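(* Let $n\ge1$, $c\in\mathbb{C}^n\setminus\{0\}$, and let $p,p_2,p_4,p_5,p_6$ be polynomials on $\mathbb{C}^n$ with $p$ non-zero and irreducible, and with $d_1=p_2p_6-p_4p_5\not\equiv 0$. Then for every entire solution $f$ on $\mathbb{C}^n$ of $$\left(p_{2}\overline{f}+p_5 f\right)^{2}+\left(p_4\overline{f}+p_6f\right)^{2}=p$$ there exist $k\in\{1,-1\}$ and an entire function $g$ on $\mathbb{C}^n$ such that $$f=\frac{b_1e^{ig}-p\,b_2e^{-ig}}{2id_1}$$ and $g$ has one of the following properties: (i) $g$ is constant; (ii) $g$ is transcendental, $\overline{g}+g$ is constant, and either $\tilde b_1\equiv b_2\equiv 0$ with $p_5$ and $p/p_2$ being non-zero constants, or $\tilde b_2\equiv b_1\equiv 0$ with $p_2$ and $p/p_5$ being non-zero constants; (iii) $(d_1)^2\,\overline{p}\,\overline{b_1}\,\overline{b_2}\equiv(\overline{d_1})^2\,p\,\tilde b_1\tilde b_2\not\equiv 0$, and either $e^{i(\overline{g}+g)}=\dfrac{\overline{d_1}\,p\,\tilde b_2}{d_1\overline{b_1}}$ is constant or $e^{i(\overline{g}-g)}=-\dfrac{\overline{d_1}\,\tilde b_1}{d_1\overline{b_1}}$ is constant.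
   Context: For a function $h$ on $\mathbb{C}^n$ and the fixed $c$, the bar denotes the shift (not complex conjugation): $\overline{h}(z)=h(z+c)$. For $k\in\{1,-1\}$ put $b_1=kp_2-ip_4$, $b_2=kp_2+ip_4$, $\tilde b_1=kp_5-ip_6$, $\tilde b_2=kp_5+ip_6$. An entire function is transcendental if it is not a polynomial. ''Irreducible'' means not a product of two non-constant polynomials; non-zero constants are allowed. *)

(* Defs.v *)
From HB Require Import structures.
From mathcomp Require Import all_boot all_order all_algebra.
From mathcomp Require Import all_classical all_reals all_analysis.
From mathcomp Require Import complex.
(* The notations of mpoly clash with those of MathComp-Analysis. *)
From mathcomp Require Import -(notations) mpoly.
Set Implicit Arguments.
Unset Strict Implicit.
Unset Printing Implicit Defensive.

Import Order.TTheory GRing.Theory Num.Theory.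
Import numFieldNormedType.Exports.

Local Open Scope ring_scope.

Section ComplexExponential.
Variable R : realType.

Definition cexp (z : R[i]) : R[i] :=
  real_complex R (expR (complex.Re z)) *
  Complex (cos (complex.Im z)) (sin (complex.Im z)).

End ComplexExponential.

(* Stated over a numFieldType because the normed-module structure that
   differentiability needs on the scalars is inferred for an abstract field but
   not for R[i]; these are used with K := R[i]. *)
Section FunctionsOnKn.
Variables (K : numFieldType) (n : nat).
Local Notation Kn := 'rV[K]_n.
Implicit Types (F N D f g h : Kn -> K) (p q r : mpoly n K) (c z : Kn).

Definition peval p : Kn -> K := fun z => meval (fun j => z ord0 j) p.

(* K-linear Frechet differentiability everywhere: holomorphy when K is C. *)
Definition entire f : Prop := forall z, differentiable f z.

Definition transcendental f : Prop :=
  entire f /\ ~ exists p, forall z, f z = peval p z.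

Definition shift_by c h : Kn -> K := fun z => h (z + c).

Definition constant_fun h : Prop := exists a : K, forall z, h z = a.

Definition constant_poly p : Prop := exists a : K, p = mpolyC n a.

Definition nonzero_constant_poly p : Prop :=
  exists a : K, a != 0 /\ p = mpolyC n a.

(* p / q is a nonzero constant *)
Definition nonzero_constant_ratio p q : Prop :=
  q != 0 /\ exists a : K, a != 0 /\ p = a *: q.

(* Nonzero constants qualify. *)
Definition irreducible_mpoly p : Prop :=
  forall q r, p = q * r -> constant_poly q \/ constant_poly r.

(* F = N / D as meromorphic functions *)
Definition eq_quotient F N D : Prop :=
  (exists z, D z != 0) /\ forall z, D z != 0 -> F z = N z / D z.

End FunctionsOnKn.

(* Main.v *)
(* Write p = (A + i B)(A - i B), with A and B the two linear forms in f(z + c) and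
   f(z). Since p is irreducible one factor has no zeros: restricted to a line in a
   non-characteristic direction of p, the zeros of A + i B are among the finitely
   many roots of p, their power sums depend holomorphically on the line and grow
   polynomially, so the factor is a polynomial times a function without zeros; the
   two polynomials multiply to p, hence one of them is constant. So
   A + i k B = e^{ig}, the other factor is p e^{-ig}, and solving the linear system
   for f(z) and f(z + c) gives the formula for f and a linear relation with
   polynomial coefficients between e^{ig(z+c)}, e^{-ig(z+c)}, e^{ig}, e^{-ig}. By
   Borel's theorem one of g, g(z+c) + g, g(z+c) - g is constant, and in the last
   two cases the relation splits into two polynomial identities.

   Borel's theorem in one variable: eliminating from a minimal relation gives
   S e^{g_i - g_j} = T with S and T bounded by a power of the growth of the
   differences; Jensen's inequality then bounds that growth by its own logarithm at
   a slightly larger radius, and iterating shows that the differences are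
   constant. *)
Require Import Defs.
From HB Require Import structures.
From mathcomp Require Import all_boot all_order all_algebra.
From mathcomp Require Import all_classical all_reals all_analysis.
From mathcomp Require Import complex.
From mathcomp Require Import -(notations) mpoly.
From mathcomp Require Import ring lra.
From mathcomp Require cyclic separable cyclotomic.
Set Implicit Arguments.
Unset Strict Implicit.
Unset Printing Implicit Defensive.

Import Order.TTheory GRing.Theory Num.Theory.
Import numFieldNormedType.Exports.

Local Open Scope ring_scope.

(** * One complex variable *)

(** No contour integral occurs: an integral along a path is the increment of a primitive, the circle
    becomes a period of the exponential, and a mean over a circle becomes an average over N-th roots
    of unity. The obstacle is the product of the zeros of one factor along a line. These zeros are
    picked among the roots of p line by line, without continuity, and even their number might vary.
    Two devices cope with this. The sum of their k-th powers is obtained from U' V, where U and V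
    are the two factors on the line, by a linear functional that kills the multiples of the
    restricted polynomial P; it is holomorphic in the line because U, V and P are. And the zeros a
    enter only through the product of the 1 - a X, whose coefficients Newton's identities compute
    from the power sums with k >= 1, whatever the number of zeros. At X = 1 this is the value at t =
    1 of the monic polynomial with these zeros. In Borel's theorem all estimates keep a free
    relative margin d between two radii: derivation consumes a part of it, and the final iteration
    takes it of the order of 2^-k. *)

Section ComplexNorm.
Variable R : realType.
Local Notation C := R[i].
Implicit Types (z w l : C).

(** The modulus as an element of [R] rather than of [R[i]], so that estimates are inequalities over
    a real field, within reach of [lra] and [nra]. *)
Definition cn z : R := Normc.normc z.

Lemma cn_normE z : `|z| = (cn z)%:C%C.
Proof. by []. Qed.

Lemma cn0 : cn 0 = 0. Proof. exact: Normc.normc0. Qed.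
Lemma cn1 : cn 1 = 1. Proof. exact: Normc.normc1. Qed.

Lemma cn_ge0 z : 0 <= cn z.
Proof. by case: z => a b; exact: sqrtr_ge0. Qed.

Lemma cn_eq0 z : (cn z == 0) = (z == 0).
Proof. by apply/eqP/eqP => [/Normc.eq0_normc //|->]; exact: cn0. Qed.

Lemma cn_gt0 z : (0 < cn z) = (z != 0).
Proof. by rewrite lt_def cn_ge0 cn_eq0 andbT. Qed.

Lemma cnM z w : cn (z * w) = cn z * cn w.
Proof. exact: Normc.normcM. Qed.

Lemma cnV z : cn z^-1 = (cn z)^-1.
Proof. exact: Normc.normcV. Qed.

Lemma cnN z : cn (- z) = cn z.
Proof. exact: normcN. Qed.

Lemma cnD z w : cn (z + w) <= cn z + cn w.
Proof. exact: le_normcD. Qed.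

Lemma cnBC z w : cn (z - w) = cn (w - z).
Proof. by rewrite -cnN opprB. Qed.

Lemma cnB z w : cn (z - w) <= cn z + cn w.
Proof. by rewrite -(cnN w) cnD. Qed.

Lemma cn_lerB z w : cn z - cn w <= cn (z - w).
Proof. by have := cnD (z - w) w; rewrite subrK; lra. Qed.

Lemma cnX z n : cn (z ^+ n) = cn z ^+ n.
Proof.
by elim: n => [|n IH]; rewrite ?expr0 ?cn1 // !exprS cnM IH.
Qed.

Lemma cn_real (x : R) : cn x%:C%C = `|x|.
Proof. by rewrite /cn /= expr0n /= addr0 sqrtr_sqr. Qed.

Lemma cn_nat n : cn n%:R = n%:R.
Proof. by rewrite -(rmorph_nat (real_complex R)) cn_real ger0_norm. Qed.

Lemma cn_sum (I : Type) (r : seq I) (P : pred I) (F : I -> C) :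
  cn (\sum_(i <- r | P i) F i) <= \sum_(i <- r | P i) cn (F i).
Proof.
elim/big_ind2: _ => [|x x' y y' h1 h2|//]; first by rewrite cn0.
by apply: le_trans (cnD _ _) _; apply: lerD.
Qed.

Lemma cn_prod (I : Type) (r : seq I) (P : pred I) (F : I -> C) :
  cn (\prod_(i <- r | P i) F i) = \prod_(i <- r | P i) cn (F i).
Proof. exact: (big_morph cn cnM cn1). Qed.

Lemma cn_Re z : `|complex.Re z| <= cn z.
Proof.
by case: z => a b; rewrite /cn /= -sqrtr_sqr ler_wsqrtr // lerDl sqr_ge0.
Qed.

Lemma cn_Im z : `|complex.Im z| <= cn z.
Proof.
by case: z => a b; rewrite /cn /= -sqrtr_sqr ler_wsqrtr // lerDr sqr_ge0.
Qed.

Lemma cn_ReIm z : cn z <= `|complex.Re z| + `|complex.Im z|.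
Proof.
case: z => a b; rewrite /cn /= -[leRHS]ger0_norm ?addr_ge0 // -sqrtr_sqr.
rewrite ler_wsqrtr // sqrrD !real_normK ?num_real //.
by rewrite addrAC lerDl mulrn_wge0 // mulr_ge0.
Qed.

Lemma cn_conj z : cn (z^*)%C = cn z.
Proof. by case: z => a b; rewrite /cn /= sqrrN. Qed.

Lemma mul_conj z : z * (z^*)%C = ((cn z) ^+ 2)%:C%C.
Proof.
case: z => a b; rewrite /cn /= sqr_sqrtr ?addr_ge0 ?sqr_ge0 //.
by simpc; rewrite -!expr2 [a * b]mulrC addNr.
Qed.

Lemma rcD (x y : R) : (x + y)%:C%C = x%:C%C + y%:C%C :> C.
Proof. by simpc. Qed.
Lemma rcB (x y : R) : (x - y)%:C%C = x%:C%C - y%:C%C :> C.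
Proof. by simpc. Qed.
Lemma rcM (x y : R) : (x * y)%:C%C = x%:C%C * y%:C%C :> C.
Proof. by simpc. Qed.

Lemma ReD z w : complex.Re (z + w) = complex.Re z + complex.Re w.
Proof. by case: z; case: w. Qed.
Lemma ReN z : complex.Re (- z) = - complex.Re z.
Proof. by case: z. Qed.
Lemma ImD z w : complex.Im (z + w) = complex.Im z + complex.Im w.
Proof. by case: z; case: w. Qed.
Lemma ImN z : complex.Im (- z) = - complex.Im z.
Proof. by case: z. Qed.
Lemma Re_sum (I : Type) (r : seq I) (P : pred I) (F : I -> C) :
  complex.Re (\sum_(i <- r | P i) F i) = \sum_(i <- r | P i) complex.Re (F i).
Proof. exact: (big_morph (@complex.Re R) ReD erefl). Qed.
Lemma Re_Mreal (x : R) z : complex.Re (x%:C%C * z) = x * complex.Re z.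
Proof. by case: z => a b; simpc. Qed.
Lemma Im_Mreal (x : R) z : complex.Im (x%:C%C * z) = x * complex.Im z.
Proof. by case: z => a b; simpc. Qed.

End ComplexNorm.

(** * Differentiability through explicit estimates *)

Section EpsilonDerivative.
Variable R : realType.
Local Notation C := R[i].
Implicit Types (F G : C -> C) (p q : R -> C) (z w l : C) (s t : R).

Definition ccont F z := forall e : R, 0 < e ->
  exists2 d : R, 0 < d & forall w, cn (w - z) < d -> cn (F w - F z) <= e.

(** Multiplying by the increment instead of dividing admits [w = z] and turns the rules of calculus
    into plain estimates; the derivative [l] is an argument, so nothing has to be chosen. *)
Definition cdiff F z l := forall e : R, 0 < e ->
  exists2 d : R, 0 < d & forall w, cn (w - z) < d ->
    cn (F w - F z - l * (w - z)) <= e * cn (w - z).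

Definition rdiff p t l := forall e : R, 0 < e ->
  exists2 d : R, 0 < d & forall s, `|s - t| < d ->
    cn (p s - p t - l * (s - t)%:C%C) <= e * `|s - t|.

Definition rcont p t := forall e : R, 0 < e ->
  exists2 d : R, 0 < d & forall s, `|s - t| < d -> cn (p s - p t) <= e.

Lemma cdiff_lip F z l : cdiff F z l ->
  exists2 d : R, 0 < d & forall w, cn (w - z) < d ->
    cn (F w - F z) <= (cn l + 1) * cn (w - z).
Proof.
move=> /(_ 1 ltr01) [d d0 h]; exists d => // w /h.
have := cnD (F w - F z - l * (w - z)) (l * (w - z)).
rewrite subrK cnM; lra.
Qed.

Lemma rdiff_lip p t l : rdiff p t l ->
  exists2 d : R, 0 < d & forall s, `|s - t| < d ->
    cn (p s - p t) <= (cn l + 1) * `|s - t|.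
Proof.
move=> /(_ 1 ltr01) [d d0 h]; exists d => // s /h.
have := cnD (p s - p t - l * (s - t)%:C%C) (l * (s - t)%:C%C).
rewrite subrK cnM cn_real; lra.
Qed.

Lemma cdiff_cont F z l : cdiff F z l -> ccont F z.
Proof.
move=> /cdiff_lip [d d0 h] e e0.
have c0 : 0 < cn l + 1 by have := cn_ge0 l; lra.
exists (Num.min d (e / (cn l + 1))); first by rewrite lt_min d0 divr_gt0.
move=> w; rewrite lt_min => /andP[/h h1 h2]; apply: le_trans h1 _.
by rewrite mulrC -ler_pdivlMr // ltW.
Qed.

Lemma rdiff_cont p t l : rdiff p t l -> rcont p t.
Proof.
move=> /rdiff_lip [d d0 h] e e0.
have c0 : 0 < cn l + 1 by have := cn_ge0 l; lra.
exists (Num.min d (e / (cn l + 1))); first by rewrite lt_min d0 divr_gt0.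
move=> w; rewrite lt_min => /andP[/h h1 h2]; apply: le_trans h1 _.
by rewrite mulrC -ler_pdivlMr // ltW.
Qed.

Lemma cdiff_cst a z : cdiff (fun=> a) z 0.
Proof.
by move=> e e0; exists 1 => // w _; rewrite subrr mul0r subr0 cn0 mulr_ge0 ?cn_ge0 ?ltW.
Qed.

Lemma cdiff_id z : cdiff id z 1.
Proof.
by move=> e e0; exists 1 => // w _; rewrite mul1r subrr cn0 mulr_ge0 ?cn_ge0 ?ltW.
Qed.

Lemma cdiffD F G z l m :
  cdiff F z l -> cdiff G z m -> cdiff (fun w => F w + G w) z (l + m).
Proof.
move=> hF hG e e0; have e20 : 0 < e / 2 by lra.
have [d d0 h] := hF _ e20; have [d' d'0 h'] := hG _ e20.
exists (Num.min d d'); first by rewrite lt_min d0.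
move=> w; rewrite lt_min => /andP[/h h1 /h' h2].
have -> : F w + G w - (F z + G z) - (l + m) * (w - z) =
   (F w - F z - l * (w - z)) + (G w - G z - m * (w - z)) by ring.
by apply: le_trans (cnD _ _) _; lra.
Qed.

Lemma cdiffM F G z l m : cdiff F z l -> cdiff G z m ->
  cdiff (fun w => F w * G w) z (l * G z + F z * m).
Proof.
move=> hF hG e e0.
have [dL dL0 hL] := cdiff_lip hF.
(* The increment splits into a product of increments and two linear error terms. Each gets a third
   of [e]; [cn l + 1] is the Lipschitz constant of [F] at [z]. *)
have e00 : 0 < e / (3 * (cn l + 2)) by apply: divr_gt0 => //; have := cn_ge0 l; lra.
have [dC dC0 hC] := cdiff_cont hG e00.
pose e1 := e / (3 * (cn (G z) + 1)); pose e2 := e / (3 * (cn (F z) + 1)).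
have e10 : 0 < e1 by apply: divr_gt0 => //; have := cn_ge0 (G z); lra.
have e20 : 0 < e2 by apply: divr_gt0 => //; have := cn_ge0 (F z); lra.
have [d1 d10 h1] := hF _ e10; have [d2 d20 h2] := hG _ e20.
exists (Num.min (Num.min dL dC) (Num.min d1 d2)).
  by rewrite !lt_min dL0 dC0 d10 d20.
move=> w; rewrite !lt_min => /andP[/andP[/hL A /hC B] /andP[/h1 D /h2 E]].
have -> : F w * G w - F z * G z - (l * G z + F z * m) * (w - z) =
  (F w - F z) * (G w - G z) + (F w - F z - l * (w - z)) * G z
  + F z * (G w - G z - m * (w - z)) by ring.
apply: le_trans (cnD _ _) _; rewrite cnM.
have := cnD ((F w - F z) * (G w - G z)) ((F w - F z - l * (w - z)) * G z).
rewrite !cnM => H; set W := cn (w - z) in A B D E *.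
have W0 : 0 <= W := cn_ge0 _.
have g0 : 0 <= cn (G z) := cn_ge0 _; have f0 : 0 <= cn (F z) := cn_ge0 _.
have l0 : 0 <= cn l := cn_ge0 _.
have k1 : cn (F w - F z) * cn (G w - G z) <= e / 3 * W.
  apply: le_trans (_ : ((cn l + 1) * W) * (e / (3 * (cn l + 2))) <= _).
    by apply: ler_pM => //; exact: cn_ge0.
  rewrite mulrAC ler_wpM2r // mulrA ler_pdivrMr; nra.
have k2 : cn (F w - F z - l * (w - z)) * cn (G z) <= e / 3 * W.
  apply: le_trans (_ : (e1 * W) * cn (G z) <= _); first exact: ler_wpM2r.
  rewrite mulrAC ler_wpM2r // /e1 mulrAC ler_pdivrMr; nra.
have k3 : cn (F z) * cn (G w - G z - m * (w - z)) <= e / 3 * W.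
  apply: le_trans (_ : cn (F z) * (e2 * W) <= _); first exact: ler_wpM2l.
  rewrite mulrA ler_wpM2r // /e2 mulrA ler_pdivrMr; nra.
lra.
Qed.

Lemma cdiff_comp F G z l m : cdiff F z l -> cdiff G (F z) m ->
  cdiff (fun w => G (F w)) z (m * l).
Proof.
move=> hF hG e e0.
have [dL dL0 hL] := cdiff_lip hF.
have l0 : 0 <= cn l := cn_ge0 _; have m0 : 0 <= cn m := cn_ge0 _.
pose e1 := e / (2 * (cn l + 1)); have e10 : 0 < e1 by apply: divr_gt0 => //; lra.
pose e2 := e / (2 * (cn m + 1)); have e20 : 0 < e2 by apply: divr_gt0 => //; lra.
have [d1 d10 h1] := hG _ e10; have [d2 d20 h2] := hF _ e20.
have [d3 d30 h3] := cdiff_cont hF (e := d1 / 2) ltac:(lra).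
exists (Num.min (Num.min dL d2) d3); first by rewrite !lt_min dL0 d20.
move=> w; rewrite !lt_min => /andP[/andP[/hL A /h2 B] /h3 D].
have := h1 (F w) ltac:(lra) => E.
have -> : G (F w) - G (F z) - m * l * (w - z) =
  (G (F w) - G (F z) - m * (F w - F z)) + m * (F w - F z - l * (w - z)) by ring.
apply: le_trans (cnD _ _) _; rewrite cnM.
set W := cn (w - z) in A B *; have W0 : 0 <= W := cn_ge0 _.
have k1 : e1 * cn (F w - F z) <= e / 2 * W.
  apply: le_trans (_ : e1 * ((cn l + 1) * W) <= _).
    by apply: ler_wpM2l A; lra.
  rewrite mulrA ler_wpM2r // /e1 mulrAC ler_pdivrMr; nra.
have k2 : cn m * cn (F w - F z - l * (w - z)) <= e / 2 * W.
  apply: le_trans (_ : cn m * (e2 * W) <= _); first exact: ler_wpM2l.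
  rewrite mulrA ler_wpM2r // /e2 mulrA ler_pdivrMr; nra.
lra.
Qed.

Lemma rdiff_comp p G t l m : rdiff p t l -> cdiff G (p t) m ->
  rdiff (fun s => G (p s)) t (m * l).
Proof.
move=> hF hG e e0.
have [dL dL0 hL] := rdiff_lip hF.
have l0 : 0 <= cn l := cn_ge0 _; have m0 : 0 <= cn m := cn_ge0 _.
pose e1 := e / (2 * (cn l + 1)); have e10 : 0 < e1 by apply: divr_gt0 => //; lra.
pose e2 := e / (2 * (cn m + 1)); have e20 : 0 < e2 by apply: divr_gt0 => //; lra.
have [d1 d10 h1] := hG _ e10; have [d2 d20 h2] := hF _ e20.
have [d3 d30 h3] := rdiff_cont hF (e := d1 / 2) ltac:(lra).
exists (Num.min (Num.min dL d2) d3); first by rewrite !lt_min dL0 d20.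
move=> w; rewrite !lt_min => /andP[/andP[/hL A /h2 B] /h3 D].
have := h1 (p w) ltac:(lra) => E.
have -> : G (p w) - G (p t) - m * l * (w - t)%:C%C =
  (G (p w) - G (p t) - m * (p w - p t)) + m * (p w - p t - l * (w - t)%:C%C) by ring.
apply: le_trans (cnD _ _) _; rewrite cnM.
set W := `|w - t| in A B *; have W0 : 0 <= W := normr_ge0 _.
have k1 : e1 * cn (p w - p t) <= e / 2 * W.
  apply: le_trans (_ : e1 * ((cn l + 1) * W) <= _).
    by apply: ler_wpM2l A; lra.
  rewrite mulrA ler_wpM2r // /e1 mulrAC ler_pdivrMr; nra.
have k2 : cn m * cn (p w - p t - l * (w - t)%:C%C) <= e / 2 * W.
  apply: le_trans (_ : cn m * (e2 * W) <= _); first exact: ler_wpM2l.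
  rewrite mulrA ler_wpM2r // /e2 mulrA ler_pdivrMr; nra.
lra.
Qed.

Lemma rdiffD p q t l m :
  rdiff p t l -> rdiff q t m -> rdiff (fun s => p s + q s) t (l + m).
Proof.
move=> hF hG e e0; have e20 : 0 < e / 2 by lra.
have [d d0 h] := hF _ e20; have [d' d'0 h'] := hG _ e20.
exists (Num.min d d'); first by rewrite lt_min d0.
move=> w; rewrite lt_min => /andP[/h h1 /h' h2].
have -> : p w + q w - (p t + q t) - (l + m) * (w - t)%:C%C =
   (p w - p t - l * (w - t)%:C%C) + (q w - q t - m * (w - t)%:C%C) by ring.
by apply: le_trans (cnD _ _) _; lra.
Qed.

Lemma cdiffZ F a z l : cdiff F z l -> cdiff (fun w => a * F w) z (a * l).
Proof.
by move=> /(cdiffM (cdiff_cst a z)); rewrite mul0r add0r.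
Qed.

Lemma cdiffN F z l : cdiff F z l -> cdiff (fun w => - F w) z (- l).
Proof.
move=> /(cdiffZ (-1)); rewrite mulN1r; congr cdiff.
by apply/funext => w; rewrite mulN1r.
Qed.

Lemma rdiffZ (a : C) p t l : rdiff p t l -> rdiff (fun s => a * p s) t (a * l).
Proof.
move=> h; apply: (rdiff_comp h (G := fun w : C => a * w)).
by have := cdiffZ a (cdiff_id (p t)); rewrite mulr1.
Qed.

Lemma rdiffN p t l : rdiff p t l -> rdiff (fun s => - p s) t (- l).
Proof.
move=> /(rdiffZ (-1)); rewrite mulN1r; congr rdiff.
by apply/funext => w; rewrite mulN1r.
Qed.

Lemma rdiff_line (a b : C) t : rdiff (fun s => a + s%:C%C * b) t b.
Proof.
move=> e e0; exists 1 => // s _.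
have -> : a + s%:C%C * b - (a + t%:C%C * b) - b * (s - t)%:C%C = 0.
  by rewrite rcB; ring.
by rewrite cn0 mulr_ge0 // ltW.
Qed.

End EpsilonDerivative.

Section DifferentiationRules.
Variable R : realType.
Local Notation C := R[i].
Implicit Types (F G : C -> C) (p q : R -> C) (z w l : C) (s t : R).

Lemma cdiff_unique F z l m : cdiff F z l -> cdiff F z m -> l = m.
Proof.
move=> h1 h2; apply/eqP; rewrite -subr_eq0; apply/negPn/negP => lm.
have e0 : 0 < cn (l - m) / 4 by rewrite divr_gt0 // cn_gt0.
have [d d0 {}h1] := h1 _ e0; have [d' d'0 {}h2] := h2 _ e0.
pose r := Num.min d d' / 2.
have r0 : 0 < r by rewrite divr_gt0 // lt_min d0.
have [rd rd'] : r < d /\ r < d'.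
  have : Num.min d d' <= d /\ Num.min d d' <= d' by split; rewrite ge_min lexx ?orbT.
  by rewrite /r in r0 *; lra.
have wz : z + r%:C%C - z = r%:C%C by ring.
have := h1 (z + r%:C%C); have := h2 (z + r%:C%C).
rewrite wz cn_real gtr0_norm // => /(_ rd') A /(_ rd) B.
have := cnB (F (z + r%:C%C) - F z - m * r%:C%C) (F (z + r%:C%C) - F z - l * r%:C%C).
have -> : F (z + r%:C%C) - F z - m * r%:C%C - (F (z + r%:C%C) - F z - l * r%:C%C)
  = (l - m) * r%:C%C by ring.
rewrite cnM cn_real gtr0_norm //; nra.
Qed.

Lemma cdiff_eq F z l m : cdiff F z l -> l = m -> cdiff F z m.
Proof. by move=> h <-. Qed.

Lemma rdiff_eq p t l m : rdiff p t l -> l = m -> rdiff p t m.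
Proof. by move=> h <-. Qed.

Lemma cdiff_inv z : z != 0 -> cdiff (fun w => w^-1) z (- (z ^- 2)).
Proof.
move=> z0 e e0; have c0 : 0 < cn z by rewrite cn_gt0.
exists (Num.min (cn z / 2) (e * cn z ^+ 3 / 2)).
  by rewrite lt_min !divr_gt0 // mulr_gt0 // exprn_gt0.
move=> w; rewrite lt_min => /andP[h1 h2].
have wz : cn z / 2 <= cn w by have := cn_lerB z w; rewrite cnBC; lra.
have w0 : w != 0 by rewrite -cn_gt0; lra.
have -> : w^-1 - z^-1 - - z ^- 2 * (w - z) = (w - z) * (w - z) / (w * z ^+ 2).
  by field; rewrite w0 z0.
rewrite !cnM cnV cnM cnX mulrAC; apply: ler_wpM2r; first exact: cn_ge0.
rewrite ler_pdivrMr; last by rewrite mulr_gt0 ?exprn_gt0 //; lra.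
apply: le_trans (ltW h2) _; rewrite -mulrA ler_wpM2l ?(ltW e0) //.
have : 0 <= cn z ^+ 2 by rewrite exprn_ge0 // ltW.
by rewrite exprS; nra.
Qed.

Lemma cdiffV F z l : cdiff F z l -> F z != 0 ->
  cdiff (fun w => (F w)^-1) z (- l / F z ^+ 2).
Proof.
move=> h F0; have := cdiff_comp h (cdiff_inv F0); congr cdiff.
by rewrite mulNr mulNr mulrC.
Qed.

Lemma cdiffX F z l n : cdiff F z l ->
  cdiff (fun w => F w ^+ n) z (n%:R * F z ^+ n.-1 * l).
Proof.
move=> h; elim: n => [|n IH].
  by rewrite !mul0r; apply: cdiff_cst.
have := cdiffM h IH; rewrite /=.
have -> : (fun w => F w * F w ^+ n) = (fun w => F w ^+ n.+1).
  by apply/funext => w; rewrite exprS.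
move=> /cdiff_eq; apply; case: n {IH} => [|n] /=.
  by rewrite !expr0; ring.
by rewrite exprS -[n.+2]addn1 natrD; ring.
Qed.

Local Open Scope classical_set_scope.

Lemma rdiff_Re_is_derive p t l : rdiff p t l ->
  is_derive t (1 : R) (fun s => complex.Re (p s)) (complex.Re l).
Proof.
move=> hp.
have H : (fun h : R => h^-1 *: ((fun s => complex.Re (p s)) (h *: (1 : R) + t)
            - complex.Re (p t)) : R^o) @ 0^' --> (complex.Re l : R^o).
  apply/cvgrPdist_le => e e0; have [d d0 h] := hp _ e0.
  near=> x.
  have x0 : x != 0 by near: x; exact: nbhs_dnbhs_neq.
  have xd : `|x| < d by near: x; exact: dnbhs0_lt.
  have -> : x *: (1 : R) = x by rewrite /GRing.scale /= mulr1.
  have := h (x + t); rewrite addrK => /(_ xd) B.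
  have := le_trans (cn_Re _) B; rewrite !ReD !ReN [l * _]mulrC Re_Mreal => {}B.
  set y := _ - complex.Re (p t) in B *.
  have -> : complex.Re l - x^-1 *: y = - ((y - x * complex.Re l) / x).
    by rewrite /GRing.scale /=; field.
  by rewrite normrN normrM normfV ler_pdivrMr ?normr_gt0.
by split; [apply/cvg_ex; exists (complex.Re l) | apply/cvg_lim].
Unshelve. all: by end_near.
Qed.

End DifferentiationRules.

(** * Curves in the plane: mean value inequality and primitives *)

Section Curves.
Variable R : realType.
Local Notation C := R[i].
Implicit Types (F G : C -> C) (p q : R -> C) (z w l : C) (s t : R).
Local Open Scope classical_set_scope.

Lemma is_derive_eps (x : R -> R) t a : is_derive t (1 : R) x a ->
  forall e, 0 < e -> exists2 d : R, 0 < d & forall s, `|s - t| < d ->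
    `|x s - x t - a * (s - t)| <= e * `|s - t|.
Proof.
move=> [/cvg_ex [b hb] ab] e e0.
have {}ab : b = a by rewrite -ab; apply/esym/cvg_lim.
rewrite ab in hb.
move/cvgrPdist_le: hb => /(_ e e0); rewrite /dnbhs withinE /=.
move=> [B /nbhs_ballP [d /= d0 hd] hB].
exists d => // s st; have [->|nst] := eqVneq s t.
  by rewrite !subrr mulr0 subr0 normr0 mulr0.
have : (B `&` [set x | x != 0]) (s - t).
  by split => /=; [apply: hd; rewrite /ball /= sub0r normrN|rewrite subr_eq0].
rewrite -hB => -[/= h _].
have st0 : s - t != 0 by rewrite subr_eq0.
move: h; rewrite /GRing.scale /= mulr1 subrK.
rewrite -(ler_pM2r (x := `|s - t|)) ?normr_gt0 // -normrM.
rewrite -normrN; congr (`| _ | <= _); field.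
by rewrite subr_eq0.
Qed.

Lemma rdiff_Complex (x y : R -> R) t a b :
  is_derive t (1 : R) x a -> is_derive t (1 : R) y b ->
  rdiff (fun s => Complex (x s) (y s)) t (Complex a b).
Proof.
move=> hx hy e e0; have e20 : 0 < e / 2 by lra.
have [d d0 h] := is_derive_eps hx e20.
have [d' d'0 h'] := is_derive_eps hy e20.
exists (Num.min d d'); first by rewrite lt_min d0.
move=> s; rewrite lt_min => /andP[/h h1 /h' h2].
apply: le_trans (cn_ReIm _) _; rewrite !(ReD, ReN, ImD, ImN) /=.
rewrite !mulr0 !subr0 !add0r; lra.
Qed.

(* Apply the real mean value theorem to the real part of p rotated so that the
   increment of p becomes a non-negative real. *)
Lemma rdiff_mvt p (p' : R -> C) a b M : a <= b ->
  (forall t, a <= t <= b -> rdiff p t (p' t)) ->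
  (forall t, a <= t <= b -> cn (p' t) <= M) ->
  cn (p b - p a) <= M * (b - a).
Proof.
move=> ab hp hM; have [E|N] := eqVneq (p b) (p a).
  rewrite E subrr cn0; have := hM a; rewrite lexx ab => /(_ isT).
  by have := cn_ge0 (p' a); nra.
pose D := p b - p a; have D0 : 0 < cn D by rewrite cn_gt0 subr_eq0.
pose q t := ((D)^*)%C * p t.
have hq t : a <= t <= b ->
    is_derive t (1 : R) (fun s => complex.Re (q s)) (complex.Re (((D)^*)%C * p' t)).
  by move=> /hp h; apply: rdiff_Re_is_derive; apply: rdiffZ.
have [||c] := @MVT_segment _ (fun s => complex.Re (q s))
    (fun t => complex.Re (((D)^*)%C * p' t)) a b ab.
- by move=> x /[!in_itv] /= /andP[h1 h2]; apply: hq; rewrite !ltW.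
- by apply: derivable_within_continuous => x /[!in_itv] /= /hq [].
rewrite in_itv /= => hc; rewrite -ReN -ReD /q -mulrBr -/D mulrC mul_conj /= => E.
have := le_trans (ler_norm _) (cn_Re (((D)^*)%C * p' c)).
rewrite cnM cn_conj => H; have := hM c hc => H2.
have : cn D ^+ 2 <= cn D * (M * (b - a)).
  rewrite E mulrA ler_wpM2r ?subr_ge0 //; apply: le_trans H _.
  by rewrite ler_pM2l.
by rewrite expr2 ler_pM2l.
Qed.

Lemma rdiff_cst_eq p a b : a <= b ->
  (forall t, a <= t <= b -> rdiff p t 0) -> p b = p a.
Proof.
move=> ab hp; apply/eqP; rewrite -subr_eq0 -cn_eq0 eq_le cn_ge0 andbT.
have := @rdiff_mvt p (fun=> 0) a b 0 ab hp; rewrite mul0r.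
by apply=> t _; rewrite cn0.
Qed.

Lemma rcont_Re p t : rcont p t -> {for t, continuous (fun s => complex.Re (p s))}.
Proof.
move=> h; apply/cvgrPdist_le => e e0; have [d d0 hd] := h _ e0.
apply/nbhs_ballP; exists d => //= s; rewrite /ball /= distrC => /hd H.
by rewrite distrC -ReN -ReD; apply: le_trans (cn_Re _) H.
Qed.

Lemma rcont_Im p t : rcont p t -> {for t, continuous (fun s => complex.Im (p s))}.
Proof.
move=> h; apply/cvgrPdist_le => e e0; have [d d0 hd] := h _ e0.
apply/nbhs_ballP; exists d => //= s; rewrite /ball /= distrC => /hd H.
by rewrite distrC -ImN -ImD; apply: le_trans (cn_Im _) H.
Qed.

Lemma real_primitive (x : R -> R) : continuous x ->
  exists X : R -> R, forall t, 0 <= t <= 1 -> is_derive t (1 : R) X (x t).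
Proof.
move=> hx; exists (fun y => \int[lebesgue_measure]_(t in `[(-1)%R, y]) (x t))%R.
move=> t /andP[t0 t1].
have [] := @continuous_FTC1_closed _ x (-1) t 2.
- lra.
- apply: continuous_compact_integrable; first exact: segment_compact.
  exact: continuous_subspaceT.
- lra.
- exact: hx.
by move=> h1 h2; rewrite -h2; rewrite derive1E; exact: derivableP.
Qed.

Lemma curve_primitive p : (forall t, rcont p t) ->
  exists q, forall t, 0 <= t <= 1 -> rdiff q t (p t).
Proof.
move=> hp.
have [X hX] := real_primitive (fun t => rcont_Re (hp t)).
have [Y hY] := real_primitive (fun t => rcont_Im (hp t)).
exists (fun s => Complex (X s) (Y s)) => t ht.
by have := rdiff_Complex (hX t ht) (hY t ht); case: (p t).
Qed.

End Curves.

(** * Limits of complex sequences *)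

Section Limits.
Variable R : realType.
Local Notation C := R[i].
Implicit Types (u v : nat -> C) (a b z : C).

Definition ulim u a := forall e : R, 0 < e ->
  exists N : nat, forall n, (N <= n)%N -> cn (u n - a) <= e.

Lemma small_eq0 z : (forall e : R, 0 < e -> cn z <= e) -> z = 0.
Proof.
move=> h; apply/eqP; rewrite -cn_eq0 eq_le cn_ge0 andbT.
by apply/ler_addgt0Pr => e /h; rewrite add0r.
Qed.

Lemma ulim_le u a b (B : R) : ulim u a ->
  (exists N : nat, forall n, (N <= n)%N -> cn (u n - b) <= B) -> cn (a - b) <= B.
Proof.
move=> hu [N hN]; apply/ler_addgt0Pr => e /hu[M hM].
have := hN (maxn N M) (leq_maxl _ _); have := hM (maxn N M) (leq_maxr _ _).
have := cnB (u (maxn N M) - b) (u (maxn N M) - a).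
rewrite (_ : _ - _ - _ = a - b); [lra|ring].
Qed.

Lemma ulim_unique u a b : ulim u a -> ulim u b -> a = b.
Proof.
move=> ha hb; apply/eqP; rewrite -subr_eq0; apply/eqP/small_eq0 => e e0.
by apply: (ulim_le ha); exact: hb.
Qed.

Lemma ulim_cst a : ulim (fun=> a) a.
Proof. by move=> e e0; exists 0%N => n _; rewrite subrr cn0 ltW. Qed.

Lemma ulimD u v a b : ulim u a -> ulim v b -> ulim (fun n => u n + v n) (a + b).
Proof.
move=> hu hv e e0; have e20 : 0 < e / 2 by lra.
have [N hN] := hu _ e20; have [M hM] := hv _ e20.
exists (maxn N M) => n; rewrite geq_max => /andP[/hN h1 /hM h2].
have := cnD (u n - a) (v n - b).
rewrite (_ : u n - a + (v n - b) = u n + v n - (a + b)); [lra|ring].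
Qed.

Lemma ulimZ u a b : ulim u a -> ulim (fun n => b * u n) (b * a).
Proof.
move=> hu e e0; have b0 := cn_ge0 b.
have [|N hN] := hu (e / (cn b + 1)); first by rewrite divr_gt0 //; lra.
exists N => n /hN; rewrite -mulrBr cnM ler_pdivlMr; last by lra.
have := cn_ge0 (u n - a); nra.
Qed.

Lemma ulim_sum (I : Type) (r : seq I) (P : pred I) (u_ : I -> nat -> C) (a_ : I -> C) :
  (forall i, P i -> ulim (u_ i) (a_ i)) ->
  ulim (fun n => \sum_(i <- r | P i) u_ i n) (\sum_(i <- r | P i) a_ i).
Proof.
move=> h; elim: r => [|i r IH].
  by rewrite big_nil; under eq_fun do rewrite big_nil; exact: ulim_cst.
under eq_fun do rewrite big_cons; rewrite big_cons; case: ifP => // Pi.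
by apply: ulimD => //; exact: h.
Qed.

Lemma ulim_shift u a k : ulim u a -> ulim (fun n => u (n + k)%N) a.
Proof.
move=> h e /h [N hN]; exists N => n hn; apply: hN.
by apply: leq_trans hn _; rewrite leq_addr.
Qed.

Lemma real_cauchy (x : nat -> R) : (forall e : R, 0 < e ->
    exists N, forall m n, (N <= m)%N -> (N <= n)%N -> `|x m - x n| <= e) ->
  exists a : R, forall e : R, 0 < e ->
    exists N, forall n, (N <= n)%N -> `|x n - a| <= e.
Proof.
move=> h; have cx : cauchy_ex (x @ \oo)%classic.
  move=> e e0; have e20 : 0 < e / 2 by lra.
  have [N hN] := h _ e20; exists (x N); exists N => // n /= hn.
  rewrite /ball /=; apply: le_lt_trans (hN _ _ (leqnn N) hn) _; lra.
have /cauchy_cvg cv : cauchy (x @ \oo)%classic by apply/cauchy_exP.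
exists (lim (x @ \oo)%classic) => e e0.
move/cvgrPdist_le : cv => /(_ e e0) [N _ hN]; exists N => n hn.
by rewrite distrC; apply: hN.
Qed.

Lemma ulim_cauchy u : (forall e : R, 0 < e ->
    exists N, forall m n, (N <= m)%N -> (N <= n)%N -> cn (u m - u n) <= e) ->
  exists a, ulim u a.
Proof.
move=> h.
have [a ha] : exists a : R, forall e : R, 0 < e ->
    exists N, forall n, (N <= n)%N -> `|complex.Re (u n) - a| <= e.
  apply: real_cauchy => e /h [N hN]; exists N => m n hm hn.
  by rewrite -ReN -ReD; apply: le_trans (cn_Re _) (hN _ _ hm hn).
have [b hb] : exists b : R, forall e : R, 0 < e ->
    exists N, forall n, (N <= n)%N -> `|complex.Im (u n) - b| <= e.
  apply: real_cauchy => e /h [N hN]; exists N => m n hm hn.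
  by rewrite -ImN -ImD; apply: le_trans (cn_Im _) (hN _ _ hm hn).
exists (Complex a b) => e e0; have e20 : 0 < e / 2 by lra.
have [N hN] := ha _ e20; have [M hM] := hb _ e20.
exists (maxn N M) => n; rewrite geq_max => /andP[/hN h1 /hM h2].
by apply: le_trans (cn_ReIm _) _; rewrite !(ReD, ReN, ImD, ImN) /=; lra.
Qed.

Lemma expr_small (q B e : R) : 0 <= q < 1 -> 0 < e ->
  exists N : nat, forall n, (N <= n)%N -> B * q ^+ n <= e.
Proof.
move=> /andP[q0 q1] e0.
have /cvgrPdist_le/(_ (e / (`|B| + 1))) :=
  @cvg_expr R q ltac:(by rewrite ger0_norm).
move=> [|N _ hN]; first by rewrite divr_gt0 // ltr_wpDl.
exists N => n /hN /=; rewrite sub0r normrN (ger0_norm (exprn_ge0 _ q0)).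
rewrite ler_pdivlMr ?ltr_wpDl // => h; apply: le_trans h.
rewrite mulrC; apply: ler_wpM2l; first exact: exprn_ge0.
by have := ler_norm B; lra.
Qed.

Lemma geom_bound (q : R) m n : 0 <= q < 1 ->
  \sum_(m <= k < n) q ^+ k <= q ^+ m / (1 - q).
Proof.
move=> /andP[q0 q1]; have [mn|mn] := leqP m n; last first.
  rewrite big_geq ?(ltnW mn) // divr_ge0 ?exprn_ge0 //; lra.
have -> : \sum_(m <= k < n) q ^+ k = (q ^+ m - q ^+ n) / (1 - q).
  elim: n mn => [|n IH].
    by rewrite leqn0 => /eqP ->; rewrite big_geq // subrr mul0r.
  rewrite leq_eqVlt => /orP[/eqP <-|]; first by rewrite big_geq // subrr mul0r.
  move=> mn; rewrite big_nat_recr //= IH // exprS; field; lra.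
rewrite ler_pM2r ?invr_gt0; last by lra.
by have := exprn_ge0 n q0; lra.
Qed.

End Limits.

(** * Goursat's theorem and primitives of entire functions *)

Section Goursat.
Variable R : realType.
Local Notation C := R[i].
Implicit Types (F G : C -> C) (p q : R -> C) (z w l a b c : C) (s t : R).
Local Open Scope classical_set_scope.

(** The integral of [F] over the segment from [a] to [b], as the increment of any primitive of the
    pulled-back integrand. [segintE] shows that the primitive does not matter; for continuous [F]
    one exists, and the default 0 is not taken. *)
Definition segint F a b : C :=
  xget 0 [set v | exists q, (forall t, 0 <= t <= 1 ->
    rdiff q t (F (a + t%:C%C * (b - a)) * (b - a))) /\ v = q 1 - q 0].

Lemma segintE F a b q : (forall t, 0 <= t <= 1 ->
    rdiff q t (F (a + t%:C%C * (b - a)) * (b - a))) ->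
  segint F a b = q 1 - q 0.
Proof.
move=> hq; rewrite /segint; case: xgetP => [_ -> [q' [hq' ->]]|]; last first.
  by move=> /(_ (q 1 - q 0)) /=; case; exists q.
have := @rdiff_cst_eq _ (fun t => q' t + - q t) 0 1 ler01.
move=> /(_ _)/wrap[|E].
  by move=> t ht; apply: rdiff_eq (rdiffD (hq' t ht) (rdiffN (hq t ht))) _; ring.
apply/eqP; rewrite -subr_eq0; apply/eqP.
by rewrite -[RHS](subrr (q' 1 + - q 1)) {2}E; ring.
Qed.


Lemma segint_ex F a b : (forall z, ccont F z) ->
  exists q, (forall t, 0 <= t <= 1 ->
    rdiff q t (F (a + t%:C%C * (b - a)) * (b - a))).
Proof.
move=> hF; have [|q hq] := @curve_primitive R (fun t => F (a + t%:C%C * (b - a))).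
  move=> t e e0; have [d d0 hd] := hF (a + t%:C%C * (b - a)) e e0.
  have [d' d'0 hd'] := rdiff_cont (rdiff_line a (b - a) t) (e := d / 2) ltac:(lra).
  by exists d' => // s /hd' h; apply: hd; lra.
exists (fun t => (b - a) * q t) => t /hq h.
by rewrite mulrC; apply: rdiffZ.
Qed.

Lemma rdiff_affine p (a0 b0 : R) t l : rdiff p (a0 + b0 * t) l ->
  rdiff (fun s => p (a0 + b0 * s)) t (l * b0%:C%C).
Proof.
move=> h e e0; have b1 : 0 < `|b0| + 1 by rewrite ltr_wpDl.
have [|d d0 hd] := h (e / (`|b0| + 1)); first by rewrite divr_gt0.
exists (d / (`|b0| + 1)); first by rewrite divr_gt0.
move=> s; rewrite ltr_pdivlMr // => st.
have E : a0 + b0 * s - (a0 + b0 * t) = b0 * (s - t) by ring.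
have st0 : 0 <= `|s - t| := normr_ge0 _.
have := hd (a0 + b0 * s); rewrite E normrM => /(_ _)/wrap[|].
  by apply: le_lt_trans st; nra.
rewrite rcM mulrA => H; apply: le_trans H _.
rewrite mulrA ler_wpM2r // mulrAC ler_pdivrMr //; nra.
Qed.

Lemma segint_rev F a b : (forall z, ccont F z) -> segint F b a = - segint F a b.
Proof.
move=> hF; have [q hq] := segint_ex a b hF.
rewrite (segintE hq) (@segintE _ _ _ (fun s => q (1 + (-1) * s))).
  by rewrite mulr1 mulr0 subrr addr0; ring.
move=> t ht; have ht' : 0 <= 1 + -1 * t <= 1 by lra.
apply: rdiff_eq (rdiff_affine (hq _ ht')) _.
have -> : b + t%:C%C * (a - b) = a + (1 + -1 * t)%:C%C * (b - a).
  by rewrite rcD rcM rmorphN1 rmorph1; ring.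
by rewrite rmorphN1; ring.
Qed.

Lemma half_rc : (2^-1 : R)%:C%C = 2^-1 :> C.
Proof. by rewrite fmorphV /= rmorph_nat. Qed.

Lemma segint_split F a b : (forall z, ccont F z) ->
  segint F a b = segint F a ((a + b) / 2) + segint F ((a + b) / 2) b.
Proof.
move=> hF; have [q hq] := segint_ex a b hF.
rewrite (segintE hq) (@segintE _ a ((a + b) / 2) (fun s => q (0 + 2^-1 * s))).
  rewrite (@segintE _ ((a + b) / 2) b (fun s => q (2^-1 + 2^-1 * s))).
    rewrite mulr1 !mulr0 !(add0r, addr0) (_ : 2^-1 + 2^-1 = 1 :> R); last by lra.
    by ring.
  move=> t ht; have ht' : 0 <= 2^-1 + 2^-1 * t <= 1 by lra.
  apply: rdiff_eq (rdiff_affine (hq _ ht')) _.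
  have -> : (a + b) / 2 + t%:C%C * (b - (a + b) / 2) =
            a + (2^-1 + 2^-1 * t)%:C%C * (b - a).
    by rewrite rcD rcM half_rc; field.
  by rewrite half_rc; field.
move=> t ht; have ht' : 0 <= 0 + 2^-1 * t <= 1 by lra.
apply: rdiff_eq (rdiff_affine (hq _ ht')) _.
have -> : a + t%:C%C * ((a + b) / 2 - a) = a + (0 + 2^-1 * t)%:C%C * (b - a).
  by rewrite rcD rcM half_rc rmorph0; field.
by rewrite half_rc; field.
Qed.

(** The mean value inequality for the difference of two primitives. It serves with an affine [L] in
    [goursat] and with a constant [L] in [entire_primitive]. *)
Lemma segint_approx F Q L a b (e : R) : (forall z, ccont F z) ->
  (forall z, cdiff Q z (L z)) ->
  (forall t, 0 <= t <= 1 -> cn (F (a + t%:C%C * (b - a)) - L (a + t%:C%C * (b - a))) <= e) ->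
  cn (segint F a b - (Q b - Q a)) <= e * cn (b - a).
Proof.
move=> hF hQ he; have [q hq] := segint_ex a b hF.
rewrite (segintE hq).
have := @rdiff_mvt _ (fun t => q t + - Q (a + t%:C%C * (b - a))) (fun t =>
  (F (a + t%:C%C * (b - a)) - L (a + t%:C%C * (b - a))) * (b - a)) 0 1 (e * cn (b - a)) ler01.
rewrite subr0 mulr1 rmorph1 rmorph0.
have -> : a + 1 * (b - a) = b by ring.
have -> : a + 0 * (b - a) = a by ring.
have -> : q 1 + - Q b - (q 0 + - Q a) = q 1 - q 0 - (Q b - Q a) by ring.
apply.
  move=> t ht; apply: rdiff_eq (rdiffD (hq t ht) (rdiffN _)) _.
    exact: rdiff_comp (rdiff_line a (b - a) t) (hQ _).
  by ring.
by move=> t ht; rewrite cnM ler_wpM2r ?cn_ge0 ?he.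
Qed.

Definition tri F (T : C * C * C) : C :=
  let: (a, b, c) := T in segint F a b + segint F b c + segint F c a.

Definition perim (T : C * C * C) : R :=
  let: (a, b, c) := T in cn (b - a) + cn (c - b) + cn (a - c).

(** Three corner triangles and the medial one, oriented so that each inner edge is run through once
    in each direction and cancels in the sum. *)
Definition subtri (T : C * C * C) (i : 'I_4) : C * C * C :=
  let: (a, b, c) := T in
  let ab := (a + b) / 2 in let bc := (b + c) / 2 in let ca := (c + a) / 2 in
  nth T [:: (a, ab, ca); (ab, b, bc); (ca, bc, c); (bc, ca, ab)] i.

Lemma tri_subtri F T : (forall z, ccont F z) ->
  tri F T = \sum_(i < 4) tri F (subtri T i).
Proof.
move=> hF; case: T => [[a b] c]; rewrite !big_ord_recl big_ord0 /=.
rewrite (segint_split a b hF) (segint_split b c hF) (segint_split c a hF).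
rewrite (segint_rev ((a + b) / 2) ((c + a) / 2) hF).
rewrite (segint_rev ((b + c) / 2) ((a + b) / 2) hF).
rewrite (segint_rev ((c + a) / 2) ((b + c) / 2) hF).
by ring.
Qed.

Lemma cn_half z : cn (z / 2) = cn z / 2.
Proof. by rewrite cnM cnV cn_nat. Qed.

Lemma perim_subtri T i : perim (subtri T i) = perim T / 2.
Proof.
case: T => [[a b] c].
have h1 (x y z : C) : (x + y) / 2 - (y + z) / 2 = (x - z) / 2 by field.
have h2 (x y z : C) : (x + y) / 2 - (x + z) / 2 = (y - z) / 2 by field.
have h3 (x y z : C) : (y + x) / 2 - (z + x) / 2 = (y - z) / 2 by field.
have h4 (x y z : C) : (y + x) / 2 - (x + z) / 2 = (y - z) / 2 by field.
have h5 (x y : C) : (x + y) / 2 - x = (y - x) / 2 by field.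
have h6 (x y : C) : (x + y) / 2 - y = (x - y) / 2 by field.
have h7 (x y : C) : x - (x + y) / 2 = (x - y) / 2 by field.
have h8 (x y : C) : y - (x + y) / 2 = (y - x) / 2 by field.
have h9 (x y z : C) : (x + y) / 2 - (z + x) / 2 = (y - z) / 2 by field.
case: i => -[|[|[|[|//]]]] hi /=;
 rewrite ?(h5, h6, h7, h8, h4, h9, h1) ?cn_half;
 rewrite ?(cnBC a b) ?(cnBC b c) ?(cnBC c a); lra.
Qed.

(** Makes the first vertices of the nested triangles in [goursat] a Cauchy sequence, since the
    perimeters are halved. *)
Lemma subtri_vertex T i : cn ((subtri T i).1.1 - T.1.1) <= perim T.
Proof.
case: T => [[a b] c] /=.
have := cn_ge0 (b - a); have := cn_ge0 (c - b); have := cn_ge0 (a - c).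
case: i => -[|[|[|[|//]]]] hi /=.
- by rewrite subrr cn0; lra.
- have -> : (a + b) / 2 - a = (b - a) / 2 by field.
  by rewrite cn_half; lra.
- have -> : (c + a) / 2 - a = (c - a) / 2 by field.
  by rewrite cn_half (cnBC c a); lra.
- have -> : (b + c) / 2 - a = (b - a) / 2 + (c - a) / 2 by field.
  by have := cnD ((b - a) / 2) ((c - a) / 2); rewrite !cn_half (cnBC c a); lra.
Qed.

Lemma tri_pigeon F T : (forall z, ccont F z) ->
  exists i, cn (tri F T) <= 4 * cn (tri F (subtri T i)).
Proof.
move=> hF; apply/not_existsP => h.
have {}h i : cn (tri F (subtri T i)) < cn (tri F T) / 4.
  by have /negP := h i; rewrite -ltNge; lra.
have := cn_sum (index_enum 'I_4) xpredT (fun i => tri F (subtri T i)).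
rewrite -(tri_subtri T hF) !big_ord_recl big_ord0.
have := h ord0; have := h (lift ord0 ord0); have := h (lift ord0 (lift ord0 ord0)).
have := h (lift ord0 (lift ord0 (lift ord0 ord0))); lra.
Qed.

(** Bisection: the integral over [T] is at most [4 ^ n] times that over a nested triangle of
    perimeter [P / 2 ^ n]. Near the limit point [F] is affine up to a small multiple of the
    perimeter, and the affine part contributes nothing because it has the primitive [Q]. *)
Lemma goursat F T : (forall z, exists l, cdiff F z l) -> tri F T = 0.
Proof.
move=> dF; have hF z : ccont F z by have [l /cdiff_cont] := dF z.
pose next S := subtri S (xget ord0 [set i | cn (tri F S) <= 4 * cn (tri F (subtri S i))]).
have nextP S : cn (tri F S) <= 4 * cn (tri F (next S)).
  rewrite /next; case: xgetP => [i -> //|h].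
  by have [i hi] := tri_pigeon S hF; have := h i.
pose Tn n := iter n next T.
pose P := perim T; have P0 : 0 <= P.
  by rewrite /P; case: (T) => [[a b] c] /=; rewrite !addr_ge0 ?cn_ge0.
have perimTn n : perim (Tn n) = P / 2 ^+ n.
  elim: n => [|n IH]; first by rewrite divr1.
  by rewrite /Tn iterS perim_subtri -/(Tn n) IH exprS; field; rewrite expf_neq0.
have triTn n : cn (tri F T) <= 4 ^+ n * cn (tri F (Tn n)).
  elim: n => [|n IH]; first by rewrite expr0 mul1r.
  apply: le_trans IH _; rewrite exprS -mulrA mulrCA.
  by apply: ler_wpM2l; [exact: exprn_ge0|exact: (nextP (Tn n))].
pose a_ n := (Tn n).1.1.
have half01 : 0 <= (2^-1 : R) < 1 by lra.
have stepa n : cn (a_ n.+1 - a_ n) <= P * 2^-1 ^+ n.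
  by rewrite exprVn -perimTn; apply: subtri_vertex.
have diffa m n : (m <= n)%N -> cn (a_ n - a_ m) <= P * 2^-1 ^+ m * 2.
  move=> mn; apply: le_trans (_ : \sum_(m <= k < n) P * 2^-1 ^+ k <= _).
    elim: n mn => [|n IH].
      by rewrite leqn0 => /eqP ->; rewrite subrr cn0 big_geq.
    rewrite leq_eqVlt => /orP[/eqP ->|]; first by rewrite subrr cn0 big_geq.
    move=> mn; rewrite big_nat_recr //=; have := cnD (a_ n.+1 - a_ n) (a_ n - a_ m).
    by rewrite addrA subrK; have := IH mn; have := stepa n; lra.
  rewrite -mulr_sumr -mulrA ler_wpM2l //.
  apply: le_trans (geom_bound _ _ half01) _.
  by rewrite (_ : 1 - 2^-1 = 2^-1 :> R) ?invrK //; lra.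
have [p hp] : exists x : C, ulim a_ x.
  apply: ulim_cauchy => e e0.
  have [N hN] := expr_small (P * 2) half01 e0.
  exists N => m n; wlog mn : m n / (m <= n)%N.
    by move=> W; case/orP: (leq_total m n) => h ? ?; [|rewrite cnBC]; apply: W.
  by move=> hm _; rewrite cnBC; apply: le_trans (diffa m n mn) _; rewrite mulrAC; exact: hN.
have ap n : cn (a_ n - p) <= perim (Tn n) * 2.
  rewrite cnBC; apply: (ulim_le hp); exists n => m /diffa h.
  by rewrite perimTn -exprVn.
have [l hl] := dF p.
pose Q z := F p * z + l / 2 * (z - p) ^+ 2.
have hQ z : cdiff Q z (F p + l * (z - p)).
  have h1 := cdiffZ (F p) (cdiff_id z).
  have h2 := cdiffX 2 (cdiffD (cdiff_id z) (cdiff_cst (- p) z)).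
  by apply: cdiff_eq (cdiffD h1 (cdiffZ (l / 2) h2)) _; rewrite expr1; field.
apply: small_eq0 => e e0.
(* The final error is [4 ^ N * (4 * e1 * L ^ 2) = 4 * e1 * P ^ 2] with [L = P / 2 ^ N]; the added 1
   keeps the denominator positive when [P = 0]. *)
have [|d d0 hd] := hl (e / (4 * P ^+ 2 + 1)).
  by rewrite divr_gt0 // ltr_wpDl // mulr_ge0 // sqr_ge0.
have [N hN] := expr_small (4 * P) half01 (e := d / 2) ltac:(lra).
have {hN} := hN N (leqnn N); rewrite exprVn -mulrA -perimTn => dN.
have := triTn N; have := ap N; have := perimTn N.
rewrite /a_; case: (Tn N) dN => [[a b] c] /= dN pN aN.
set L := _ + _ + _ in dN pN aN *.
have L0 : 0 <= L by rewrite !addr_ge0 ?cn_ge0.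
set e1 := e / _ in hd.
have e10 : 0 <= e1 by rewrite /e1 divr_ge0 ?(ltW e0) // addr_ge0 // mulr_ge0 // sqr_ge0.
(* [a] is within [2 * L] of [p], hence every vertex within [3 * L] and every point of a side within
   [4 * L]. *)
have near_p z : cn (z - p) <= 4 * L -> cn (F z - (F p + l * (z - p))) <= e1 * (4 * L).
  move=> zp; rewrite opprD addrA; apply: le_trans (hd z _) _; first lra.
  exact: ler_wpM2l.
have on_seg x y : cn (x - p) <= 3 * L -> cn (y - x) <= L ->
    cn (segint F x y - (Q y - Q x)) <= e1 * (4 * L) * cn (y - x).
  move=> xp yx; apply: (segint_approx hF hQ) => t /andP[t0 t1]; apply: near_p.
  have := cnD (x - p) (t%:C%C * (y - x)).
  rewrite cnM cn_real ger0_norm // addrAC; have := cn_ge0 (y - x); nra.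
have [[g1 g2] g3] := (cn_ge0 (b - a), cn_ge0 (c - b), cn_ge0 (a - c)).
have s1 := on_seg a b ltac:(lra) ltac:(rewrite /L; lra).
have bp : cn (b - p) <= 3 * L.
  by have := cnD (b - a) (a - p); rewrite addrA subrK /L in aN *; lra.
have cp : cn (c - p) <= 3 * L.
  by have := cnD (c - a) (a - p); rewrite addrA subrK (cnBC c a) /L in aN *; lra.
have s2 := on_seg b c bp ltac:(rewrite /L; lra).
have s3 := on_seg c a cp ltac:(rewrite /L; lra).
move=> tT; apply: le_trans tT _.
have -> : segint F a b + segint F b c + segint F c a =
  (segint F a b - (Q b - Q a)) + (segint F b c - (Q c - Q b))
  + (segint F c a - (Q a - Q c)) by ring.
have tL : cn ((segint F a b - (Q b - Q a)) + (segint F b c - (Q c - Q b))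
  + (segint F c a - (Q a - Q c))) <= e1 * 4 * L ^+ 2.
  apply: le_trans (cnD _ _) _.
  have := cnD (segint F a b - (Q b - Q a)) (segint F b c - (Q c - Q b)).
  have -> : e1 * 4 * L ^+ 2 = e1 * (4 * L) * cn (b - a) + e1 * (4 * L) * cn (c - b) +
     e1 * (4 * L) * cn (a - c) by rewrite /L; ring.
  lra.
apply: le_trans (_ : 4 ^+ N * (e1 * 4 * L ^+ 2) <= _).
  by rewrite ler_wpM2l // exprn_ge0.
rewrite pN expr_div_n -exprM mulnC exprM (_ : 2 ^+ 2 = 4 :> R); last by ring.
have -> : 4 ^+ N * (e1 * 4 * (P ^+ 2 / 4 ^+ N)) = e1 * 4 * P ^+ 2.
  by field; rewrite expf_neq0.
rewrite /e1; have P2 : 0 <= P ^+ 2 := sqr_ge0 P.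
have -> : e / (4 * P ^+ 2 + 1) * 4 * P ^+ 2 = e * (4 * P ^+ 2) / (4 * P ^+ 2 + 1).
  by ring.
rewrite ler_pdivrMr; last by lra.
by rewrite ler_wpM2l ?(ltW e0) //; lra.
Qed.

(** On the triangle 0, z, w Goursat's theorem turns the increment of [segint F 0] into an integral
    over one short segment, where [F] is nearly the constant [F z]. *)
Theorem entire_primitive F : (forall z, exists l, cdiff F z l) ->
  exists G, forall z, cdiff G z (F z).
Proof.
move=> dF; have hF z : ccont F z by have [l /cdiff_cont] := dF z.
exists (segint F 0) => z e e0; have [d d0 hd] := hF z e e0.
exists d => // w wz.
have -> : segint F 0 w - segint F 0 z = segint F z w.
  have := goursat (0, z, w) dF => /=; rewrite (segint_rev 0 w hF) => /eqP.
  by rewrite subr_eq0 => /eqP <-; ring.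
have := @segint_approx F (fun x => F z * x) (fun=> F z) z w e hF.
rewrite -mulrBr; apply.
  by move=> x; apply: cdiff_eq (cdiffZ (F z) (cdiff_id x)) _; rewrite mulr1.
move=> t /andP[t0 t1]; apply: hd; rewrite [z + _]addrC addrK cnM cn_real ger0_norm //.
by apply: le_lt_trans wz; have := cn_ge0 (w - z); nra.
Qed.

End Goursat.

(** * Exponential and logarithm *)

Section ComplexExpLog.
Variable R : realType.
Local Notation C := R[i].
Implicit Types (F G : C -> C) (p q : R -> C) (z w l a b c : C) (s t x y : R).
Local Open Scope classical_set_scope.

Definition jcont (g : C -> C -> C) := forall s0 t0 : C, forall e : R, 0 < e ->
  exists2 d : R, 0 < d & forall s t : C, cn (s - s0) < d -> cn (t - t0) < d ->
    cn (g s t - g s0 t0) <= e.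

(** Compactness is that of a box in the fourfold product of [R], which contains the bidisc once both
    variables are split into real and imaginary parts. *)
Lemma bidisc_bounded g r : jcont g ->
  exists M : R, forall s t : C, cn s <= r -> cn t <= r -> cn (g s t) <= M.
Proof.
move=> hg; have [r0|r0] := ltP r 0.
  by exists 0 => s t sr; have := cn_ge0 s; lra.
pose f (x : (R * R) * (R * R)) : R :=
  cn (g (Complex x.1.1 x.1.2) (Complex x.2.1 x.2.2)).
pose I := `[- r, r].
have cI : compact ((I `*` I) `*` (I `*` I)).
  by do 2!apply: compact_setX; try (apply: compact_setX); exact: segment_compact.
have cf : continuous f.
  move=> x; apply/cvgrPdist_le => e e0.
  have [d d0 hd] := hg (Complex x.1.1 x.1.2) (Complex x.2.1 x.2.2) e e0.
  apply: (proj2 (@nbhs_ballP R ((R * R) * (R * R))%type x _)).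
  exists (d / 2) => /=; first by lra.
  move=> [[y1 y2] [y3 y4]] /=; rewrite /ball /= /prod_ball /= /ball /=.
  move=> [[h1 h2] [h3 h4]]; rewrite distrC.
  apply: le_trans (_ : cn (g (Complex y1 y2) (Complex y3 y4) -
    g (Complex x.1.1 x.1.2) (Complex x.2.1 x.2.2)) <= _).
    by rewrite ler_norml cn_lerB andbT lerNl opprB cnBC cn_lerB.
  have {}h1 : `|x.1.1 - y1| < d / 2 := h1.
  have {}h2 : `|x.1.2 - y2| < d / 2 := h2.
  have {}h3 : `|x.2.1 - y3| < d / 2 := h3.
  have {}h4 : `|x.2.2 - y4| < d / 2 := h4.
  rewrite distrC in h1; rewrite distrC in h2; rewrite distrC in h3; rewrite distrC in h4.
  by apply: hd; apply: le_lt_trans (cn_ReIm _) _; rewrite !(ReD, ReN, ImD, ImN) /=;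
    lra.
have [|m _ hm] := @compact_EVT_max _ _ f _ _ cI (continuous_subspaceT cf).
  by exists ((0, 0), (0, 0)); rewrite /I /= !in_itv /=; split; split; lra.
exists (f m) => s t sr tr.
have := hm ((complex.Re s, complex.Im s), (complex.Re t, complex.Im t)).
rewrite /f /=; case: s t sr tr => [s1 s2] [t1 t2] /= sr tr; apply.
rewrite inE /= /I /= !in_itv /=.
have := cn_Re (Complex s1 s2); have := cn_Im (Complex s1 s2).
have := cn_Re (Complex t1 t2); have := cn_Im (Complex t1 t2).
rewrite /= => h1 h2 h3 h4.
have n1 := le_trans h1 tr; have n2 := le_trans h2 tr.
have n3 := le_trans h3 sr; have n4 := le_trans h4 sr.
by rewrite !ler_norml in n1 n2 n3 n4.
Qed.

Lemma disc_bounded F r : (forall z, ccont F z) ->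
  exists M : R, forall z, cn z <= r -> cn (F z) <= M.
Proof.
move=> hF; have [|M hM] := @bidisc_bounded (fun z _ => F z) r.
  by move=> s0 t0 e e0; have [d d0 hd] := hF s0 e e0; exists d => // s t /hd.
exists M => z zr; apply: (hM z 0) => //; rewrite cn0.
exact: le_trans (cn_ge0 z) zr.
Qed.

Lemma cexpE z : cexp z = Complex (expR (complex.Re z) * cos (complex.Im z))
  (expR (complex.Re z) * sin (complex.Im z)).
Proof. by rewrite /cexp; simpc. Qed.

Lemma cexpD z w : cexp (z + w) = cexp z * cexp w.
Proof.
rewrite !cexpE ReD ImD expRD cosD sinD; simpc.
by congr Complex; ring.
Qed.

Lemma cexp0 : cexp 0 = 1 :> C.
Proof. by rewrite cexpE /= expR0 cos0 sin0 mulr1 mulr0. Qed.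

Lemma cexpN z : cexp (- z) * cexp z = 1.
Proof. by rewrite -cexpD addNr cexp0. Qed.

Lemma cexp_neq0 z : cexp z != 0.
Proof.
by apply/eqP => h; have := cexpN z; rewrite h mulr0 => /esym/eqP; rewrite oner_eq0.
Qed.

Lemma cexpNV z : cexp (- z) = (cexp z)^-1.
Proof. by apply: (mulIf (cexp_neq0 z)); rewrite cexpN mulVf ?cexp_neq0. Qed.

Lemma cexpMn z n : cexp (n%:R * z) = cexp z ^+ n.
Proof.
elim: n => [|n IH]; first by rewrite mul0r cexp0.
by rewrite -natr1 mulrDl mul1r cexpD IH exprSr.
Qed.

Lemma cn_cexp z : cn (cexp z) = expR (complex.Re z).
Proof.
rewrite cexpE /cn /= !exprMn -mulrDr cos2Dsin2 mulr1 sqrtr_sqr.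
by rewrite ger0_norm // expR_ge0.
Qed.

Lemma cdiff_cexp z : cdiff (@cexp R) z (cexp z).
Proof.
suff h0 : cdiff (@cexp R) 0 1.
  have h : cdiff (fun w => w - z) z 1.
    by apply: cdiff_eq (cdiffD (cdiff_id z) (cdiff_cst (- z) z)) _; rewrite addr0.
  have h1 : cdiff (fun w => cexp (w - z)) z (1 * 1).
    by apply: (cdiff_comp h); rewrite subrr.
  have := cdiffZ (cexp z) h1; rewrite !mulr1; congr cdiff.
  by apply/funext => w; rewrite -cexpD addrC subrK.
move=> e e0; have e80 : 0 < e / 8 by lra.
have [d1 d10 h1] := is_derive_eps (is_derive_expR 0) e80.
have [d2 d20 h2] := rdiff_Complex (is_derive_cos 0) (is_derive_sin 0) e80.
exists (Num.min (Num.min d1 d2) (Num.min 1 (e / 4))).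
  by rewrite !lt_min d10 d20 ltr01 /= divr_gt0.
move=> w; rewrite subr0 !lt_min => /andP[/andP[w1 w2] /andP[w3 w4]].
case: w w1 w2 w3 w4 => a b; set w := Complex a b => w1 w2 w3 w4.
have aw : `|a| <= cn w := cn_Re w; have bw : `|b| <= cn w := cn_Im w.
have := h1 a; rewrite subr0 expR0 mul1r => /(_ (le_lt_trans aw w1)) A.
have := h2 b; rewrite subr0 cos0 sin0 => /(_ (le_lt_trans bw w2)) B.
set cs := Complex (cos b) (sin b) in B.
have csn : cn cs = 1 by rewrite /cn /= cos2Dsin2 sqrtr1.
(* The real estimates for [expR], [cos] and [sin] at 0 bound the first two terms; the third is
   quadratic in [w]. *)
have -> : cexp w - cexp 0 - 1 * w =
   (expR a - 1 - a)%:C%C * cs + (1 + a)%:C%C * (cs - Complex 1 0 - Complex (- 0) 1 * b%:C%C)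
   + 'i%C * a%:C%C * b%:C%C.
  rewrite cexp0 /cexp /= /w /cs; simpc.
  by apply/eqP; rewrite eq_complex /=; apply/andP; split; apply/eqP; ring.
have i1 : cn ('i%C : C) = 1 by rewrite /cn /= expr0n expr1n add0r sqrtr1.
apply: le_trans (cnD _ _) _.
have := cnD ((expR a - 1 - a)%:C%C * cs) ((1 + a)%:C%C * (cs - Complex 1 0 - Complex (- 0) 1 * b%:C%C)).
rewrite !cnM !cn_real csn i1 mulr1 mul1r => H.
have a1 : `|1 + a| <= 2 by have := ler_normD 1 a; rewrite normr1; lra.
have k1 : `|1 + a| * cn (cs - Complex 1 0 - Complex (- 0) 1 * b%:C%C) <= 2 * (e / 8 * `|b|).
  by apply: ler_pM => //; exact: cn_ge0.
have k2 : `|a| * `|b| <= e / 4 * cn w.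
  by apply: ler_pM => //; lra.
have k3 : e / 8 * `|a| <= e / 8 * cn w by rewrite ler_pM2l.
have k4 : e / 8 * `|b| <= e / 8 * cn w by rewrite ler_pM2l.
nra.
Qed.

Lemma cdiff_cst_eq F : (forall z, cdiff F z 0) -> forall z w, F z = F w.
Proof.
move=> h z w; have := @rdiff_cst_eq _ (fun t => F (w + t%:C%C * (z - w))) 0 1 ler01.
rewrite rmorph1 rmorph0 mul1r mul0r addr0 [w + _]addrC subrK; apply => t _.
by apply: rdiff_eq (rdiff_comp (rdiff_line w (z - w) t) (h _)) _; rewrite mul0r.
Qed.

(** The principal logarithm on the right half-plane: the [atan] of the quotient is the argument only
    when the real part is positive. *)
Definition cln z : C := Complex (ln (cn z)) (atan (complex.Im z / complex.Re z)).

Lemma cexp_cln z : 0 < complex.Re z -> cexp (cln z) = z.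
Proof.
case: z => a b /= a0; rewrite cexpE /=.
have n0 : 0 < cn (Complex a b).
  by apply: lt_le_trans a0 _; apply: le_trans (ler_norm _) (cn_Re (Complex a b)).
have E : Num.sqrt (1 + (b / a) ^+ 2) = cn (Complex a b) / a.
  have -> : 1 + (b / a) ^+ 2 = (a ^+ 2 + b ^+ 2) * a^-1 ^+ 2.
    by field; rewrite gt_eqF.
  rewrite sqrtrM ?addr_ge0 ?sqr_ge0 // sqrtr_sqr ger0_norm //.
  by rewrite invr_ge0 ltW.
have T : tan (atan (b / a)) = b / a := atanK _.
have Cn : cos (atan (b / a)) = a / cn (Complex a b).
  by rewrite cos_atan E invf_div.
have S : sin (atan (b / a)) = b / cn (Complex a b).
  have : sin (atan (b / a)) = tan (atan (b / a)) * cos (atan (b / a)).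
    by rewrite /tan mulfVK // Cn mulf_neq0 ?invr_eq0 // gt_eqF.
  by rewrite T Cn => ->; rewrite mulrA divfK // gt_eqF.
rewrite lnK ?posrE // Cn S; by congr Complex; rewrite mulrC divfK // gt_eqF.
Qed.

Lemma cont_eps (f : R -> R) x : {for x, continuous f} -> forall e, 0 < e ->
  exists2 d : R, 0 < d & forall y, `|y - x| < d -> `|f y - f x| <= e.
Proof.
move=> /cvgrPdist_le h e /h /nbhs_ballP[d /= d0 hd]; exists d => // y yx.
by rewrite distrC; apply: hd; rewrite /ball /= distrC.
Qed.

Lemma ccont_cln z : 0 < complex.Re z -> ccont cln z.
Proof.
move=> a0 e e0; have e20 : 0 < e / 2 by lra.
have n0 : 0 < cn z.
  by apply: lt_le_trans a0 _; apply: le_trans (ler_norm _) (cn_Re _).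
have [d1 d10 h1] := cont_eps (continuous_ln n0) e20.
have [d2 d20 h2] := cont_eps (@continuous_atan R (complex.Im z / complex.Re z)) e20.
set a := complex.Re z in a0 h2 *; set b := complex.Im z in h2 *.
(* A Lipschitz constant at [z] for the quotient of imaginary by real part, valid as long as the real
   part stays above [a / 2]. *)
pose k := (a + `|b| + 1) * 2 / a ^+ 2.
have k0 : 0 < k by rewrite divr_gt0 ?exprn_gt0 // mulr_gt0 // ltr_wpDl // addr_ge0 // ltW.
exists (Num.min (Num.min d1 (a / 2)) (d2 / k)).
  by rewrite !lt_min d10 (divr_gt0 d20 k0) (divr_gt0 a0).
move=> w; rewrite !lt_min => /andP[/andP[w1 w2] w3].
have ra : `|complex.Re w - a| <= cn (w - z) by rewrite -ReN -ReD; exact: cn_Re.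
have ib : `|complex.Im w - b| <= cn (w - z) by rewrite -ImN -ImD; exact: cn_Im.
apply: le_trans (cn_ReIm _) _; rewrite !(ReD, ReN, ImD, ImN) /=.
have nw : `|cn w - cn z| < d1.
  by apply: le_lt_trans w1; rewrite ler_norml cn_lerB andbT lerNl opprB cnBC cn_lerB.
have wa : a / 2 < complex.Re w.
  by have := le_lt_trans ra w2; rewrite ltr_norml; lra.
have q : `|complex.Im w / complex.Re w - b / a| < d2.
  have -> : complex.Im w / complex.Re w - b / a =
     ((complex.Im w - b) * a - b * (complex.Re w - a)) / (complex.Re w * a).
    by field; rewrite !gt_eqF //; lra.
  apply: le_lt_trans (_ : cn (w - z) * k < _); last by rewrite -ltr_pdivlMr.
  have wa0 : 0 < complex.Re w * a by rewrite mulr_gt0 //; lra.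
  rewrite normrM normfV (gtr0_norm wa0) ler_pdivrMr //.
  apply: le_trans (_ : cn (w - z) * (a + `|b|) <= _).
    apply: le_trans (ler_normB _ _) _; rewrite !normrM (gtr0_norm a0).
    have := ler_wpM2r (ltW a0) ib; have := ler_wpM2l (normr_ge0 b) ra; lra.
  rewrite -mulrA ler_wpM2l ?cn_ge0 // /k.
  have b0 := normr_ge0 b; rewrite mulrAC ler_pdivlMr ?exprn_gt0 // -mulrA.
  apply: ler_pM; [lra|exact: sqr_ge0|lra|rewrite expr2; nra].
have := h1 _ nw; have := h2 _ q; lra.
Qed.

(** A nonzero derivative of [F] gives [cn (G w - G z) * (cn l / 2) <= cn (w - z)], which converts
    the error of [F], small against [G w - G z], into one small against [w - z]. *)
Lemma cdiff_local_inverse F G z l : cdiff F (G z) l -> l != 0 -> ccont G z ->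
  (exists2 d : R, 0 < d & forall w, cn (w - z) < d -> F (G w) = w) ->
  cdiff G z l^-1.
Proof.
move=> hF l0 cG [d0 d00 FG] e e0.
have nl : 0 < cn l by rewrite cn_gt0.
pose e1 := Num.min (cn l / 2) (e * cn l ^+ 2 / 2).
have e10 : 0 < e1 by rewrite lt_min !divr_gt0 // mulr_gt0 // exprn_gt0.
have [d1 d10 h1] := hF _ e10.
have [d2 d20 h2] := cG (d1 / 2) ltac:(lra).
exists (Num.min d0 d2); first by rewrite lt_min d00.
move=> w; rewrite lt_min => /andP[w0 /h2 w2].
have := h1 (G w) ltac:(lra); rewrite FG // FG ?subrr ?cn0 // => A.
have [E1 E2] : e1 <= cn l / 2 /\ e1 <= e * cn l ^+ 2 / 2.
  by split; rewrite ge_min lexx ?orbT.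
have g0 := cn_ge0 (G w - G z).
have B : cn (G w - G z) * (cn l / 2) <= cn (w - z).
  have := cnB (w - z) (w - z - l * (G w - G z)).
  rewrite opprB addrC subrK cnM; nra.
have -> : G w - G z - l^-1 * (w - z) = - (l^-1 * (w - z - l * (G w - G z))).
  by field.
rewrite cnN cnM cnV mulrC ler_pdivrMr //; apply: le_trans A _.
have w0' := cn_ge0 (w - z).
apply: le_trans (_ : e * cn l ^+ 2 / 2 * cn (G w - G z) <= _); first nra.
have -> : e * cn l ^+ 2 / 2 * cn (G w - G z) = e * cn l * (cn (G w - G z) * (cn l / 2)).
  by field.
rewrite [leRHS]mulrAC; apply: ler_wpM2l => //.
by rewrite mulr_ge0 // ltW.
Qed.

Lemma cdiff_cln z : 0 < complex.Re z -> cdiff cln z z^-1.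
Proof.
move=> z0; apply: (@cdiff_local_inverse (@cexp R)).
- by have := cdiff_cexp (cln z); rewrite cexp_cln.
- by apply/eqP => h; rewrite h /= ltxx in z0.
- exact: ccont_cln.
exists (complex.Re z) => // w wz; apply: cexp_cln.
have := le_lt_trans (cn_Re (w - z)) wz; rewrite ReD ReN ltr_norml; lra.
Qed.

End ComplexExpLog.

(** * Entire functions of one variable and Taylor's formula *)

Section Taylor.
Variable R : realType.
Local Notation C := R[i].
Implicit Types (F G : C -> C) (z w l a b c : C) (s t x y r : R).

Definition ent F := forall z, exists l, cdiff F z l.

Lemma ent_cont F : ent F -> forall z, ccont F z.
Proof. by move=> h z; have [l /cdiff_cont] := h z. Qed.

Lemma ent_cst a : ent (fun=> a).
Proof. by move=> z; exists 0; exact: cdiff_cst. Qed.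

Lemma ent_id : ent id.
Proof. by move=> z; exists 1; exact: cdiff_id. Qed.

Lemma ent_exp : ent (@cexp R).
Proof. by move=> z; exists (cexp z); exact: cdiff_cexp. Qed.

Lemma entD F G : ent F -> ent G -> ent (fun z => F z + G z).
Proof.
by move=> hF hG z; have [l hl] := hF z; have [m hm] := hG z; exists (l + m); apply: cdiffD.
Qed.

Lemma entM F G : ent F -> ent G -> ent (fun z => F z * G z).
Proof.
move=> hF hG z; have [l hl] := hF z; have [m hm] := hG z.
by exists (l * G z + F z * m); apply: cdiffM.
Qed.

Lemma entN F : ent F -> ent (fun z => - F z).
Proof. by move=> hF z; have [l hl] := hF z; exists (- l); apply: cdiffN. Qed.

Lemma entB F G : ent F -> ent G -> ent (fun z => F z - G z).
Proof. by move=> hF hG; apply: entD => //; exact: entN. Qed.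

Lemma ent_comp F G : ent F -> ent G -> ent (fun z => G (F z)).
Proof.
by move=> hF hG z; have [l hl] := hF z; have [m hm] := hG (F z); exists (m * l); apply: cdiff_comp.
Qed.

Lemma entV F : ent F -> (forall z, F z != 0) -> ent (fun z => (F z)^-1).
Proof. by move=> hF F0 z; have [l hl] := hF z; exists (- l / F z ^+ 2); apply: cdiffV. Qed.

Lemma ent_sum (I : Type) (s : seq I) (P : pred I) (F_ : I -> C -> C) :
  (forall i, P i -> ent (F_ i)) -> ent (fun z => \sum_(i <- s | P i) F_ i z).
Proof.
move=> h; elim: s => [|i s IH]; first by under eq_fun do rewrite big_nil; exact: ent_cst.
case Pi: (P i); under eq_fun do rewrite big_cons Pi; last exact: IH.
by apply: entD => //; exact: h.
Qed.

Lemma ent_prod (I : Type) (s : seq I) (P : pred I) (F_ : I -> C -> C) :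
  (forall i, P i -> ent (F_ i)) -> ent (fun z => \prod_(i <- s | P i) F_ i z).
Proof.
move=> h; elim: s => [|i s IH]; first by under eq_fun do rewrite big_nil; exact: ent_cst.
case Pi: (P i); under eq_fun do rewrite big_cons Pi; last exact: IH.
by apply: entM => //; exact: h.
Qed.

Lemma entX F n : ent F -> ent (fun z => F z ^+ n).
Proof.
by move=> h; elim: n => [|n IH]; [exact: ent_cst|under eq_fun do rewrite exprS; exact: entM].
Qed.

Lemma ent_horner (p : {poly C}) : ent (fun z => p.[z]).
Proof.
under eq_fun do rewrite horner_coef.
by apply: ent_sum => i _; apply: entM; [exact: ent_cst|exact: entX ent_id].
Qed.

Lemma ent_bounded F r : ent F -> exists M : R, forall z, cn z <= r -> cn (F z) <= M.
Proof. by move=> h; exact: (disc_bounded r (ent_cont h)). Qed.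

Definition twopi : R := pi *+ 2.
Definition twopii : C := twopi%:C%C * 'i%C.

Lemma twopi_gt0 : 0 < twopi.
Proof. by rewrite /twopi mulrn_wgt0 // pi_gt0. Qed.

Lemma cn_i : cn ('i%C : C) = 1.
Proof. by rewrite /cn /= expr0n expr1n add0r sqrtr1. Qed.

Lemma cn_twopii : cn twopii = twopi.
Proof. by rewrite cnM cn_real cn_i mulr1 ger0_norm // ltW // twopi_gt0. Qed.

Lemma twopii_neq0 : twopii != 0.
Proof. by rewrite -cn_gt0 cn_twopii twopi_gt0. Qed.

Lemma rdiff_cst a t : rdiff (fun=> a) t 0.
Proof.
by move=> e e0; exists 1 => // s _; rewrite subrr mul0r subr0 cn0 mulr_ge0 // ltW.
Qed.

Lemma cexp_period z : cexp (z + twopii) = cexp z.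
Proof.
rewrite !cexpE ReD ImD /twopii Re_Mreal Im_Mreal /= mulr0 mulr1 addr0.
by rewrite /twopi cosD2pi sinD2pi.
Qed.

(* The increment over a period of a primitive of [F (w + exp om)] is independent
   of om; letting [Re om] tend to -oo identifies it. *)
Lemma period_primitive F w G : ent F ->
  (forall om, cdiff G om (F (w + cexp om))) ->
  forall om, G (om + twopii) - G om = twopii * F w.
Proof.
move=> hF hG om; pose D z := G (z + twopii) + - G z.
have D0 z : cdiff D z 0.
  have hs : cdiff (fun v => v + twopii) z 1.
    by apply: cdiff_eq (cdiffD (cdiff_id z) (cdiff_cst twopii z)) _; rewrite addr0.
  apply: cdiff_eq (cdiffD (cdiff_comp hs (hG _)) (cdiffN (hG z))) _.
  by rewrite mulr1 cexp_period subrr.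
apply/eqP; rewrite -subr_eq0; apply/eqP/small_eq0 => e e0.
have [|d d0 hd] := ent_cont hF w (e := e / twopi).
  by rewrite divr_gt0 // twopi_gt0.
pose z : C := (ln (d / 2))%:C%C.
rewrite -[G _ - G om]/(D om) (cdiff_cst_eq D0 om z) /D.
have := @rdiff_mvt _ (fun t => G (z + t%:C%C * twopii) + - ((t%:C%C * twopii) * F w))
  (fun t => (F (w + cexp (z + t%:C%C * twopii)) - F w) * twopii) 0 1 e ler01.
rewrite subr0 mulr1 rmorph1 rmorph0 !mul1r !mul0r addr0 subr0.
rewrite (_ : G (z + twopii) + _ - G z = G (z + twopii) + - G z - twopii * F w); last by ring.
apply=> t _.
  have h1 := rdiff_comp (rdiff_line z twopii t) (hG _).
  have h2 := rdiffZ (- F w) (rdiff_line 0 twopii t).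
  have := rdiffD h1 h2; congr (rdiff _ t _); last by ring.
  by apply/funext => s; rewrite add0r; ring.
rewrite cnM cn_twopii -ler_pdivlMr ?twopi_gt0 //; apply: hd.
rewrite [w + _]addrC addrK cn_cexp ReD Re_Mreal /twopii Re_Mreal /=.
by rewrite !mulr0 addr0 lnK ?posrE; lra.
Qed.

(** Cauchy's formulas in logarithmic coordinates. The coefficient is the increment over a period of
    a primitive of [F (exp om) * exp (- n om)], divided by [twopii]; being independent of [om], it
    serves all radii at once. The remainder is the same increment for [F z] times the tail of the
    geometric series in [w / z]. *)
Lemma taylor F : ent F -> exists a : nat -> C, forall r (M : R), 0 < r ->
  (forall z, cn z = r -> cn (F z) <= M) ->
  (forall n, cn (a n) <= M / r ^+ n) /\
  (forall w N, cn w < r -> cn (F w - \sum_(n < N) a n * w ^+ n)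
     <= M * (cn w / r) ^+ N / (1 - cn w / r)).
Proof.
move=> hF.
have hE n : ent (fun om => F (cexp om) * cexp (- (n%:R * om))).
  apply: entM; first exact: ent_comp ent_exp hF.
  apply: (@ent_comp (fun om => - (n%:R * om))) ent_exp.
  by apply/entN/entM; [exact: ent_cst|exact: ent_id].
have [Gn hGn] := choice (fun n => entire_primitive (hE n)).
pose a n := (Gn n twopii - Gn n 0) / twopii.
have aE n om : Gn n (om + twopii) - Gn n om = twopii * a n.
  rewrite /a mulrC divfK ?twopii_neq0 //.
  have D0 z : cdiff (fun v => Gn n (v + twopii) + - Gn n v) z 0.
    have hs : cdiff (fun v => v + twopii) z 1.
      by apply: cdiff_eq (cdiffD (cdiff_id z) (cdiff_cst twopii z)) _; rewrite addr0.
    apply: cdiff_eq (cdiffD (cdiff_comp hs (hGn n _)) (cdiffN (hGn n z))) _.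
    rewrite mulr1 cexp_period mulrDr opprD cexpD.
    have -> : cexp (- (n%:R * twopii)) = 1 :> C.
      by rewrite cexpNV cexpMn -[twopii]add0r cexp_period cexp0 expr1n invr1.
    by rewrite mulr1 subrr.
  by rewrite (cdiff_cst_eq D0 om 0) add0r.
exists a => r M r0 hM.
pose sg t : C := (ln r)%:C%C + t%:C%C * 'i%C.
pose z t := cexp (sg t).
have cz t : cn (z t) = r.
  by rewrite cn_cexp /sg ReD Re_Mreal /= mulr0 addr0 lnK ?posrE.
have z0 t : z t != 0 by exact: cexp_neq0.
have sg_per : sg twopi = sg 0 + twopii by rewrite /sg rmorph0 mul0r addr0.
have Fz t : cn (F (z t)) <= M by apply: hM; exact: cz.
have M0 : 0 <= M := le_trans (cn_ge0 _) (Fz 0).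
have tp := twopi_gt0.
split=> [n|w N wr].
  have := @rdiff_mvt _ (fun t => Gn n (sg t))
    (fun t => F (z t) * cexp (- (n%:R * sg t)) * 'i%C) 0 twopi (M / r ^+ n) (ltW tp).
  rewrite sg_per aE cnM cn_twopii subr0 [twopi * _]mulrC ler_pM2r //; apply.
    by move=> t _; exact: rdiff_comp (rdiff_line _ _ t) (hGn n _).
  move=> t _; rewrite 2!cnM cn_i mulr1 cexpNV cexpMn -/(z t) cnV cnX cz.
  by rewrite ler_wpM2r // invr_ge0 exprn_ge0 // ltW.
have [E hEd] := entire_primitive (ent_comp (entD (ent_cst w) ent_exp) hF).
(* Chosen so that [w + exp (om t)] runs through the circle of radius [r] around 0. Since [cn w < r],
   the argument of [cln] has positive real part and [om] still increases by exactly one period. *)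
pose om t := sg t + cln (1 - w / z t).
have wz t : cn (w / z t) = cn w / r by rewrite cnM cnV cz.
have wr1 : cn w / r < 1 by rewrite ltr_pdivrMr // mul1r.
have re1 t : 0 < complex.Re (1 - w / z t).
  rewrite ReD ReN /=; have := le_trans (ler_norm _) (cn_Re (w / z t)).
  by rewrite wz; lra.
have om_exp t : w + cexp (om t) = z t.
  rewrite /om cexpD cexp_cln // -/(z t); field; exact: z0.
have n1 t : 1 - w / z t != 0 by apply/eqP => h; have := re1 t; rewrite h /= ltxx.
have zw t : z t - w != 0.
  apply/eqP => h; have := n1 t; have -> : 1 - w / z t = (z t - w) / z t by field.
  by rewrite h mul0r eqxx.
have hsg t : rdiff sg t 'i%C := rdiff_line _ _ t.
have hz t : rdiff z t (z t * 'i%C) := rdiff_comp (hsg t) (cdiff_cexp _).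
have hq t : rdiff (fun s => 1 - w / z s) t (w / z t * 'i%C).
  have h := rdiff_comp (hz t) (G := fun v => 1 - w * v^-1) (m := 0 + - (w * - (z t ^- 2))).
  apply: rdiff_eq (h _) _; last by field.
  by apply: cdiffD (cdiff_cst 1 _) (cdiffN (cdiffZ w (cdiff_inv (z0 t)))).
have hom t : rdiff om t ('i%C / (1 - w / z t)).
  apply: rdiff_eq (rdiffD (hsg t) (rdiff_comp (hq t) (cdiff_cln (re1 t)))) _.
  by field; rewrite z0 zw.
have om_per : om twopi = om 0 + twopii.
  have zper : z twopi = z 0 by rewrite /z sg_per cexp_period.
  by rewrite /om zper sg_per; ring.
have := @rdiff_mvt _ (fun t => E (om t) + - \sum_(n < N) w ^+ n * Gn n (sg t))
  (fun t => F (z t) * 'i%C * ((w / z t) ^+ N / (1 - w / z t))) 0 twopi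
  (M * (cn w / r) ^+ N / (1 - cn w / r)) (ltW tp).
have -> : E (om twopi) + - (\sum_(n < N) w ^+ n * Gn n (sg twopi)) -
    (E (om 0) + - (\sum_(n < N) w ^+ n * Gn n (sg 0))) =
    twopii * (F w - \sum_(n < N) a n * w ^+ n).
  have hS : \sum_(n < N) w ^+ n * Gn n (sg 0 + twopii) -
      \sum_(n < N) w ^+ n * Gn n (sg 0) = twopii * \sum_(n < N) a n * w ^+ n.
    by rewrite -sumrB mulr_sumr; apply: eq_bigr => n _; rewrite -mulrBr aE; ring.
  by rewrite om_per sg_per mulrBr -(period_primitive hF hEd (om 0)) -hS; ring.
rewrite cnM cn_twopii subr0 [twopi * _]mulrC ler_pM2r //; apply.
  move=> t _.
  have hsum : rdiff (fun s => \sum_(n < N) w ^+ n * Gn n (sg s)) t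
      (\sum_(n < N) w ^+ n * (F (z t) * cexp (- (n%:R * sg t)) * 'i%C)).
    elim: (index_enum _) => [|n l IH].
      by under eq_fun do rewrite big_nil; rewrite big_nil; exact: rdiff_cst.
    under eq_fun do rewrite big_cons; rewrite big_cons; apply: rdiffD IH.
    by apply: rdiffZ; exact: rdiff_comp (hsg t) (hGn n _).
  have h1 := rdiff_comp (hom t) (hEd _).
  apply: rdiff_eq (rdiffD h1 (rdiffN hsum)) _; rewrite om_exp.
  have -> : \sum_(n < N) w ^+ n * (F (z t) * cexp (- (n%:R * sg t)) * 'i%C) =
            F (z t) * 'i%C * \sum_(n < N) (w / z t) ^+ n.
    rewrite mulr_sumr; apply: eq_bigr => n _.
    by rewrite cexpNV cexpMn -/(z t) expr_div_n; ring.
  have G : (1 - w / z t) * \sum_(n < N) (w / z t) ^+ n = 1 - (w / z t) ^+ N.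
    have := subrXX 1 (w / z t) N; rewrite expr1n => ->; congr (_ * _);
    by apply: eq_bigr => n _; rewrite expr1n mul1r.
  have -> : \sum_(n < N) (w / z t) ^+ n = (1 - (w / z t) ^+ N) / (1 - w / z t).
    by rewrite -G [_ * \sum_(_ < _) _]mulrC mulfK.
  by ring.
move=> t _; rewrite !cnM cn_i mulr1 cnX cnV wz -mulrA.
apply: ler_pM => //; first exact: cn_ge0.
  by rewrite mulr_ge0 ?exprn_ge0 ?invr_ge0 ?cn_ge0 // divr_ge0 ?cn_ge0 // ltW.
apply: ler_wpM2l; first by rewrite exprn_ge0 // divr_ge0 ?cn_ge0 // ltW.
rewrite lef_pV2 ?posrE; [|by rewrite cn_gt0|by rewrite subr_gt0].
by have := cn_lerB 1 (w / z t); rewrite cn1 wz.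
Qed.

End Taylor.

(** * Everywhere convergent power series *)

Section PowerSeries.
Variable R : realType.
Local Notation C := R[i].
Implicit Types (F G H : C -> C) (a b c : nat -> C) (z w l : C) (r M : R).
Local Open Scope classical_set_scope.

(** Infinite radius of convergence, in the form of Cauchy's estimates at every radius. *)
Definition rapid a := forall r, 0 < r ->
  exists2 M : R, 0 <= M & forall n, cn (a n) <= M / r ^+ n.

Definition ps a w N : C := \sum_(n < N) a n * w ^+ n.

Definition psum a w : C := xget 0 [set v | ulim (ps a w) v].

Lemma ps_tail a r M w m n : 0 < r -> 0 <= M ->
  (forall k, cn (a k) <= M / r ^+ k) -> cn w < r -> (m <= n)%N ->
  cn (ps a w n - ps a w m) <= M * ((cn w / r) ^+ m / (1 - cn w / r)).
Proof.
move=> r0 M0 ha wr mn.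
have q01 : 0 <= cn w / r < 1.
  by rewrite divr_ge0 ?cn_ge0 ?(ltW r0) //= ltr_pdivrMr // mul1r.
rewrite /ps -!(big_mkord xpredT (fun k => a k * w ^+ k)).
rewrite (big_cat_nat (leq0n m) mn) /= addrAC subrr add0r.
apply: le_trans (cn_sum _ _ _) _.
apply: le_trans (_ : \sum_(m <= k < n) M * (cn w / r) ^+ k <= _).
  apply: ler_sum => k _; rewrite cnM cnX expr_div_n [M * _]mulrA [M * _ * _]mulrAC.
  by apply: ler_wpM2r; [rewrite exprn_ge0 ?cn_ge0|exact: ha].
by rewrite -mulr_sumr ler_wpM2l // geom_bound.
Qed.

Lemma psumP a : rapid a -> forall w, ulim (ps a w) (psum a w).
Proof.
move=> ha w; rewrite /psum; case: xgetP => [v -> //|h].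
suff [v hv] : exists v, ulim (ps a w) v by have := h v.
have w0 := cn_ge0 w; pose r := 2 * (cn w + 1).
have r0 : 0 < r by rewrite /r; lra.
have [M M0 hM] := ha r r0.
have wr : cn w < r by rewrite /r; lra.
have q01 : 0 <= cn w / r < 1.
  by rewrite divr_ge0 ?cn_ge0 ?(ltW r0) //= ltr_pdivrMr // mul1r.
apply: ulim_cauchy => e e0.
have [N hN] := expr_small (M / (1 - cn w / r)) q01 e0.
exists N => m n; wlog mn : m n / (m <= n)%N.
  by move=> W; case/orP: (leq_total m n) => h' ? ?; [|rewrite cnBC]; apply: W.
move=> hm _; rewrite cnBC; apply: le_trans (ps_tail r0 M0 hM wr mn) _.
by rewrite mulrCA mulrC; exact: hN.
Qed.

Lemma psum_eq a w v : rapid a -> ulim (ps a w) v -> psum a w = v.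
Proof. by move=> ha; apply: ulim_unique; exact: psumP. Qed.

Lemma rapid_shift a m : rapid a -> rapid (fun n => a (n + m)%N).
Proof.
move=> ha r r0; have [M M0 hM] := ha r r0; exists (M / r ^+ m).
  by rewrite divr_ge0 // exprn_ge0 // ltW.
by move=> n; apply: le_trans (hM _) _; rewrite exprD invfM mulrA mulrAC.
Qed.

Definition dcoef a n : C := n.+1%:R * a n.+1.

Lemma rapid_dcoef a : rapid a -> rapid (dcoef a).
Proof.
move=> ha r r0; have r20 : 0 < 2 * r by lra.
have [M M0 hM] := ha _ r20; exists (M / r); first by rewrite divr_ge0 // ltW.
move=> n; rewrite /dcoef cnM cn_nat; have := hM n.+1.
rewrite ler_pdivlMr ?exprn_gt0 // exprMn mulrA => h.
rewrite ler_pdivlMr ?exprn_gt0 // ler_pdivlMr // -mulrA -exprSr.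
apply: le_trans h; rewrite ler_wpM2r ?exprn_ge0 ?(ltW r0) // mulrC.
by rewrite ler_wpM2l ?cn_ge0 // -natrX ler_nat ltnW // ltn_expl.
Qed.

(** The second-order remainder of a single power, which makes termwise derivation in [psum_diff] a
    sum of quadratic errors; [1 <= rho] allows all powers of [rho] to be raised to the n-th. *)
Lemma expr_remainder (z h : C) (rho : R) n : 1 <= rho -> cn z <= rho -> cn (z + h) <= rho ->
  cn ((z + h) ^+ n - z ^+ n - n%:R * z ^+ n.-1 * h) <= (n ^ 2)%:R * rho ^+ n * cn h ^+ 2.
Proof.
move=> r1 zr zhr; elim: n => [|n IH].
  by rewrite !expr0 subrr !mul0r subr0 cn0.
have -> : (z + h) ^+ n.+1 - z ^+ n.+1 - n.+1%:R * z ^+ n.+1.-1 * h =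
  (z + h) * ((z + h) ^+ n - z ^+ n - n%:R * z ^+ n.-1 * h) + n%:R * z ^+ n.-1 * (h * h).
  rewrite !exprS -natr1 /=; case: n {IH} => [|n] /=; first by rewrite !expr0; ring.
  by rewrite !exprS; ring.
apply: le_trans (cnD _ _) _; rewrite cnM.
set E := cn _ in IH *; have E0 : 0 <= E := cn_ge0 _.
have h2 : 0 <= cn h ^+ 2 := sqr_ge0 _.
have rn : 1 <= rho ^+ n by rewrite exprn_ege1.
have k1 : cn (z + h) * E <= rho * ((n ^ 2)%:R * rho ^+ n * cn h ^+ 2).
  by apply: ler_pM => //; exact: cn_ge0.
have k2 : cn (n%:R * z ^+ n.-1 * (h * h)) <= n%:R * rho ^+ n.+1 * cn h ^+ 2.
  rewrite !cnM cn_nat cnX -expr2 ler_wpM2r // ler_wpM2l //.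
  apply: le_trans (_ : rho ^+ n.-1 <= _); first by rewrite lerXn2r ?nnegrE ?cn_ge0 //; lra.
  by rewrite ler_weXn2l //; case: (n) => // m; rewrite /= leqW.
apply: le_trans (lerD k1 k2) _.
have -> : rho * ((n ^ 2)%:R * rho ^+ n * cn h ^+ 2) + n%:R * rho ^+ n.+1 * cn h ^+ 2 =
   (n ^ 2 + n)%:R * rho ^+ n.+1 * cn h ^+ 2 by rewrite natrD [rho ^+ n.+1]exprS; ring.
rewrite ler_wpM2r // ler_wpM2r ?exprn_ge0 //; first lra.
by rewrite ler_nat -!mulnn addnC -mulnS leq_mul2r leqnSn orbT.
Qed.

Lemma psum_diff a w : rapid a -> cdiff (psum a) w (psum (dcoef a) w).
Proof.
move=> ha e e0; have w0 := cn_ge0 w; pose rho := cn w + 1.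
have r1 : 1 <= rho by rewrite /rho; lra.
(* Cauchy's estimate at radius [8 * rho] leaves [n ^ 2 / 8 ^ n] in the n-th remainder, at most
   [2 ^ - n] because [n ^ 2 <= 4 ^ n]. *)
have r80 : 0 < 8 * rho by lra.
have [M M0 hM] := ha _ r80.
exists (Num.min 1 (e / (2 * M + 1))).
  by rewrite lt_min ltr01 divr_gt0 //; lra.
move=> v; rewrite lt_min => /andP[v1 v2].
pose h := v - w; have vE : v = w + h by rewrite /h addrC subrK.
have v0 := cn_ge0 (v - w).
suff H : cn (psum a v - psum a w - psum (dcoef a) w * (v - w)) <= 2 * M * cn (v - w) ^+ 2.
  apply: le_trans H _; rewrite expr2 mulrA ler_wpM2r //.
  move: v2; rewrite ltr_pdivlMr; [nra|lra].
have L : ulim (fun N => ps a v N.+1 + (-1) * ps a w N.+1 + (- (v - w)) * ps (dcoef a) w N)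
              (psum a v + (-1) * psum a w + (- (v - w)) * psum (dcoef a) w).
  apply: ulimD; [apply: ulimD|].
  - by have := ulim_shift 1 (psumP ha v); congr ulim; apply/funext => n; rewrite addn1.
  - apply: ulimZ.
    by have := ulim_shift 1 (psumP ha w); congr ulim; apply/funext => n; rewrite addn1.
  - by apply: ulimZ; exact: psumP (rapid_dcoef ha) w.
have -> : psum a v - psum a w - psum (dcoef a) w * (v - w) =
  psum a v + (-1) * psum a w + (- (v - w)) * psum (dcoef a) w - 0.
  by rewrite subr0 mulN1r mulNr [X in _ - X]mulrC.
apply: (ulim_le L); exists 0%N => N _; rewrite subr0.
have -> : ps a v N.+1 + (-1) * ps a w N.+1 + (- (v - w)) * ps (dcoef a) w N =
  \sum_(n < N.+1) a n * (v ^+ n - w ^+ n - n%:R * w ^+ n.-1 * h).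
  rewrite [in RHS](eq_bigr (fun n : 'I_N.+1 => a n * v ^+ n + (-1) * (a n * w ^+ n)
     + (- h) * (n%:R * a n * w ^+ n.-1))); last by move=> n _; ring.
  rewrite !big_split /= -!mulr_sumr; congr (_ + _ + _ * _).
  rewrite big_ord_recl mul0r mul0r add0r; apply: eq_bigr => n _.
  by rewrite /dcoef lift0.
apply: le_trans (cn_sum _ _ _) _.
apply: le_trans (_ : \sum_(n < N.+1) (M * cn h ^+ 2) * 2^-1 ^+ n <= _).
  apply: ler_sum => n _; rewrite cnM vE.
  have hn : cn h < 1 by [].
  have E := @expr_remainder w h rho n r1 ltac:(rewrite /rho; lra)
     ltac:(by have := cnD w h; rewrite /rho; lra).
  apply: le_trans (_ : (M / (8 * rho) ^+ n) * ((n ^ 2)%:R * rho ^+ n * cn h ^+ 2) <= _).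
    by apply: ler_pM => //; exact: cn_ge0.
  have -> : M / (8 * rho) ^+ n * ((n ^ 2)%:R * rho ^+ n * cn h ^+ 2) =
     M * cn h ^+ 2 * ((n ^ 2)%:R / 8 ^+ n).
    by rewrite exprMn; field; rewrite !expf_neq0 //; lra.
  apply: ler_wpM2l; first by rewrite mulr_ge0 // sqr_ge0.
  rewrite ler_pdivrMr ?exprn_gt0 // -exprMn.
  have -> : 2^-1 * 8 = 4 :> R by field.
  rewrite -natrX ler_nat -[4%N]/(2 ^ 2)%N -expnM mulnC expnM leq_exp2r //.
  by rewrite ltnW // ltn_expl.
rewrite -mulr_sumr -(big_mkord xpredT (fun k => 2^-1 ^+ k)).
have -> : 2 * M * cn h ^+ 2 = M * cn h ^+ 2 * 2 by ring.
apply: ler_wpM2l; first by rewrite mulr_ge0 // sqr_ge0.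
apply: le_trans (geom_bound _ _ _) _; first by apply/andP; split; lra.
by rewrite expr0 mul1r (_ : 1 - 2^-1 = 2^-1 :> R) ?invrK //; lra.
Qed.

Lemma psum_ent a : rapid a -> ent (psum a).
Proof. by move=> ha w; exists (psum (dcoef a) w); exact: psum_diff. Qed.

Lemma psum_coef_eq0 a : rapid a -> (forall w, psum a w = 0) -> forall n, a n = 0.
Proof.
move=> ha h n; apply/eqP/negPn/negP => an.
have ex : exists n, a n != 0 by exists n.
case: (ex_minnP ex) => m am mmin {n an ex}.
have [M M0 hM] := ha 1 ltr01.
have cm : 0 < cn (a m) by rewrite cn_gt0.
(* As [t <= 1/2], the tail after the index [m] is at most [2 * M * t ^ (m + 1)]; the second bound on
   [t] makes it smaller than [cn (a m) * t ^ m]. *)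
pose t := Num.min 2^-1 (cn (a m) / (2 * M + 1) / 2).
have D0 : 0 < 2 * M + 1 by lra.
have t0 : 0 < t.
  by rewrite lt_min invr_gt0 ltr0n /= !divr_gt0.
have t2 : t <= 2^-1 by rewrite /t ge_min lexx.
have tm : t * (2 * M + 1) <= cn (a m) / 2.
  by rewrite -ler_pdivlMr // mulrAC /t ge_min lexx orbT.
have ct : cn (t%:C%C : C) = t by rewrite cn_real gtr0_norm.
have K : cn (0 - a m * t%:C%C ^+ m) <= M * (t ^+ m.+1 / (1 - t)).
  rewrite -(h t%:C%C); apply: (ulim_le (psumP ha t%:C%C)).
  exists m.+1 => n mn.
  have -> : a m * t%:C%C ^+ m = ps a t%:C%C m.+1.
    rewrite /ps big_ord_recr /= big1 ?add0r // => i _.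
    have [/eqP ->|ai] := boolP (a i == 0); first by rewrite mul0r.
    by have := mmin _ ai; rewrite leqNgt ltn_ord.
  have := @ps_tail a 1 M t%:C%C m.+1 n ltr01 M0 hM; rewrite ct divr1; apply => //.
  by apply: le_lt_trans t2 _; lra.
move: K; rewrite sub0r cnN cnM cnX ct exprS.
have tm0 : 0 < t ^+ m by rewrite exprn_gt0.
have -> : M * (t * t ^+ m / (1 - t)) = M * t / (1 - t) * t ^+ m by ring.
rewrite ler_pM2r // ler_pdivlMr; last by lra.
nra.
Qed.

Definition tc F : nat -> C := xget (fun=> 0) [set a | forall r M, 0 < r ->
  (forall z, cn z = r -> cn (F z) <= M) ->
  (forall n, cn (a n) <= M / r ^+ n) /\
  (forall w N, cn w < r -> cn (F w - \sum_(n < N) a n * w ^+ n)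
     <= M * (cn w / r) ^+ N / (1 - cn w / r))].

Lemma tcP F r M : ent F -> 0 < r -> (forall z, cn z = r -> cn (F z) <= M) ->
  (forall n, cn (tc F n) <= M / r ^+ n) /\
  (forall w N, cn w < r -> cn (F w - ps (tc F) w N)
     <= M * (cn w / r) ^+ N / (1 - cn w / r)).
Proof.
move=> hF; rewrite /ps /tc; case: xgetP => [a -> h|h]; first exact: h.
by have [a ha] := taylor hF; have := h a.
Qed.

Lemma tc_rapid F : ent F -> rapid (tc F).
Proof.
move=> hF r r0; have [M hM] := ent_bounded r hF.
have [] := tcP hF r0 (M := M); first by move=> z h; apply: hM; rewrite h.
exists M => //; apply: le_trans (hM 0 _); first exact: cn_ge0.
by rewrite cn0 ltW.
Qed.

Lemma psum_tc F : ent F -> psum (tc F) = F.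
Proof.
move=> hF; apply/funext => w; apply: psum_eq; first exact: tc_rapid.
have w0 := cn_ge0 w; have r0 : 0 < cn w + 1 by lra.
have [M hM] := ent_bounded (cn w + 1) hF.
have [] := tcP hF r0 (M := M); first by move=> z h; apply: hM; rewrite h.
move=> _ h e e0.
have q01 : 0 <= cn w / (cn w + 1) < 1.
  by rewrite divr_ge0 ?(ltW r0) //= ltr_pdivrMr // mul1r; lra.
have [N hN] := expr_small (M / (1 - cn w / (cn w + 1))) q01 e0.
exists N => n /hN K; rewrite cnBC; apply: le_trans (h w n _) _; first lra.
by rewrite mulrAC.
Qed.

Lemma tc_unique a : rapid a -> tc (psum a) = a.
Proof.
move=> ha; have hF := psum_ent ha; apply/funext => n.
apply/eqP; rewrite -subr_eq0; apply/eqP.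
pose b n := tc (psum a) n - a n; rewrite -[LHS]/(b n).
have rb : rapid b.
  move=> r r0; have [M M0 hM] := ha r r0; have [M' M'0 hM'] := tc_rapid hF r0.
  exists (M' + M); first by rewrite addr_ge0.
  by move=> k; apply: le_trans (cnB _ _) _; rewrite mulrDl; apply: lerD.
apply: (psum_coef_eq0 rb) => w; apply: (psum_eq rb).
have E : ps b w = fun N => ps (tc (psum a)) w N + (-1) * ps a w N.
  apply/funext => N; rewrite /ps mulr_sumr -big_split; apply: eq_bigr => k _ /=.
  by rewrite /b; ring.

rewrite E; have := ulimD (psumP (tc_rapid hF) w) (ulimZ (-1) (psumP ha w)).
by rewrite psum_tc // [-1 * psum a w]mulN1r subrr.
Qed.

(** Derived term by term rather than chosen from [cdiff], so that the derivative is entire by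
    construction; [cdiff_der] identifies it. *)
Definition der F : C -> C := psum (dcoef (tc F)).

Lemma cdiff_der F z : ent F -> cdiff F z (der F z).
Proof. by move=> hF; rewrite -{1}(psum_tc hF); apply: psum_diff; exact: tc_rapid. Qed.

Lemma der_eq F z l : ent F -> cdiff F z l -> der F z = l.
Proof. by move=> hF; apply: cdiff_unique; exact: cdiff_der. Qed.

Lemma ent_der F : ent F -> ent (der F).
Proof. by move=> hF; apply/psum_ent/rapid_dcoef/tc_rapid. Qed.

Lemma tc_der F n : ent F -> tc (der F) n = n.+1%:R * tc F n.+1.
Proof. by move=> hF; rewrite tc_unique //; apply/rapid_dcoef/tc_rapid. Qed.

Lemma tcS F n : ent F -> tc F n.+1 = tc (der F) n / n.+1%:R.
Proof. by move=> hF; rewrite tc_der // mulrC mulKf // pnatr_eq0. Qed.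

Lemma tc_0 F : ent F -> tc F 0 = F 0.
Proof.
move=> hF; rewrite -{2}(psum_tc hF); apply: ulim_unique (psumP (tc_rapid hF) 0).
move=> e e0; exists 1%N => -[//|n] _; rewrite /ps big_ord_recl expr0 mulr1 big1.
  by rewrite addr0 subrr cn0 ltW.
by move=> i _; rewrite exprS mul0r mulr0.
Qed.

Lemma der_cst (c : C) : der (fun=> c) = fun=> 0.
Proof. by apply/funext => z; apply: der_eq; [exact: ent_cst|exact: cdiff_cst]. Qed.

Lemma derD F G : ent F -> ent G -> der (fun z => F z + G z) = fun z => der F z + der G z.
Proof.
move=> hF hG; apply/funext => z; apply: der_eq; first exact: entD.
by apply: cdiffD; exact: cdiff_der.
Qed.

Lemma derM F G : ent F -> ent G ->
  der (fun z => F z * G z) = fun z => der F z * G z + F z * der G z.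
Proof.
move=> hF hG; apply/funext => z; apply: der_eq; first exact: entM.
by apply: cdiffM; exact: cdiff_der.
Qed.

Lemma der_comp F G : ent F -> ent G ->
  der (fun z => G (F z)) = fun z => der G (F z) * der F z.
Proof.
move=> hF hG; apply/funext => z; apply: der_eq; first exact: ent_comp.
by apply: cdiff_comp; exact: cdiff_der.
Qed.

Lemma der_id : der id = fun=> 1.
Proof. by apply/funext => z; apply: der_eq; [exact: ent_id|exact: cdiff_id]. Qed.

Lemma der_exp F : ent F -> der (fun z => cexp (F z)) = fun z => der F z * cexp (F z).
Proof.
move=> hF; rewrite der_comp //; last exact: ent_exp.
by apply/funext => z; rewrite (der_eq (@ent_exp R) (cdiff_cexp (F z))) mulrC.
Qed.

Lemma derX F n : ent F ->
  der (fun z => F z ^+ n) = fun z => n%:R * F z ^+ n.-1 * der F z.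
Proof.
move=> hF; apply/funext => z; apply: der_eq; first exact: entX.
by apply: cdiffX; exact: cdiff_der.
Qed.

Lemma derZ (c : C) F : ent F -> der (fun z => c * F z) = fun z => c * der F z.
Proof.
move=> hF; apply/funext => z; apply: der_eq; last exact/cdiffZ/cdiff_der.
by apply: entM => //; exact: ent_cst.
Qed.

Lemma tcD F G n : ent F -> ent G -> tc (fun z => F z + G z) n = tc F n + tc G n.
Proof.
elim: n F G => [|n IH] F G hF hG; have hFG := entD hF hG; first by rewrite !tc_0.
by rewrite !tcS // derD // IH ?mulrDl //; exact: ent_der.
Qed.

Lemma tcZ (c : C) F n : ent F -> tc (fun z => c * F z) n = c * tc F n.
Proof.
have hc := ent_cst c.
elim: n F => [|n IH] F hF; have hFG := entM hc hF; first by rewrite !tc_0.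
by rewrite !tcS // derZ // IH ?mulrA //; exact: ent_der.
Qed.

(** Induction through [tcS] instead of a rearrangement of double series: the two sums of the Leibniz
    rule carry the weights [i] and [n + 1 - i], which add up to [n + 1]. *)
Lemma tcM F G n : ent F -> ent G ->
  tc (fun z => F z * G z) n = \sum_(i < n.+1) tc F i * tc G (n - i)%N.
Proof.
elim: n F G => [|n IH] F G hF hG; have hFG := entM hF hG.
  by rewrite big_ord_recl big_ord0 addr0 !tc_0.
have hF' := ent_der hF; have hG' := ent_der hG.
rewrite tcS // derM // tcD ?IH //; [|exact: entM|exact: entM].
apply: (mulIf (x := n.+1%:R)); first by rewrite pnatr_eq0.
rewrite divfK ?pnatr_eq0 // big_distrl /=.
have -> : \sum_(i < n.+1) tc (der F) i * tc G (n - i) =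
    \sum_(i < n.+2) i%:R * (tc F i * tc G (n.+1 - i)).
  rewrite [RHS]big_ord_recl mul0r add0r; apply: eq_bigr => i _.
  by rewrite tc_der // lift0 subSS; ring.
have -> : \sum_(i < n.+1) tc F i * tc (der G) (n - i) =
    \sum_(i < n.+2) (n.+1 - i)%:R * (tc F i * tc G (n.+1 - i)).
  rewrite [RHS]big_ord_recr /= subnn mul0r addr0; apply: eq_bigr => i _.
  by rewrite tc_der // subSn 1?mulrCA // -ltnS.
rewrite -big_split; apply: eq_bigr => i _ /=.
by rewrite -mulrDl -natrD subnKC 1?mulrC // -ltnS.
Qed.

(** Weierstrass's theorem: by Cauchy's estimates the Taylor coefficients of the [f n] are Cauchy
    sequences, their limits are again rapid, and [F] is the power series with these limits. *)
Lemma ent_lim (f : nat -> C -> C) F : (forall n, ent (f n)) ->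
  (forall S e : R, 0 < e -> exists N : nat, forall n, (N <= n)%N ->
     forall w, cn w <= S -> cn (f n w - F w) <= e) ->
  ent F.
Proof.
move=> hf hF.
have diff_bound r e : 0 < r -> 0 < e -> exists N : nat, forall m n,
    (N <= m)%N -> (N <= n)%N -> forall k, cn (tc (f m) k - tc (f n) k) <= e / r ^+ k.
  move=> r0 e0; have [N hN] := hF r (e / 2) ltac:(lra).
  exists N => m n hm hn k.
  have hfm : ent (fun z => f m z + (-1) * f n z).
    by apply: entD => //; apply: entM => //; exact: ent_cst.
  have [|+ _] := tcP hfm r0 (M := e).
    move=> z zr; have := hN _ hm z; have := hN _ hn z; rewrite zr => /(_ (lexx _)) A /(_ (lexx _)) B.
    have := cnB (f m z - F z) (f n z - F z).
    rewrite (_ : _ - _ - _ = f m z + (-1) * f n z); [lra|ring].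
  move=> /(_ k); rewrite tcD ?tcZ ?mulN1r //.
  by apply: entM => //; exact: ent_cst.
have /choice[c hc] : forall k, exists v, ulim (fun n => tc (f n) k) v.
  move=> k; apply: ulim_cauchy => e e0.
  have [N hN] := diff_bound 1 e ltr01 e0; exists N => m n hm hn.
  by have := hN m n hm hn k; rewrite expr1n divr1.
have unif r : 0 < r -> exists (N : nat) (M : R), 0 <= M /\
    forall n, (N <= n)%N -> forall z, cn z <= r -> cn (f n z) <= M.
  move=> r0; have [N hN] := hF r 1 ltr01; have [M hM] := ent_bounded r (hf N).
  exists N, (M + 2); split.
    by have := hM 0; rewrite cn0 => /(_ (ltW r0)); have := cn_ge0 (f N 0); lra.
  move=> n /hN h z zr; have := h z zr; have := hN N (leqnn N) z zr; have := hM z zr.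
  have := cnD (f n z - F z) (- (f N z - F z)); rewrite cnN.
  have := cnD (f n z - F z - (f N z - F z)) (f N z).
  rewrite (_ : f n z - F z - (f N z - F z) + f N z = f n z); [lra|ring].
have rc : rapid c.
  move=> r r0; have [N [M [M0 hM]]] := unif r r0; exists M => // k.
  rewrite -[c k]subr0; apply: (ulim_le (hc k)); exists N => n /hM h; rewrite subr0.
  by have [+ _] := tcP (hf n) r0 (M := M) ltac:(by move=> z zr; apply: h; rewrite zr); apply.
suff -> : F = psum c by exact: psum_ent.
apply/funext => w; apply/esym/psum_eq => // e e0.
have w0 := cn_ge0 w; have r0 : 0 < cn w + 1 by lra.
have [N [M [M0 hM]]] := unif _ r0.
have q01 : 0 <= cn w / (cn w + 1) < 1.
  by rewrite divr_ge0 ?(ltW r0) //= ltr_pdivrMr // mul1r; lra.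
have [K hK] := expr_small (M / (1 - cn w / (cn w + 1))) q01 (e := e / 2) ltac:(lra).
exists K => k /hK {}hK.
have L : ulim (fun n => ps (tc (f n)) w k) (ps c w k).
  apply: ulim_sum => i _; have := ulimZ (w ^+ i) (hc i).
  by rewrite mulrC; congr ulim; apply/funext => n; rewrite mulrC.
apply: (ulim_le L); have [N' hN'] := hF (cn w) (e / 2) ltac:(lra).
exists (maxn N N') => n; rewrite geq_max => /andP[nN nN'].
have A := hN' n nN' w (lexx _).
have [|_ B] := tcP (hf n) r0 (M := M).
  by move=> z zr; apply: hM => //; rewrite zr.
have {}B := B w k ltac:(lra); rewrite mulrAC in B.
have := cnD (ps (tc (f n)) w k - f n w) (f n w - F w).
rewrite addrA subrK [cn (_ - f n w)]cnBC; lra.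
Qed.

Lemma ent_mtest (f : nat -> C -> C) F : (forall n, ent (f n)) ->
  (forall S : R, exists M : R, forall n w, cn w <= S -> cn (f n w) <= M * 2^-1 ^+ n) ->
  (forall w, ulim (fun N => \sum_(n < N) f n w) (F w)) -> ent F.
Proof.
move=> hf hM hF; apply: (ent_lim (f := fun N w => \sum_(n < N) f n w)).
  by move=> N; apply: ent_sum.
move=> S e e0; have [M hMS] := hM S.
have half01 : 0 <= (2^-1 : R) < 1 by lra.
have [N hN] := expr_small (M * 2) half01 e0.
exists N => n /hN {}hN w wS.
have M0 : 0 <= M.
  by have := hMS 0%N w wS; rewrite expr0 mulr1; apply: le_trans; exact: cn_ge0.
rewrite cnBC; apply: (ulim_le (hF w)); exists n => m nm.
rewrite -!(big_mkord xpredT (fun k => f k w)) (big_cat_nat (leq0n n) nm) /= addrAC subrr add0r.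
apply: le_trans (cn_sum _ _ _) _.
apply: le_trans (_ : \sum_(n <= k < m) M * 2^-1 ^+ k <= _).
  by apply: ler_sum => k _; exact: hMS.
rewrite -mulr_sumr; apply: le_trans hN; rewrite -mulrA; apply: ler_wpM2l => //.
apply: le_trans (geom_bound _ _ half01) _.
by rewrite mulrC (_ : 1 - 2^-1 = 2^-1 :> R) ?invrK //; lra.
Qed.

Lemma psum_shift a m w : rapid a ->
  psum a w = ps a w m + w ^+ m * psum (fun n => a (n + m)%N) w.
Proof.
move=> ha; apply: psum_eq => //.
have := ulimD (ulim_cst (ps a w m)) (ulimZ (w ^+ m) (psumP (rapid_shift m ha) w)).
move=> h e /h [N hN]; exists (N + m)%N => n hn.
have mn : (m <= n)%N := leq_trans (leq_addl _ _) hn.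
have -> : ps a w n = ps a w m + w ^+ m * ps (fun k => a (k + m)%N) w (n - m).
  rewrite /ps -!(big_mkord xpredT (fun k => a k * w ^+ k)).
  rewrite -(big_mkord xpredT (fun k => a (k + m)%N * w ^+ k)).
  rewrite (big_cat_nat (leq0n m) mn) /= mulr_sumr; congr (_ + _).
  have := big_addn 0 n m xpredT (fun k => a k * w ^+ k); rewrite add0n => ->.
  by apply: eq_bigr => k _; rewrite exprD; ring.
by apply: hN; rewrite leq_subRL // addnC.
Qed.

Lemma ent_translate F w : ent F -> ent (fun z => F (z + w)).
Proof.
by move=> hF; apply: (@ent_comp R (fun z => z + w)) => //; apply: entD; [exact: ent_id|exact: ent_cst].
Qed.

Lemma ent_factor F w : ent F -> F w = 0 ->
  exists2 G, ent G & forall z, F z = (z - w) * G z.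
Proof.
move=> hF F0; have hFt := ent_translate w hF.
pose a n := tc (fun z => F (z + w)) (n + 1)%N.
have ra : rapid a := rapid_shift 1 (tc_rapid hFt).
exists (fun z => psum a (z - w)).
  by rewrite -[X in fun z => psum a (z + X)]/(- w); apply: ent_translate; exact: psum_ent.
move=> z; have := psum_tc hFt => /(congr1 (fun f => f (z - w))).
rewrite (psum_shift 1) //; last exact: tc_rapid.
by rewrite subrK => <-; rewrite /ps big_ord_recl big_ord0 tc_0 // add0r F0 mul0r !add0r expr1.
Qed.

Lemma ent_order F : ent F -> (exists z, F z != 0) ->
  exists m, exists2 G, ent G /\ G 0 != 0 & forall z, F z = z ^+ m * G z.
Proof.
move=> hF [z0 Fz0].
have ex : exists n, tc F n != 0.
  apply/not_existsP => h; move/eqP: Fz0; apply; rewrite -(psum_tc hF).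
  apply: psum_eq; first exact: tc_rapid.
  move=> e e0; exists 0%N => n _; rewrite /ps big1 ?subrr ?cn0 ?ltW // => i _.
  by have /negP/negPn/eqP -> := h i; rewrite mul0r.
case: (ex_minnP ex) => m cm mmin.
exists m; have ra := rapid_shift m (tc_rapid hF).
exists (psum (fun n => tc F (n + m))).
  split; first exact: psum_ent.
  by rewrite -tc_0 ?tc_unique //; exact: psum_ent.
move=> z; rewrite -{1}(psum_tc hF) (psum_shift m) //; last exact: tc_rapid.
rewrite /ps big1 ?add0r // => i _.
have [/eqP ->|ai] := boolP (tc F i == 0); first by rewrite mul0r.
by have := mmin _ ai; rewrite leqNgt ltn_ord.
Qed.

Lemma ent_punctured_eq0 F : ent F -> (forall z, z != 0 -> F z = 0) -> F 0 = 0.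
Proof.
move=> hF h; apply: small_eq0 => e e0; have [d d0 hd] := ent_cont hF 0 e0.
have ct : cn ((d / 2)%:C%C : C) = d / 2 by rewrite cn_real gtr0_norm //; lra.
have := hd (d / 2)%:C%C; rewrite subr0 ct h; last by rewrite -cn_gt0 ct; lra.
by rewrite sub0r cnN; apply; lra.
Qed.

Lemma ent_mul_eq0 F G : ent F -> ent G -> (forall z, F z * G z = 0) ->
  (forall z, F z = 0) \/ (forall z, G z = 0).
Proof.
move=> hF hG h; have [/(ent_order hF)|/forallNP nF] := pselect (exists z, F z != 0); last first.
  by left => z; have /negP/negPn/eqP := nF z.
have [/(ent_order hG)|/forallNP nG _] := pselect (exists z, G z != 0); last first.
  by right => z; have /negP/negPn/eqP := nG z.
move=> [m [G1 [hG1 G10] GE]] [k [F1 [hF1 F10] FE]].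
have := @ent_punctured_eq0 (fun z => F1 z * G1 z) (entM hF1 hG1).
move=> /(_ _)/wrap[z z0|/eqP]; last by rewrite mulf_eq0 (negPf F10) (negPf G10).
have := h z; rewrite FE GE => /eqP; rewrite !mulf_eq0 !expf_eq0 (negPf z0) !andbF /=.
by move=> /orP[/eqP->|/eqP->]; rewrite ?mul0r ?mulr0.
Qed.

(** With [c] chosen to make [D = F - c G] vanish at [z0], the pair [D], [G] satisfies the same
    identity. If [D] had a zero of finite order [m] at [z0], the lowest-order terms of the identity
    would force [m = 0]. *)
Lemma wronskian_eq0 F G : ent F -> ent G -> (exists z, G z != 0) ->
  (forall z, der F z * G z = F z * der G z) ->
  exists c : C, forall z, F z = c * G z.
Proof.
move=> hF hG [z0 Gz0] W; pose c := F z0 / G z0; exists c.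
pose D z := F z + (- c) * G z.
have hcG : ent (fun z => - c * G z) by apply: entM => //; exact: ent_cst.
have hD : ent D by apply: entD.
have dD z : der D z = der F z - c * der G z.
  by rewrite /D derD // derZ // mulNr.
have WD z : der D z * G z = D z * der G z by rewrite dD /D mulrBl W; ring.
suff D0 z : D z = 0 by move=> z; apply/eqP; rewrite -subr_eq0 -mulNr; apply/eqP; exact: D0.
apply/eqP/negPn/negP => Dz.
pose T H z := H (z + z0).
have hT H : ent H -> ent (T H) by exact: ent_translate.
have [|m [E [hE E0] DE]] := @ent_order (T D) (hT _ hD).
  by exists (z - z0); rewrite /T subrK.
have dT H w : ent H -> der (T H) w = der H (w + z0).
  move=> hH; apply: der_eq; first exact: hT.
  apply: cdiff_eq (cdiff_comp (F := fun v => v + z0) _ (cdiff_der _ hH)) (mulr1 _).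
  by apply: cdiff_eq (cdiffD (cdiff_id w) (cdiff_cst z0 w)) _; rewrite addr0.
have m0 : (0 < m)%N.
  rewrite lt0n; apply/eqP => m0; have := DE 0; rewrite m0 mul1r /T add0r /D /c.
  by move=> h; move/eqP: E0; apply; rewrite -h mulNr divfK // subrr.
have dTD w : der (T D) w = m%:R * w ^+ m.-1 * E w + w ^+ m * der E w.
  have -> : T D = fun z => z ^+ m * E z by apply/funext.
  by rewrite derM ?derX ?der_id ?mulr1 //; [exact: ent_id|by apply: entX; exact: ent_id].
(* The translated identity divided by [w ^ (m - 1)]: it vanishes off 0, hence at 0, where its value
   is [m * E 0 * G z0]. *)
pose H w := (m%:R * E w + w * der E w) * T G w - w * E w * der (T G) w.
have entH : ent H.
  have hc : ent (fun=> m%:R : C) := ent_cst _.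
  apply: entB; apply: entM.
  - apply: entD; apply: entM => //; [exact: ent_id|exact: ent_der].
  - exact: hT.
  - by apply: entM => //; exact: ent_id.
  - exact/ent_der/hT.
have := ent_punctured_eq0 entH; rewrite /H => /(_ _)/wrap[w w0|].
  have := WD (w + z0); rewrite -(dT D) // -(dT G) // -[D _]/(T D w) dTD DE -/(T G w).
  have -> : w ^+ m = w * w ^+ m.-1 by rewrite -exprS prednK.
  have wm : w ^+ m.-1 != 0 by rewrite expf_neq0.
  move=> h; apply: (mulfI wm); rewrite mulr0 mulrBr.
  apply/eqP; rewrite subr_eq0; apply/eqP.
  transitivity ((m%:R * w ^+ m.-1 * E w + w * w ^+ m.-1 * der E w) * T G w); first by ring.
  by rewrite h; ring.
rewrite !mul0r addr0 subr0 => /eqP; rewrite !mulf_eq0 (negPf E0) /T add0r (negPf Gz0).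
by rewrite pnatr_eq0 (negPf (lt0n_neq0 m0)).
Qed.

Lemma ent_poly_growth F (D : nat) (M : R) : ent F ->
  (forall z, cn (F z) <= M * (1 + cn z) ^+ D) ->
  exists2 q : {poly C}, (size q <= D.+1)%N & forall z, F z = q.[z].
Proof.
move=> hF hM; exists (\poly_(i < D.+1) tc F i); first exact: size_poly.
have M0 : 0 <= M.
  by have := hM 0; rewrite cn0 addr0 expr1n mulr1; apply: le_trans; exact: cn_ge0.
have c0 n : (D < n)%N -> tc F n = 0.
  (* On the circle of radius [r >= 1] the hypothesis gives [M * (2 r) ^ D], so the coefficient is at
     most [M * 2 ^ D / r ^ (n - D)], and [n - D >= 1]. *)
  move=> Dn; apply: small_eq0 => e e0; pose r := Num.max 1 (M * 2 ^+ D / e).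
  have r1 : 1 <= r by rewrite le_max lexx.
  have r0 : 0 < r by lra.
  have [|+ _] := tcP hF r0 (M := M * (2 * r) ^+ D).
    move=> z zr; apply: le_trans (hM z) _; apply: ler_wpM2l => //.
    by rewrite zr lerXn2r ?nnegrE; lra.
  move=> /(_ n) h; apply: le_trans h _.
  rewrite ler_pdivrMr ?exprn_gt0 //.
  have -> : r ^+ n = r ^+ D * r * r ^+ (n - D.+1) by rewrite -exprSr -exprD subnKC.
  have rM : M * 2 ^+ D <= e * r by rewrite [e * r]mulrC -ler_pdivrMr // /r le_max lexx orbT.
  have rn : 1 <= r ^+ (n - D.+1) by rewrite exprn_ege1.
  have rD : 0 < r ^+ D by rewrite exprn_gt0.
  rewrite exprMn mulrA.
  apply: le_trans (_ : e * r * r ^+ D <= _); first by rewrite ler_pM2r.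
  rewrite !mulrA [e * _ * r]mulrAC ler_peMr // ltW // !mulr_gt0 //.
move=> z; rewrite horner_poly -{1}(psum_tc hF); apply: psum_eq; first exact: tc_rapid.
move=> e e0; exists D.+1 => n Dn; rewrite /ps.
rewrite -!(big_mkord xpredT (fun k => tc F k * z ^+ k)) (big_cat_nat (leq0n D.+1) Dn) /=.
rewrite addrAC subrr add0r big_nat big1 ?cn0 ?ltW // => i /andP[Di _].
by rewrite c0 ?mul0r.
Qed.

End PowerSeries.

(** * Averages over roots of unity *)

Section RootsOfUnityAverages.
Variable R : realType.
Local Notation C := R[i].
Implicit Types (F G S g : C -> C) (z w l : C) (r M : R).

Lemma prim_root_exists N : (0 < N)%N -> exists y : C, N.-primitive_root y.
Proof.
move=> N0; pose p : {poly C} := 'X^N - 1.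
have [rs Dp] := closed_field_poly_normal p.
have {}Dp : p = \prod_(z <- rs) ('X - z%:P).
  by move: Dp; rewrite lead_coefDl ?size_polyXn ?size_polyN ?size_poly1 // lead_coefXn scale1r.
have rn1 : all N.-unity_root rs by apply/allP => z; rewrite -root_prod_XsubC -Dp.
have sz : (N < (size rs).+1)%N by rewrite -(size_prod_XsubC rs id) -Dp size_XnsubC.
have [|z _ hz] := hasP (cyclic.has_prim_root N0 rn1 _ sz); last by exists z.
by rewrite -separable.separable_prod_XsubC -Dp cyclotomic.separable_Xn_sub_1 // pnatr_eq0 -lt0n.
Qed.

Lemma prim_root_cn N (y : C) : N.-primitive_root y -> cn y = 1.
Proof.
move=> hy; have N0 := prim_order_gt0 hy.
have := congr1 (@cn R) (prim_expr_order hy); rewrite cnX cn1 => /eqP.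
by rewrite pexpr_eq1 ?cn_ge0 // => /eqP.
Qed.

Lemma prim_root_sum N (y : C) m : N.-primitive_root y -> ~~ (N %| m)%N ->
  \sum_(k < N) (y ^+ k) ^+ m = 0.
Proof.
move=> hy hm; have ym : y ^+ m - 1 != 0.
  by rewrite subr_eq0 -(prim_order_dvd hy).
apply: (mulfI ym); rewrite mulr0.
under eq_bigr do rewrite exprAC.
rewrite -subrX1.
by rewrite exprAC (prim_expr_order hy) expr1n subrr.
Qed.

(** Fourier inversion on N points for a truncated series. The exponent [m] stands for [- l] modulo
    [N], which keeps all exponents natural numbers. *)
Lemma dft N (y z : C) (a : nat -> C) (l m : nat) : N.-primitive_root y -> (l < N)%N ->
  (N %| l + m)%N ->
  \sum_(k < N) ps a (y ^+ k * z) N * (y ^+ k) ^+ m = N%:R * (a l * z ^+ l).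
Proof.
move=> hy lN Nlm; rewrite /ps.
under eq_bigr do rewrite big_distrl /=.
rewrite exchange_big /= (bigD1 (Ordinal lN)) //= [X in _ + X]big1 ?addr0.
  rewrite (eq_bigr (fun=> a l * z ^+ l)) ?sumr_const ?card_ord ?mulr_natl // => k _.
  transitivity (a l * z ^+ l * (y ^+ k) ^+ (l + m)); first by rewrite exprMn exprD /=; ring.
  have /eqP E : y ^+ (l + m) == 1 by rewrite -(prim_order_dvd hy).
  by rewrite exprAC E expr1n mulr1.
move=> i il; rewrite (eq_bigr (fun k : 'I_N => (a i * z ^+ i) * (y ^+ k) ^+ (i + m))).
  rewrite -mulr_sumr prim_root_sum ?mulr0 //; apply: contra il => Nim.
  apply/eqP/val_inj => /=.
  have : i = l %[mod N].
    apply/eqP; rewrite -(eqn_modDr m).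
    by rewrite (eqP Nim) (eqP Nlm).
  by rewrite !modn_small.
by move=> k _; rewrite exprMn exprD; ring.
Qed.

(* Jensen's inequality in discrete form: the maximum principle applied to
   z |-> prod_k S (y^k z) yields a regular N-gon on the circle on which the mean
   of log |S| is at least log (|S 0| / 2). *)
Lemma discrete_jensen S N (y : C) (r : R) : ent S -> S 0 != 0 -> (0 < N)%N -> 0 < r ->
  exists2 z, cn z = r & (cn (S 0) / 2) ^+ N < \prod_(k < N) cn (S (y ^+ k * z)).
Proof.
move=> hS S0 N0 r0; apply/not_exists2P => h.
pose P z := \prod_(k < N) S (y ^+ k * z).
have hP : ent P.
  apply: ent_prod => k _; apply: (@ent_comp R (fun z => y ^+ k * z)) => //.
  by apply: entM; [exact: ent_cst|exact: ent_id].
have [|+ _] := tcP hP r0 (M := (cn (S 0) / 2) ^+ N).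
  move=> z zr; have [//|/negP] := h z.
  by rewrite -leNgt cn_prod.
move=> /(_ 0%N); rewrite expr0 divr1 tc_0 // cn_prod.
rewrite (eq_bigr (fun=> cn (S 0))); last by move=> k _; rewrite mulr0.
rewrite prodr_const card_ord; apply/negP; rewrite -ltNge.
have s0 : 0 < cn (S 0) by rewrite cn_gt0.
by rewrite ltrXn2r -?lt0n //; lra.
Qed.

End RootsOfUnityAverages.

(** * Growth of an exponent from bounds on a quotient *)

Section GrowthOfUnits.
Variable R : realType.
Local Notation C := R[i].
Implicit Types (F G S T g : C -> C) (z w l : C) (r M : R).

Lemma ent_partial_sum_approx g (r : R) : ent g -> 0 < r ->
  exists2 M : R, 0 <= M & (forall n, cn (tc g n) * r ^+ n <= M * 2^-1 ^+ n) /\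
    (forall z N, cn z = r -> cn (g z - ps (tc g) z N) <= M * 2^-1 ^+ N).
Proof.
move=> hg r0; have r20 : 0 < 2 * r by lra.
have [M hM] := ent_bounded (2 * r) hg.
have M0 : 0 <= M by apply: le_trans (cn_ge0 (g 0)) (hM 0 _); rewrite cn0; lra.
have [|h1 h2] := tcP hg r20 (M := M); first by move=> z zr; apply: hM; rewrite zr.
exists (2 * M); first by lra.
split=> [n|z N zr].
  apply: le_trans (ler_wpM2r (exprn_ge0 n (ltW r0)) (h1 n)) _.
  have -> : M / (2 * r) ^+ n * r ^+ n = M * 2^-1 ^+ n.
    by rewrite exprMn exprVn; field; rewrite !expf_neq0 // gt_eqF.
  by rewrite ler_wpM2r ?exprn_ge0 //; lra.
have := h2 z N; rewrite zr.
have -> : r / (2 * r) = 2^-1 by field; rewrite gt_eqF.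
have -> : 1 - 2^-1 = 2^-1 :> R by field.
rewrite invrK mulrAC [M * 2]mulrC; apply; lra.
Qed.

(** Twice the real part is [g] plus its conjugate. In the Fourier sum of index [n] the conjugate
    contributes only the coefficient of index [N - n], which is negligible for large [N]; so the
    coefficient is bounded by a mean of the modulus of the real part alone. *)
Lemma coef_le_mean_Re g (r B : R) n : ent g -> 0 < r -> (0 < n)%N ->
  (forall e : R, 0 < e -> exists N0 : nat, forall N, (N0 <= N)%N -> (0 < N)%N ->
     forall y : C, N.-primitive_root y ->
     exists2 z, cn z = r &
       \sum_(k < N) `|complex.Re (g (y ^+ k * z))| <= N%:R * (B + e)) ->
  cn (tc g n) * r ^+ n <= 2 * B.
Proof.
move=> hg r0 n0 hB.
have [M M0 [hc ha]] := ent_partial_sum_approx hg r0.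
(* Two fifths come from the bound on [2 * X], two from the truncations [A1] and [A2], one from the
   coefficient of index [N - n]. *)
apply/ler_addgt0Pr => e e0; have e50 : 0 < e / 5 by lra.
have [N0 hN0] := hB _ e50.
have half01 : 0 <= (2^-1 : R) < 1 by lra.
have [N1 hN1] := expr_small M half01 e50.
pose N := (maxn N0 (N1 + n.+1))%N.
have NN0 : (N0 <= N)%N by exact: leq_maxl.
have NN1 : (N1 + n.+1 <= N)%N by exact: leq_maxr.
have nN : (n < N)%N by apply: leq_trans NN1; rewrite leq_addl.
have N_gt0 : (0 < N)%N by apply: leq_trans nN.
have [y hy] := prim_root_exists R N_gt0.
have [z zr hz] := hN0 N NN0 N_gt0 y hy.
have cy : cn y = 1 := prim_root_cn hy.
have cyk k m : cn ((y ^+ k) ^+ m) = 1 by rewrite !cnX cy !expr1n.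
have yz k : cn (y ^+ k * z) = r by rewrite cnM cnX cy expr1n mul1r.
have NR : 0 < N%:R :> R by rewrite ltr0n.
have approx (l m : nat) : (l < N)%N -> (N %| l + m)%N ->
    cn (\sum_(k < N) g (y ^+ k * z) * (y ^+ k) ^+ m - N%:R * (tc g l * z ^+ l))
      <= N%:R * (e / 5).
  move=> lN hlm; rewrite -(dft z (tc g) hy lN hlm) -sumrB.
  apply: le_trans (cn_sum _ _ _) _; rewrite -[X in X%:R]card_ord mulr_natl -sumr_const.
  apply: ler_sum => k _; rewrite -mulrBl cnM cyk mulr1.
  apply: le_trans (ha _ N (yz k)) _; apply: hN1.
  by apply: leq_trans NN1; rewrite leq_addr.
pose X := \sum_(k < N) (complex.Re (g (y ^+ k * z)))%:C%C * (y ^+ k) ^+ (N - n).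
have XE : 2 * X = \sum_(k < N) g (y ^+ k * z) * (y ^+ k) ^+ (N - n) +
    ((\sum_(k < N) g (y ^+ k * z) * (y ^+ k) ^+ n)^*)%C.
  rewrite /X mulr_sumr rmorph_sum -big_split; apply: eq_bigr => k _ /=.
  have -> : ((g (y ^+ k * z) * (y ^+ k) ^+ n)^*)%C =
     ((g (y ^+ k * z))^*)%C * (y ^+ k) ^+ (N - n).
    rewrite rmorphM /=; congr (_ * _).
    have E1 : (y ^+ k) ^+ n * (y ^+ k) ^+ (N - n) = 1.
      by rewrite -exprD subnKC 1?ltnW // exprAC (prim_expr_order hy) expr1n.
    have E2 : (y ^+ k) ^+ n * (((y ^+ k) ^+ n)^*)%C = 1.
      by rewrite mul_conj cyk expr1n.
    have nz : (y ^+ k) ^+ n != 0 by rewrite -cn_gt0 cyk.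
    by apply: (mulfI nz); rewrite E1 E2.
  rewrite mulrA -mulrDl; congr (_ * _).
  by rewrite addcJ.
have Xle : cn X <= N%:R * (B + e / 5).
  apply: le_trans (cn_sum _ _ _) (le_trans _ hz).
  by apply: ler_sum => k _; rewrite cnM cyk mulr1 cn_real.
have A1 := approx n (N - n)%N nN ltac:(by rewrite subnKC // ltnW).
have A2 := approx (N - n)%N n ltac:(by rewrite ltn_subrL n0) ltac:(by rewrite subnK // ltnW).
have A3 : cn (N%:R * (tc g (N - n) * z ^+ (N - n))) <= N%:R * (e / 5).
  rewrite cnM cn_nat cnM cnX zr ler_pM2l //; apply: le_trans (hc _) (hN1 _ _).
  rewrite leq_subRL ?(ltnW nN) // addnC; apply: leq_trans NN1.
  by rewrite leq_add2l.
have main : N%:R * (cn (tc g n) * r ^+ n) <= N%:R * (2 * B + e).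
  have -> : N%:R * (cn (tc g n) * r ^+ n) = cn (N%:R * (tc g n * z ^+ n)).
    by rewrite !cnM cn_nat cnX zr.
  set s1 := \sum_(k < N) _ in A1 XE; set s2 := \sum_(k < N) _ in A2 XE.
  set a1 := N%:R * _ in A1 *; set a2 := N%:R * _ in A2 A3.
  have := cnD (s1 - a1) (a1); have := cnB (2 * X) (s1 - a1).
  have := cnD (s2 - a2) a2; rewrite subrK => h3.
  have := cnB (2 * X - (s1 - a1)) ((s2^*)%C).
  rewrite (_ : 2 * X - (s1 - a1) - (s2^*)%C = a1); last by rewrite XE; ring.
  rewrite cn_conj [cn (2 * X)]cnM cn_nat => h1 h2 _.
  apply: le_trans (_ : 2 * (N%:R * (B + e / 5)) + 3 * (N%:R * (e / 5)) <= _); last by lra.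
  lra.
by rewrite ler_pM2l in main.
Qed.

(** The bounds on [S] and [S exp g] give both [log |S| <= L] and [log |S| + Re g <= L], hence
    [|Re g| <= 2 L - 2 log |S| - Re g]. On the polygon of [discrete_jensen] the mean of [log |S|] is
    bounded below and that of [Re g] is nearly [Re (g 0)]. A zero of [S] at 0 is divided out first;
    since [1 <= r] this only lowers the modulus. *)
Lemma jensen_bound g S T : ent g -> ent S -> (exists z, S z != 0) ->
  (forall z, S z * cexp (g z) = T z) ->
  exists2 K : R, 0 < K & forall r L : R, 1 <= r -> 0 <= L ->
    (forall z, cn z = r -> cn (S z) <= expR L /\ cn (T z) <= expR L) ->
    forall n, (0 < n)%N -> cn (tc g n) * r ^+ n <= K * (1 + L).
Proof.
move=> hg hS S0 ST.
have [m [S1 [hS1 S10] SE]] := ent_order hS S0.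
pose c0 := cn (S1 0) / 2; have c00 : 0 < c0 by rewrite divr_gt0 // cn_gt0.
pose B := 2 * `|ln c0| + cn (g 0).
have B0 : 0 <= B by rewrite addr_ge0 ?cn_ge0 // mulr_ge0.
exists (2 * (B + 3)); first by lra.
move=> r L r1 L0 hL n n0; have r0 : 0 < r by lra.
have S1b z : cn z = r -> cn (S1 z) <= expR L /\ cn (S1 z) * expR (complex.Re (g z)) <= expR L.
  move=> zr; have [h1 h2] := hL z zr; rewrite SE cnM cnX zr in h1.
  rewrite -ST SE 2!cnM cnX zr cn_cexp in h2.
  have rm : 1 <= r ^+ m by rewrite exprn_ege1.
  have s0 := cn_ge0 (S1 z); have e0 := expR_ge0 (complex.Re (g z)).
  split; first by apply: le_trans h1; rewrite ler_peMl.
  by apply: le_trans h2; rewrite -mulrA ler_peMl // mulr_ge0.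
have [M M0 [_ ha]] := ent_partial_sum_approx hg r0.
apply: le_trans (coef_le_mean_Re (B := B + 2 * L) hg r0 n0 _) _; last by nra.
move=> e e0; have half01 : 0 <= (2^-1 : R) < 1 by lra.
have [N1 hN1] := expr_small M half01 e0.
exists N1 => N NN1 N0 y hy.
have [z zr hz] := discrete_jensen y hS1 S10 N0 r0; exists z => //.
have cy : cn y = 1 := prim_root_cn hy.
have yz k : cn (y ^+ k * z) = r by rewrite cnM cnX cy expr1n mul1r.
have NR : 0 < N%:R :> R by rewrite ltr0n.
have pos k : 0 < cn (S1 (y ^+ k * z)) \/ \prod_(k < N) cn (S1 (y ^+ k * z)) = 0 \/ (N <= k)%N.
  have [kN|] := ltnP k N; last by right; right.
  have [E|E] := eqVneq (S1 (y ^+ k * z)) 0; last by left; rewrite cn_gt0.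
  by right; left; rewrite (bigD1 (Ordinal kN)) //= E cn0 mul0r.
have {}pos (k : 'I_N) : 0 < cn (S1 (y ^+ k * z)).
  have [//|[E|]] := pos k; last by rewrite leqNgt ltn_ord.
  by move: hz; rewrite E ltNge exprn_ge0 // ltW.
have sumln : N%:R * ln c0 <= \sum_(k < N) ln (cn (S1 (y ^+ k * z))).
  have -> : \sum_(k < N) ln (cn (S1 (y ^+ k * z))) = ln (\prod_(k < N) cn (S1 (y ^+ k * z))).
    elim: (index_enum _) => [|k s IH]; first by rewrite !big_nil ln1.
    have pp : 0 < \prod_(k <- s) cn (S1 (y ^+ k * z)).
      by apply: prodr_gt0 => i _; exact: pos.
    by rewrite !big_cons IH lnM // posrE.
  rewrite mulr_natl -lnXn // ler_ln ?posrE ?exprn_gt0 ?ltW //.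
  by apply: lt_trans hz; rewrite exprn_gt0.
have term (k : 'I_N) : `|complex.Re (g (y ^+ k * z))| <=
    2 * L - 2 * ln (cn (S1 (y ^+ k * z))) - complex.Re (g (y ^+ k * z)).
  have [h1 h2] := S1b _ (yz k).
  set s := cn (S1 _) in h1 h2 *; set x := complex.Re _ in h2 *.
  have s0 : 0 < s := pos k.
  have l1 : ln s <= L by rewrite -ler_expR lnK ?posrE.
  have l2 : ln s + x <= L by rewrite -ler_expR expRD lnK ?posrE.
  by rewrite ler_norml; lra.
apply: le_trans (ler_sum _ (fun k _ => term k)) _.
rewrite !sumrB !sumr_const !card_ord -!mulr_sumr -Re_sum.
have dftg := dft z (tc g) hy N0 (dvdnn N : (N %| 0 + N)%N).
have A : cn (\sum_(k < N) g (y ^+ k * z) - N%:R * g 0) <= N%:R * e.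
  have := dftg; rewrite expr0 mulr1 tc_0 // => <-.
  rewrite -sumrB; apply: le_trans (cn_sum _ _ _) _.
  rewrite -[X in X%:R]card_ord mulr_natl -sumr_const.
  apply: ler_sum => k _; have -> : (y ^+ k) ^+ N = 1.
    by rewrite exprAC (prim_expr_order hy) expr1n.
  by rewrite mulr1; apply: le_trans (ha _ N (yz k)) (hN1 _ NN1).
have Re1 := le_trans (cn_Re _) A; rewrite ReD ReN in Re1.
have Re2 := cn_Re (N%:R * g 0); rewrite cnM cn_nat in Re2.
have lnc : - `|ln c0| <= ln c0 by rewrite lerNnormlW.
rewrite /B; rewrite !ler_norml in Re1 Re2.
have k1 : N%:R * - `|ln c0| <= N%:R * ln c0 by rewrite ler_pM2l.
rewrite -[2 * L *+ N]mulr_natl.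
lra.
Qed.

End GrowthOfUnits.

(** * Borel's theorem on sums of exponentials *)

Section SmallFunctions.
Variable R : realType.
Local Notation C := R[i].
Implicit Types (F G S T : C -> C) (z w : C) (r d : R).
Local Open Scope classical_set_scope.

Lemma cauchy_der F z (rho M : R) : ent F -> 0 < rho ->
  (forall v, cn (v - z) = rho -> cn (F v) <= M) -> cn (der F z) <= M / rho.
Proof.
move=> hF r0 hM; have hT := ent_translate z hF.
have [|+ _] := tcP hT r0 (M := M).
  by move=> v vr; apply: hM; rewrite addrK.
move=> /(_ 1%N); rewrite expr1 tcS // divr1 tc_0; last exact: ent_der.
suff -> : der (fun v => F (v + z)) 0 = der F z by [].
have h := cdiffD (cdiff_id 0) (cdiff_cst z 0).
by rewrite (der_eq hT (cdiff_comp h (cdiff_der (0 + z) hF))) addr0 mulr1 add0r.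
Qed.

Lemma cst_of_tc F : ent F -> (forall n, (0 < n)%N -> tc F n = 0) ->
  forall z, F z = F 0.
Proof.
move=> hF h z; rewrite -{1}(psum_tc hF); apply: psum_eq; first exact: tc_rapid.
move=> e e0; exists 1%N => -[//|n] _.
rewrite /ps big_ord_recl big1 => [|i _]; last by rewrite h ?mul0r.
by rewrite tc_0 // expr0 mulr1 addr0 subrr cn0 ltW.
Qed.

Section Family.
Variables (I : finType) (g : I -> C -> C).
Hypothesis hg : forall j, ent (g j).

(** The maximal term of the Taylor series of all the [g j], in place of the maximum modulus.
    Constant terms are left out because only constancy is at stake; the value 0 keeps the set
    inhabited for an empty family. *)
Definition growth r : R :=
  sup [set x : R | x = 0 \/ exists j n, x = cn (tc (g j) n.+1) * r ^+ n.+1].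

Lemma growth_has_sup r : 0 < r ->
  has_sup [set x : R | x = 0 \/ exists j n, x = cn (tc (g j) n.+1) * r ^+ n.+1].
Proof.
move=> r0; split; first by exists 0; left.
have /choice[M hM] : forall j, exists M : R, 0 <= M /\ forall n, cn (tc (g j) n) <= M / r ^+ n.
  by move=> j; have [M M0 h] := tc_rapid (hg j) r0; exists M.
have M0 j : 0 <= M j by have [] := hM j.
exists (\sum_j M j) => x [->|[j [n ->]]]; first by apply: sumr_ge0.
apply: le_trans (_ : M j <= _).
  by rewrite -ler_pdivlMr ?exprn_gt0 //; have [_ ->] := hM j.
by rewrite (bigD1 j) //= lerDl sumr_ge0.
Qed.

Lemma growth_ge0 r : 0 < r -> 0 <= growth r.
Proof.
by move=> r0; apply: ub_le_sup; [have [] := growth_has_sup r0|left].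
Qed.

Lemma growth_ub r j n : 0 < r -> (0 < n)%N -> cn (tc (g j) n) * r ^+ n <= growth r.
Proof.
case: n => // n r0 _.
by apply: ub_le_sup; [have [] := growth_has_sup r0|right; exists j, n].
Qed.

Lemma growth_le r (B : R) : 0 <= B ->
  (forall j n, (0 < n)%N -> cn (tc (g j) n) * r ^+ n <= B) -> growth r <= B.
Proof.
move=> B0 h; apply: ge_sup; first by exists 0; left.
by move=> x [->//|[j [n ->]]]; apply: h.
Qed.

Lemma growth_mono r r' : 0 < r -> r <= r' -> growth r <= growth r'.
Proof.
move=> r0 rr'; have r'0 : 0 < r' by lra.
apply: growth_le; first exact: growth_ge0.
move=> j n n0; apply: le_trans (growth_ub j r'0 n0).
by rewrite ler_wpM2l ?cn_ge0 // lerXn2r ?nnegrE ?(ltW r0) ?(ltW r'0).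
Qed.

(* Cauchy's estimate on a disc of radius d r / 4 makes the functions bounded by a
   power of the gauge closed under derivation. *)
Definition gauge r d : R := r / d * (1 + growth ((1 + d) * r)).

Lemma gauge_ge r d : 1 <= r -> 0 < d <= 1 -> r <= gauge r d.
Proof.
move=> r1 /andP[d0 d1]; have K0 := @growth_ge0 ((1 + d) * r) ltac:(nra).
have rd : r <= r / d by rewrite ler_pdivlMr // ler_piMr //; lra.
rewrite /gauge; nra.
Qed.

Lemma gauge_ge_inv r d : 1 <= r -> 0 < d <= 1 -> d^-1 <= gauge r d.
Proof.
move=> r1 /andP[d0 d1]; have K0 := @growth_ge0 ((1 + d) * r) ltac:(nra).
have di : 0 < d^-1 by rewrite invr_gt0.
have rd : d^-1 <= r / d by rewrite ler_peMl // ltW.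
rewrite /gauge; nra.
Qed.

(** One bound for all margins [d] at once: derivation passes from [d] to [d / 4], and the growth
    argument lets [d] tend to 0. *)
Definition small S := ent S /\ exists (B : R) (m : nat), 0 <= B /\
  forall r d z, 1 <= r -> 0 < d <= 1 -> cn z <= r -> cn (S z) <= B * gauge r d ^+ m.

Lemma gauge_leX r d m n : 1 <= r -> 0 < d <= 1 -> (m <= n)%N ->
  gauge r d ^+ m <= gauge r d ^+ n.
Proof.
by move=> r1 hd mn; rewrite ler_weXn2l // (le_trans r1) // gauge_ge.
Qed.

Lemma small_cst (a : C) : small (fun=> a).
Proof.
split; first exact: ent_cst.
by exists (cn a), 0%N; split; [exact: cn_ge0|move=> r d z _ _ _; rewrite expr0 mulr1].
Qed.

Lemma smallD S T : small S -> small T -> small (fun z => S z + T z).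
Proof.
move=> [hS [B [m [B0 hB]]]] [hT [D [n [D0 hD]]]]; split; first exact: entD.
exists (B + D), (m + n)%N; split; first lra.
move=> r d z r1 hd zr; apply: le_trans (cnD _ _) _; rewrite mulrDl.
apply: lerD; [apply: le_trans (hB _ _ _ r1 hd zr) _|apply: le_trans (hD _ _ _ r1 hd zr) _].
  by rewrite ler_wpM2l // gauge_leX // leq_addr.
by rewrite ler_wpM2l // gauge_leX // leq_addl.
Qed.

Lemma smallM S T : small S -> small T -> small (fun z => S z * T z).
Proof.
move=> [hS [B [m [B0 hB]]]] [hT [D [n [D0 hD]]]]; split; first exact: entM.
exists (B * D), (m + n)%N; split; first exact: mulr_ge0.
move=> r d z r1 hd zr; rewrite cnM exprD mulrACA.
by apply: ler_pM; [exact: cn_ge0|exact: cn_ge0|exact: hB|exact: hD].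
Qed.

Lemma smallB S T : small S -> small T -> small (fun z => S z - T z).
Proof.
move=> hS hT; have -> : (fun z => S z - T z) = (fun z => S z + (-1) * T z).
  by apply/funext => z; rewrite mulN1r.
by apply: smallD => //; apply: smallM => //; exact: small_cst.
Qed.

Lemma small_id : small id.
Proof.
split; first exact: ent_id.
exists 1, 1%N; split=> // r d z r1 hd zr.
by rewrite mul1r expr1; apply: le_trans zr (gauge_ge r1 hd).
Qed.

Lemma small_poly (p : {poly C}) : small (fun z => p.[z]).
Proof.
elim/poly_ind: p => [|p a IH].
  by under eq_fun do rewrite horner0; exact: small_cst.
under eq_fun do rewrite !hornerE.
by apply: smallD; [apply: smallM => //; exact: small_id|exact: small_cst].
Qed.

Lemma small_der S : small S -> small (der S).
Proof.
move=> [hS [B [m [B0 hB]]]]; split; first exact: ent_der.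
exists (B * 5 ^+ m * 4), m.+1; split.
  by rewrite !mulr_ge0 ?exprn_ge0.
move=> r d z r1 /andP[d0 d1] zr.
have hd : 0 < d <= 1 by apply/andP.
have hd4 : 0 < d / 4 <= 1 by apply/andP; split; lra.
pose r' := (1 + d / 4) * r; have r'1 : 1 <= r' by rewrite /r'; nra.
have rho0 : 0 < d / 4 * r by rewrite mulr_gt0 //; lra.
have G0 : 1 <= gauge r d := le_trans r1 (gauge_ge r1 hd).
(* Two margins [d / 4] fit into one margin [d], since [(1 + d / 4) ^ 2 <= 1 + d]; the 5 bounds the
   factor [4 + d] in [r' / (d / 4)]. *)
have gg : gauge r' (d / 4) <= 5 * gauge r d.
  have K1 : growth ((1 + d / 4) * r') <= growth ((1 + d) * r).
    apply: growth_mono; first by rewrite /r'; nra.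
    rewrite /r' mulrA ler_pM2r; [nra|lra].
  have K0 := @growth_ge0 ((1 + d / 4) * r') ltac:(rewrite /r'; nra).
  rewrite /gauge mulrA; apply: ler_pM; [|lra| |lra].
    by rewrite divr_ge0 //; lra.
  have -> : r' / (d / 4) = (4 + d) * (r / d) by rewrite /r'; field; rewrite gt_eqF.
  by rewrite ler_wpM2r ?divr_ge0 //; lra.
apply: le_trans (cauchy_der hS rho0 (M := B * (5 * gauge r d) ^+ m) _) _.
  move=> v vz; apply: le_trans (hB r' (d / 4) v r'1 hd4 _) _.
    by have := cnD (v - z) z; rewrite subrK /r'; lra.
  rewrite ler_wpM2l // lerXn2r ?nnegrE //; last by lra.
  by apply: le_trans (gauge_ge r'1 hd4); lra.
rewrite ler_pdivrMr // exprMn exprS.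
have g2 : 1 <= d * gauge r d by rewrite mulrC -ler_pdivrMr // mul1r gauge_ge_inv.
have Xm : 0 <= B * 5 ^+ m * gauge r d ^+ m.
  by rewrite !mulr_ge0 ?exprn_ge0 //; lra.
have -> : B * 5 ^+ m * 4 * (gauge r d * gauge r d ^+ m) * (d / 4 * r) =
  (B * 5 ^+ m * gauge r d ^+ m) * ((d * gauge r d) * r) by field.
rewrite [leLHS]mulrA ler_peMr //; nra.
Qed.

(** On the disc of radius [(1 + d / 2) r] the series of [g j - g j 0] is dominated by the growth at
    [(1 + d) r] times a geometric series of ratio at most [1 - d / 4]. This costs [4 / d], and
    Cauchy's estimate for the derivative costs [2 / (d r)]. *)
Lemma small_dgen j : small (der (g j)).
Proof.
split; first exact: ent_der.
exists 8, 2%N; split=> // r d z r1 /andP[d0 d1] zr.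
have hd : 0 < d <= 1 by apply/andP.
pose r' := (1 + d) * r; have r'0 : 0 < r' by rewrite /r'; nra.
have rho0 : 0 < d / 2 * r by rewrite mulr_gt0 //; lra.
set K := growth r'; have K0 : 0 <= K := growth_ge0 r'0.
have hgc : ent (fun z => g j z + - g j 0) by apply: entD => //; exact: ent_cst.
have -> : der (g j) z = der (fun z => g j z + - g j 0) z.
  by rewrite derD // ?der_cst ?addr0 //; exact: ent_cst.
apply: le_trans (cauchy_der hgc rho0 (M := K * (4 / d)) _) _.
  move=> v vz; rewrite -{1}(psum_tc (hg j)) -[_ + _]/(_ - _).
  have vr : cn v <= (1 + d / 2) * r by have := cnD (v - z) z; rewrite subrK; lra.
  have q1 : cn v / r' <= 1 - d / 4.
    rewrite ler_pdivrMr // /r'; apply: le_trans vr _; rewrite mulrA ler_pM2r; [nra|lra].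
  have q01 : 0 <= cn v / r' < 1.
    by rewrite divr_ge0 ?cn_ge0 ?(ltW r'0) //=; lra.
  apply: (ulim_le (psumP (tc_rapid (hg j)) v)); exists 1%N => -[//|n] _.
  have -> : ps (tc (g j)) v n.+1 - g j 0 = \sum_(1 <= k < n.+1) tc (g j) k * v ^+ k.
    rewrite /ps -(big_mkord xpredT (fun k => tc (g j) k * v ^+ k)) big_ltn //.
    by rewrite expr0 mulr1 tc_0 // addrAC subrr add0r.
  apply: le_trans (cn_sum _ _ _) _.
  apply: le_trans (_ : \sum_(1 <= k < n.+1) K * (cn v / r') ^+ k <= _).
    rewrite big_nat [leRHS]big_nat; apply: ler_sum => k /andP[k0 _].
    rewrite cnM cnX expr_div_n [K * (_ / _)]mulrA [K * _ * _]mulrAC.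
    apply: ler_wpM2r; first by rewrite exprn_ge0 ?cn_ge0.
    by rewrite ler_pdivlMr ?exprn_gt0 // growth_ub.
  rewrite -mulr_sumr ler_wpM2l //; apply: le_trans (geom_bound _ _ q01) _.
  rewrite expr1 ler_pdivrMr; last by lra.
  have -> : 4 / d * (1 - cn v / r') = 1 + ((1 - d / 4) - cn v / r') * (4 / d).
    by field; rewrite !gt_eqF.
  have : 0 <= (1 - d / 4 - cn v / r') * (4 / d).
    by rewrite mulr_ge0 ?divr_ge0 ?(ltW d0) //; lra.
  lra.
have -> : K * (4 / d) / (d / 2 * r) = 8 * (K * (d^-1 * (d^-1 * r^-1))).
  by field; rewrite !gt_eqF //; lra.
rewrite ler_pM2l //; have g1 := gauge_ge_inv r1 hd; have di : 0 < d^-1 by rewrite invr_gt0.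
have r0 : 0 < r by lra.
have ri : r^-1 <= 1 by rewrite invf_le1.
have ri0 : 0 < r^-1 by rewrite invr_gt0; lra.
have -> : gauge r d ^+ 2 = (r / d * (1 + K)) * gauge r d by rewrite expr2.
have rd : d^-1 <= r / d by rewrite ler_peMl // ltW.
have KX : K * d^-1 <= r / d * (1 + K).
  by rewrite mulrC; apply: ler_pM => //; [exact: ltW|lra].
have dX : d^-1 * r^-1 <= gauge r d by apply: le_trans g1; rewrite ler_piMr // ltW.
rewrite (mulrA K); apply: ler_pM; [|by rewrite mulr_ge0 ?(ltW di) ?(ltW ri0)|exact: KX|exact: dX].
by rewrite mulr_ge0 // ltW.
Qed.

End Family.

End SmallFunctions.

Section Borel.
Variable R : realType.
Local Notation C := R[i].
Implicit Types (F G S T : C -> C) (z w : C) (r d : R).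

(** Replaces the logarithm of the growth by its square root, so that the bound of the growth by its
    own logarithm can be resolved by squaring. *)
Lemma ln_le_sqrt (x : R) : 0 < x -> ln x <= 2 * Num.sqrt x.
Proof.
move=> x0; have s0 : 0 < Num.sqrt x by rewrite sqrtr_gt0.
rewrite -{1}(sqr_sqrtr (ltW x0)) lnXn // -[leLHS]mulr_natl ler_pM2l //.
exact/ltW/ln_sublinear.
Qed.

(** [S] and [T] are at most a constant times a power of the gauge, so [jensen_bound] applies with
    [L] linear in the logarithm of the gauge. *)
Lemma growth_log_bound (I : finType) (g : I -> C -> C) : (forall j, ent (g j)) ->
  (forall j, exists S T, [/\ small g S, small g T, exists z, S z != 0 &
    forall z, S z * cexp (g j z) = T z]) ->
  exists2 B : R, 1 <= B & forall r d, 1 <= r -> 0 < d <= 1 ->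
    growth g r <= B * (1 + ln (gauge g r d)).
Proof.
move=> hg H.
have /choice[B hB] : forall j, exists B : R, 0 <= B /\ forall r d n, 1 <= r -> 0 < d <= 1 ->
    (0 < n)%N -> cn (tc (g j) n) * r ^+ n <= B * (1 + ln (gauge g r d)).
  move=> j; have [S [T [[hS [B1 [m1 [B10 hB1]]]] [hT [B2 [m2 [B20 hB2]]]] S0 ST]]] := H j.
  have [K K0 hK] := jensen_bound (hg j) hS S0 ST.
  pose D := 1 + B1 + B2; have D1 : 1 <= D by rewrite /D; lra.
  have lD : 0 <= ln D by rewrite ln_ge0.
  exists (K * (1 + ln D + (m1 + m2)%:R)); split.
    by rewrite mulr_ge0 ?(ltW K0) // addr_ge0 //; lra.
  move=> r d n r1 hd n0; set X := gauge g r d.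
  have X1 : 1 <= X := le_trans r1 (gauge_ge hg r1 hd).
  have lX : 0 <= ln X by rewrite ln_ge0.
  have X0 : 0 < X by lra.
  apply: le_trans (hK r (ln D + (m1 + m2)%:R * ln X) r1 _ _ n n0) _.
  - by rewrite addr_ge0 // mulr_ge0.
  - move=> z zr; have eL : expR (ln D + (m1 + m2)%:R * ln X) = D * X ^+ (m1 + m2).
      by rewrite expRD expRM_natl !lnK ?posrE //; lra.
    have zr' : cn z <= r by rewrite zr.
    rewrite eL; split.
      apply: le_trans (hB1 r d z r1 hd zr') _; apply: ler_pM => //.
      - by rewrite exprn_ge0 // ltW.
      - by rewrite /D; lra.
      - by rewrite ler_weXn2l // leq_addr.
    apply: le_trans (hB2 r d z r1 hd zr') _; apply: ler_pM => //.
    - by rewrite exprn_ge0 // ltW.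
    - by rewrite /D; lra.
    - by rewrite ler_weXn2l // leq_addl.
  rewrite -mulrA ler_pM2l //.
  have : 0 <= (m1 + m2)%:R :> R by [].
  nra.
have B0 j : 0 <= B j by have [] := hB j.
have sB : 0 <= \sum_j B j by apply: sumr_ge0.
exists (1 + \sum_j B j) => [|r d r1 hd]; first lra.
have X1 : 1 <= gauge g r d := le_trans r1 (gauge_ge hg r1 hd).
have lX : 0 <= ln (gauge g r d) by rewrite ln_ge0.
apply: growth_le; first by rewrite mulr_ge0 //; lra.
move=> j n n0; have [_ h] := hB j; apply: le_trans (h r d n r1 hd n0) _.
apply: ler_wpM2r; first lra.
by rewrite (bigD1 j) //= addrCA lerDl addr_ge0 // sumr_ge0.
Qed.

(* By [growth_log_bound], if the growth is large compared with 1 + ln r then it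
   doubles between r (2 - 2^-k) and r (2 - 2^-(k+1)) for every k, although it is
   bounded by its value at 2 r. *)
Lemma units_of_small_quotient_cst (I : finType) (g : I -> C -> C) :
  (forall j, ent (g j)) ->
  (forall j, exists S T, [/\ small g S, small g T, exists z, S z != 0 &
    forall z, S z * cexp (g j z) = T z]) ->
  forall j z, g j z = g j 0.
Proof.
move=> hg /(growth_log_bound hg) [B B1 hB] j.
(* With [s] the root of one plus the new growth and [L = l * 2 ^ k], the log bound reads
   [A L <= B (7 L + 2 s)]; the 7 collects 1, 2, [l] and [4 * 2 ^ k]. This [A] turns it into
   [t L <= s], and [2 A + 1 <= t ^ 2] then yields the doubling. *)
pose t := 18 * B + 1; pose A := B * (7 + 2 * t).
have tB : 2 * A + 1 <= t * t by rewrite /A /t; nra.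
have A1 : 1 <= A by rewrite /A /t; nra.
have t1 : 1 <= t by rewrite /t; lra.
have small_growth r : 1 <= r -> growth g r < A * (1 + ln r).
  move=> r1; rewrite ltNge; apply/negP => big0.
  pose l := 1 + ln r; have l1 : 1 <= l by have := ln_ge0 r1; rewrite /l; lra.
  pose rr k := r * (2 - 2^-1 ^+ k) : R.
  have p2 k : 0 < (2^-1 : R) ^+ k <= 1.
    by rewrite exprn_gt0 ?invr_gt0 //= exprn_ile1 // invf_le1 ?ler1n.
  have rr1 k : r <= rr k <= 2 * r by have /andP[] := p2 k; rewrite /rr; nra.
  have big k : A * l * 2 ^+ k <= growth g (rr k).
    elim: k => [|k IH].
      by rewrite /rr !expr0 mulr1 (_ : 2 - 1 = 1 :> R) ?mulr1 //; lra.
    pose d : R := 2^-1 ^+ k.+2.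
    have hd : 0 < d <= 1 := p2 _.
    have [rk1 rk2] := andP (rr1 k).
    have rk : 1 <= rr k by lra.
    have K'r : growth g ((1 + d) * rr k) <= growth g (rr k.+1).
      apply: growth_mono => //; first by case/andP: hd; nra.
      have [h1 h2] := andP (p2 k).
      rewrite /d /rr !exprS; nra.
    set K' := growth g ((1 + d) * rr k) in K'r.
    have K'0 : 0 <= K' by apply: growth_ge0 => //; case/andP: hd; nra.
    have H := hB _ _ rk hd; rewrite /gauge -/K' in H.
    have d0 : 0 < d by case/andP: hd.
    have rk0 : 0 < rr k by lra.
    have r0 : 0 < r by lra.
    have di0 : 0 < d^-1 by rewrite invr_gt0.
    have rd0 : 0 < rr k / d by rewrite mulr_gt0.
    have K'1 : 0 < 1 + K' by lra.
    have E1 : ln (rr k / d * (1 + K')) = ln (rr k) + ln d^-1 + ln (1 + K').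
      by rewrite lnM ?posrE // lnM ?posrE.
    have E2 : ln (rr k) <= 2 + ln r.
      apply: le_trans (_ : ln (2 * r) <= _).
        by rewrite ler_ln ?posrE //; lra.
      rewrite lnM ?posrE //; have := @ln_sublinear R 2 ltac:(lra); lra.
    have E3 : ln d^-1 <= 4 * 2 ^+ k.
      have -> : 4 * 2 ^+ k = d^-1 :> R.
        by rewrite /d exprVn invrK !exprS; ring.
      by apply/ltW/ln_sublinear; rewrite invr_gt0.
    have E4 : ln (1 + K') <= 2 * Num.sqrt (1 + K') by apply: ln_le_sqrt; lra.
    have k1 : 1 <= (2 : R) ^+ k by rewrite exprn_ege1 // ler1n.
    have lk : 1 <= l * 2 ^+ k by nra.
    have lk2 : 2 ^+ k <= l * 2 ^+ k by nra.
    have lk3 : l <= l * 2 ^+ k by nra.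
    set s := Num.sqrt (1 + K') in E4.
    have ss : s * s = 1 + K' by rewrite -expr2 sqr_sqrtr //; lra.
    have Hs : A * (l * 2 ^+ k) <= B * (7 * (l * 2 ^+ k) + 2 * s).
      rewrite mulrA; apply: le_trans IH (le_trans H _).
      by rewrite ler_pM2l ?E1; [rewrite /l in lk lk2 lk3 *; lra|lra].
    set L := l * 2 ^+ k in lk lk2 lk3 Hs.
    have s1 : t * L <= s.
      have : B * (t * L) <= B * s by rewrite /A in Hs; lra.
      by rewrite ler_pM2l //; lra.
    apply: le_trans K'r; rewrite exprS.
    have -> : A * l * (2 * 2 ^+ k) = 2 * A * L by rewrite /L; ring.
    have : (t * L) * (t * L) <= 1 + K'.
      by rewrite -ss; apply: ler_pM => //; rewrite mulr_ge0 //; lra.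
    have : (2 * A + 1) * L <= (t * L) * (t * L).
      apply: le_trans (_ : t * t * L <= _); first by rewrite ler_wpM2r //; lra.
      have -> : t * L * (t * L) = (t * t * L) * L by ring.
      by rewrite ler_peMr // !mulr_ge0 //; lra.
    lra.
  have half01 : 0 <= (2^-1 : R) < 1 by lra.
  have [k hk] := expr_small (growth g (2 * r)) half01 (e := 2^-1) ltac:(lra).
  have {}hk := hk k (leqnn k).
  have h2 : growth g (rr k) <= growth g (2 * r).
    by have /andP[h3 h4] := rr1 k; apply: growth_mono => //; lra.
  have h5 := le_trans (big k) h2.
  have pk : 0 < (2 : R) ^+ k by rewrite exprn_gt0.
  move: hk; rewrite exprVn ler_pdivrMr // => hk.
  have : 1 * 2 ^+ k <= A * l * 2 ^+ k by rewrite ler_pM2r //; nra.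
  lra.
apply: cst_of_tc => // n n0; apply: small_eq0 => e e0.
(* At radius [x ^ 2] the growth is below [A (1 + 2 ln x) <= 3 A x], so the coefficient is at most
   [3 A / x], hence at most [e]. *)
pose x : R := Num.max 1 (3 * A / e).
have x1 : 1 <= x by rewrite /x le_max lexx.
have xA : 3 * A <= e * x.
  by rewrite mulrC [e * x]mulrC -ler_pdivrMr // mulrC /x le_max lexx orbT.
have x0 : 0 < x by lra.
have x21 : 1 <= x ^+ 2 by rewrite exprn_ege1.
have := growth_ub hg j (lt_le_trans ltr01 x21) n0.
have := small_growth _ x21; rewrite lnXn // => h1 h2.
have lx : ln x < x := ln_sublinear x0.
have h3 : cn (tc (g j) n) * x ^+ 2 <= 3 * A * x.
  apply: le_trans (_ : A * (1 + ln x *+ 2) <= _); last by rewrite -[ln x *+ 2]mulr_natl; nra.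
  apply: le_trans (ltW h1); apply: le_trans h2.
  by rewrite ler_wpM2l ?cn_ge0 // -[leLHS]expr1 ler_weXn2l.
rewrite -(ler_pM2r (x := x ^+ 2)) ?exprn_gt0 //; apply: le_trans h3 _.
by rewrite expr2 [leRHS]mulrA; apply: ler_wpM2r; [lra|exact: xA].
Qed.

(* Differentiating the relation divided by its term of index l removes that term;
   the new coefficients are the Wronskians Q. *)
Lemma elimination (P : (C -> C) -> Prop) (I : finType) (g : I -> C -> C) :
  (forall S, P S -> ent S) -> (forall S, P S -> P (der S)) ->
  (forall S T, P S -> P T -> P (fun z => S z * T z)) ->
  (forall S T, P S -> P T -> P (fun z => S z + T z)) ->
  (forall S T, P S -> P T -> P (fun z => S z - T z)) ->
  (forall i, ent (g i)) -> (forall i, P (der (g i))) ->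
  forall n (A : {set I}) (S : I -> C -> C) i j, #|A| = n.+2 ->
    i \in A -> j \in A -> i != j -> (forall k, P (S k)) ->
    (forall k, k \in A -> exists z, S k z != 0) ->
    (forall z, \sum_(k in A) S k z * cexp (g k z) = 0) ->
    (forall c : I -> C, (forall z, \sum_(k in A) c k * (S k z * cexp (g k z)) = 0) ->
       forall k l, k \in A -> l \in A -> c k = c l) ->
  exists S1 S2, [/\ P S1, P S2, exists z, S1 z != 0 &
    forall z, S1 z * cexp (g i z) = S2 z * cexp (g j z)].
Proof.
move=> Pent Pder PM PD PB hg Pg; elim=> [|n IH] A S i j cA iA jA ij PS S0 rel ind.
  have AE : A = [set i; j].
    apply/esym/eqP; rewrite eqEcard cA cards2 ij andbT.
    by apply/fintype.subsetP => x; rewrite !inE => /orP[] /eqP ->.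
  (* The second witness is [- S j], written with the sum and the difference under which [P] is
     closed. *)
  exists (S i), (fun z => S j z - (S j z + S j z)); split => //; [by apply: PB => //; apply: PD|exact: S0|].
  move=> z; have := rel z; rewrite AE big_setU1 ?inE //= big_set1 => /eqP.
  by rewrite addr_eq0 => /eqP ->; ring.
have [l lA /andP[li lj]] : exists2 l, l \in A & (l != i) && (l != j).
  apply/exists_inP; apply: contraT => /exists_inPn h.
  have : A \subset [set i; j].
    by apply/fintype.subsetP => x /h; rewrite negb_and !negbK !inE.
  by move=> /subset_leq_card; rewrite cA cards2 ij.
pose y k z := S k z * cexp (g k z).
have hy k : ent (y k).
  by apply: entM; [exact: Pent|apply: ent_comp (hg k) (@ent_exp R)].
pose Q k z := der (S k) z * S l z - S k z * der (S l) z +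
   S k z * S l z * (der (g k) z - der (g l) z).
have PQ k : P (Q k).
  by apply: (PD (fun z => der (S k) z * S l z - S k z * der (S l) z));
    [apply PB; apply PM; auto|apply PM; [apply PM|apply PB]].
have dy k z : der (y k) z = (der (S k) z + S k z * der (g k) z) * cexp (g k z).
  rewrite /y derM ?der_exp //; [by ring|exact: Pent|].
  exact: ent_comp (hg k) (@ent_exp R).
have QE k z : Q k z * cexp (g k z) * cexp (g l z) = der (y k) z * y l z - y k z * der (y l) z.
  by rewrite !dy /Q /y; ring.
have lyl : exists z, y l z != 0.
  by have [z hz] := S0 l lA; exists z; rewrite mulf_neq0 // cexp_neq0.
have hP i' : ent (Q i') := Pent _ (PQ i').
have relA z : \sum_(k in A) y k z = 0 by exact: rel.
have dsum (c : I -> C) (D : {set I}) z : der (fun z => \sum_(k in D) c k * y k z) z =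
    \sum_(k in D) c k * der (y k) z.
  apply: der_eq.
    by apply: ent_sum => k _; apply: entM => //; exact: ent_cst.
  elim: (index_enum I) => [|k s IHs].
    by under eq_fun do rewrite big_nil; rewrite big_nil; exact: cdiff_cst.
  rewrite big_cons; case kD: (k \in D).
    under eq_fun do rewrite big_cons kD.
    by apply: cdiffD => //; apply: cdiffZ; exact: cdiff_der.
  by under eq_fun do rewrite big_cons kD.
have QSum (c : I -> C) (D : {set I}) z :
    (\sum_(k in D) c k * (Q k z * cexp (g k z))) * cexp (g l z) =
    der (fun z => \sum_(k in D) c k * y k z) z * y l z
      - (\sum_(k in D) c k * y k z) * der (y l) z.
  rewrite dsum !big_distrl -sumrB; apply: eq_bigr => k _ /=.
  by rewrite -mulrA QE; ring.
have hsum (c : I -> C) (D : {set I}) : ent (fun z => \sum_(k in D) c k * y k z).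
  by apply: ent_sum => k _; apply: entM => //; exact: ent_cst.
have indQ (c : I -> C) :
    (forall z, \sum_(k in A :\ l) c k * (Q k z * cexp (g k z)) = 0) ->
    forall k m, k \in A :\ l -> m \in A :\ l -> c k = c m.
  move=> hc.
  (* A relation between the Wronskians makes the same combination of the [y k] proportional to
     [y l]; with the coefficient [- kap] at [l] it becomes a relation on [A], to which [ind]
     applies. *)
  have [kap hkap] : exists kap : C, forall z, \sum_(k in A :\ l) c k * y k z = kap * y l z.
    apply: wronskian_eq0 => // z; apply/eqP; rewrite -subr_eq0 -QSum hc mul0r eqxx //.
  pose c' k := if k == l then - kap else c k.
  have hc' z : \sum_(k in A) c' k * (S k z * cexp (g k z)) = 0.
    rewrite (big_setD1 l) //= {1}/c' eqxx mulNr.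
    rewrite (eq_bigr (fun k => c k * y k z)) ?hkap ?addNr // => k.
    by rewrite !inE /c' => /andP[/negPf ->].
  move=> k m; rewrite !inE => /andP[kl kA] /andP[ml mA].
  by have := ind c' hc' k m kA mA; rewrite /c' (negPf kl) (negPf ml).
have iA' : i \in A :\ l by rewrite !inE eq_sym li.
have jA' : j \in A :\ l by rewrite !inE eq_sym lj.
apply: (IH (A :\ l) Q) => //.
- by move: cA; rewrite (cardsD1 l) lA add1n => -[].
- move=> k kA'; apply/not_existsP => h.
  have Qk0 z : Q k z = 0 by have /negP/negPn/eqP := h z.
  have [m mA' mk] : exists2 m, m \in A :\ l & m != k.
    by have [ik|ik] := eqVneq i k; [exists j; rewrite // -ik eq_sym|exists i].
  have := indQ (fun m => (m == k)%:R) _ k m kA' mA'; rewrite eqxx (negPf mk).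
  move=> /(_ _)/wrap[z|/eqP]; last by rewrite oner_eq0.
  rewrite (bigD1 k) //= eqxx Qk0 mul0r mulr0 add0r big1 // => m' /andP[_ /negPf ->].
  by rewrite mul0r.
- move=> z; apply: (mulIf (cexp_neq0 (g l z))); rewrite mul0r.
  have := QSum (fun=> 1) (A :\ l) z; under eq_bigr do rewrite mul1r; move=> ->.
  have E w : \sum_(k in A :\ l) 1 * y k w = - y l w.
    under eq_bigr do rewrite mul1r.
    by apply/eqP; rewrite -addr_eq0 addrC -big_setD1 //= relA.
  have -> : (fun w => \sum_(k in A :\ l) 1 * y k w) = (fun w => (-1) * y l w).
    by apply/funext => w; rewrite E mulN1r.
  by rewrite derZ // E; ring.
Qed.

(** A set of least cardinality that carries a relation without zero coefficients. From a second
    relation subtract [c' k] times the first: the term [k] disappears, so by minimality nothing may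
    remain. *)
Lemma minimal_relation (I : finType) (x : I -> C -> C) (A0 : {set I}) :
  A0 != finset.set0 -> (forall i, i \in A0 -> exists z, x i z != 0) ->
  (forall z, \sum_(i in A0) x i z = 0) ->
  exists (A : {set I}) (c : I -> C), [/\ A \subset A0, (1 < #|A|)%N,
    forall i, i \in A -> c i != 0, forall z, \sum_(i in A) c i * x i z = 0 &
    forall c' : I -> C, (forall z, \sum_(i in A) c' i * (c i * x i z) = 0) ->
      forall k l, k \in A -> l \in A -> c' k = c' l].
Proof.
move=> A00 x0 rel.
pose good (A : {set I}) := `[< A != finset.set0 /\ A \subset A0 /\ exists c : I -> C,
  (forall i, i \in A -> c i != 0) /\ forall z, \sum_(i in A) c i * x i z = 0 >].
have good0 : good A0.
  apply/asboolP; split=> //; split=> //; exists (fun=> 1); split=> [i _|z].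
    exact: oner_neq0.
  by under eq_bigr do rewrite mul1r.
case: (arg_minnP (fun A : {set I} => #|A|) good0) => A /asboolP [An0 [AA0 [c [c0 hc]]]] Amin.
exists A, c; split => //.
  rewrite ltnNge; apply/negP => cA; move: An0; rewrite -card_gt0 => cA'.
  have /cards1P[i Ai] : #|A| == 1%N by rewrite eqn_leq cA cA'.
  have iA : i \in A by rewrite Ai inE.
  have [z xz] := x0 i (fintype.subsetP AA0 i iA).
  have := hc z; rewrite Ai big_set1 => /eqP; rewrite mulf_eq0 (negPf xz) orbF.
  by rewrite (negPf (c0 i iA)).
move=> c' hc' k l kA lA; apply/eqP/negPn/negP => ckl.
pose c2 i := (c' i - c' k) * c i.
pose A2 := [set i in A | c' i != c' k].
have : good A2.
  apply/asboolP; split; first by apply/finset.set0Pn; exists l; rewrite !inE lA eq_sym.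
  split; first by apply: fintype.subset_trans AA0; apply/fintype.subsetP => i; rewrite inE => /andP[].
  exists c2; split=> [i|z].
    by rewrite inE => /andP[iA hi]; rewrite mulf_neq0 ?c0 // subr_eq0.
  have -> : \sum_(i in A2) c2 i * x i z = \sum_(i in A) c2 i * x i z.
    rewrite [RHS](bigID (fun i => c' i != c' k)) /= [X in _ + X]big1 ?addr0.
      by apply: eq_bigl => i; rewrite inE.
    by move=> i /andP[_ /negPn/eqP]; rewrite /c2 => ->; rewrite subrr !mul0r.
  have -> : \sum_(i in A) c2 i * x i z =
     \sum_(i in A) c' i * (c i * x i z) - c' k * \sum_(i in A) c i * x i z.
    by rewrite mulr_sumr -sumrB; apply: eq_bigr => i _; rewrite /c2; ring.
  by rewrite hc' hc mulr0 subrr.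
move=> /Amin; apply/negP; rewrite -ltnNge; apply: proper_card.
apply/fintype.properP; split; first by apply/fintype.subsetP => i; rewrite inE => /andP[].
by exists k; rewrite // inE eqxx andbF.
Qed.

(** A minimal relation is divided by the exponential of one exponent [h j0]. Elimination then writes
    the exponential of each difference [h i - h j0] as a quotient of functions small relative to
    these very differences, so they are constant; minimality leaves at least two indices. *)
Theorem borel_one_variable (I : finType) (p : I -> {poly C}) (h : I -> C -> C)
    (A0 : {set I}) :
  A0 != finset.set0 -> (forall i, i \in A0 -> p i != 0) -> (forall i, ent (h i)) ->
  (forall z, \sum_(i in A0) (p i).[z] * cexp (h i z) = 0) ->
  exists i j, [/\ i \in A0, j \in A0, i != j &
    forall z, h i z - h j z = h i 0 - h j 0].
Proof.
move=> A00 p0 hh rel.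
have pnz i : i \in A0 -> exists z, (p i).[z] != 0.
  move=> /p0 pi; apply/not_existsP => hz.
  have r z : root (p i) z by have /negP/negPn := hz z.
  move/eqP: pi; apply; apply: (@roots_geq_poly_eq0 _ _ (map (fun n => n%:R) (iota 0 (size (p i))))).
  - by apply/allP => z _; exact: r.
  - rewrite map_inj_uniq ?iota_uniq // => m n /eqP.
    by rewrite eqr_nat => /eqP.
  - by rewrite size_map size_iota.
have [|A [c [AA0 cA c0 hc ind]]] :=
    @minimal_relation I (fun i z => (p i).[z] * cexp (h i z)) A0 A00 _ rel.
  by move=> i /pnz [z hz]; exists z; rewrite mulf_neq0 ?cexp_neq0.
have [j0 j0A] : exists j0, j0 \in A.
  by apply/finset.set0Pn; rewrite -card_gt0; apply: leq_trans cA.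
(* The value 0 outside [A] keeps the family indexed by all of [I]; there the required small quotient
   is the constant 1. *)
pose g i : C -> C := if i \in A then (fun z => h i z - h j0 z) else fun=> 0.
have hg i : ent (g i).
  by rewrite /g; case: ifP => _; [exact: entB|exact: ent_cst].
pose S i z := c i * (p i).[z].
have sS i : small g (S i).
  by apply: smallM => //; [exact: small_cst|exact: small_poly].
have gE i z : i \in A -> cexp (g i z) * cexp (h j0 z) = cexp (h i z).
  by move=> iA; rewrite /g iA -cexpD subrK.
have sumE (c' : I -> C) z : (\sum_(k in A) c' k * (S k z * cexp (g k z))) * cexp (h j0 z)
    = \sum_(k in A) c' k * (c k * ((p k).[z] * cexp (h k z))).
  by rewrite big_distrl; apply: eq_bigr => k kA /=; rewrite /S -(gE k z kA); ring.
have gcst : forall i z, g i z = g i 0.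
  apply: units_of_small_quotient_cst => // i.
  have [[iA ij]|nij] : (i \in A /\ i != j0) \/ (g i = fun=> 0).
  - case iA: (i \in A); last by right; rewrite /g iA.
    have [->|] := eqVneq i j0; last by left.
    by right; apply/funext => z; rewrite /g j0A subrr.
  - have := @elimination (small g) I g _ _ _ _ _ hg _ #|A|.-2 A S i j0.
    move=> /(_ _)/wrap[|]; first by move=> ? [].
    move=> /(_ _)/wrap[|]; first exact: small_der.
    move=> /(_ _)/wrap[|]; first exact: smallM.
    move=> /(_ _)/wrap[|]; first exact: smallD.
    move=> /(_ _)/wrap[|]; first exact: smallB.
    move=> /(_ _)/wrap[|]; first exact: small_dgen.
    move=> /(_ _)/wrap[|]; first by case: #|A| cA => [|[]].
    move=> /(_ iA j0A ij sS).
    move=> /(_ _)/wrap[k kA|].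
      have [z hz] := pnz k (fintype.subsetP AA0 k kA).
      by exists z; rewrite /S mulf_neq0 ?c0.
    move=> /(_ _)/wrap[z|].
      apply: (mulIf (cexp_neq0 (h j0 z))); rewrite mul0r -[RHS](hc z).
      have := sumE (fun=> 1) z; under eq_bigr do rewrite mul1r; move=> ->.
      by apply: eq_bigr => k _; rewrite mul1r.
    move=> /(_ _)/wrap[c' hc'|].
      by apply: ind => z; rewrite -sumE hc' mul0r.
    move=> [S1 [S2 [hS1 hS2 S10 E]]]; exists S1, S2; split=> // z.
    by rewrite E /g j0A subrr cexp0 mulr1.
  exists (fun=> 1), (fun=> 1); split; [exact: small_cst|exact: small_cst| |].
    by exists 0; exact: oner_neq0.
  by move=> z; rewrite nij cexp0 mulr1.
have [k kA kj0] : exists2 k, k \in A & k != j0.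
  apply/exists_inP; apply: contraT => /exists_inPn hk.
  have : A \subset [set j0] by apply/fintype.subsetP => x /hk; rewrite negbK inE.
  by move=> /subset_leq_card; rewrite cards1 leqNgt cA.
exists k, j0; split=> //; [exact: (fintype.subsetP AA0)|exact: (fintype.subsetP AA0)|].
by move=> z; have := gcst k z; rewrite /g kA.
Qed.

End Borel.

(** * Entire functions of several variables *)

Section DifferentiabilityCriteria.
Variable K : numFieldType.
Local Open Scope classical_set_scope.

Lemma differentiable_flat (V W : normedModType K) (f : V -> W) x :
  (forall e : K, 0 < e -> \forall h \near (0 : V), `|f (h + x) - f x| <= e * `|h|) ->
  differentiable f x.
Proof.
move=> hf.
have c0 : continuous (\0 : V -> W) by exact: cst_continuous.
have E : f \o shift x = cst (f x) + (\0 : V -> W) +o_ (0 : V) id.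
  apply/eqaddoP => e e0; have := hf e e0; apply: filterS => h.
  by rewrite -![(_ + _ : _ -> _) _]/(_ + _) -![(- _ : _ -> _) _]/(- _) /= addr0.
have du : 'd f x = \0 :> (V -> W) := diff_unique c0 E.
by apply/diff_locallyP; rewrite du.
Qed.

Lemma differentiable_near_lipschitz (V W : normedModType K) (f : V -> W) x :
  differentiable f x ->
  exists2 c : K, 0 < c & \forall h \near (0 : V), `|f (h + x) - f x| <= c * `|h|.
Proof.
move=> df; have [dc E] := (proj1 (diff_locallyP x f)) df.
have /linear_boundedP/pinfty_ex_gt0[r r0 hr] := @continuous_linear_bounded _ _ _ 0 _ (dc 0).
exists (r + 1); first by rewrite addr_gt0.
have /eqaddoP/(_ 1 ltr01) := E; apply: filterS => h.
rewrite -![(_ + _ : _ -> _) _]/(_ + _) -![(- _ : _ -> _) _]/(- _) /= mul1r => H.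
rewrite mulrDl mul1r [r * _ + _]addrC.
have -> : f (h + x) - f x = (f (h + x) - (f x + 'd f x h)) + 'd f x h.
  by rewrite opprD addrA subrK.
by apply: le_trans (ler_normD _ _) _; apply: lerD.
Qed.

Lemma near_cvg0 (V : normedModType K) (x : V) (P : V -> Prop) :
  (\forall z \near x, P z) -> \forall h \near (0 : V), P (h + x).
Proof. by move=> h; rewrite (near_shift x) /= sub0r; near=> y; rewrite /= subrK; near: y.
Unshelve. all: by end_near. Qed.

(** The difference of [g] and [u / c] is flat at [z0]: the expansion of [E] compares [c (g - g z0)]
    with [u - u z0] up to a small multiple of [g - g z0], and the Lipschitz bound of [u] controls
    the latter. *)
Lemma differentiable_local_inverse (V : normedModType K) (u g : V -> K) (E : K -> K)
    (z0 : V) (c : K) :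
  differentiable u z0 -> c != 0 ->
  (forall e : K, 0 < e -> exists2 d : K, 0 < d & forall y, `|y - g z0| < d ->
     `|E y - E (g z0) - c * (y - g z0)| <= e * `|y - g z0|) ->
  (forall e : K, 0 < e -> \forall z \near z0, `|g z - g z0| < e) ->
  (forall z, E (g z) = u z) ->
  differentiable g z0.
Proof.
move=> du c0 hE hg Eg; pose v z := c^-1 *: u z.
have dv : differentiable (v : V -> K) z0 by exact: differentiableZ.
have nc : 0 < `|c| by rewrite normr_gt0.
suff dw : differentiable ((fun z => g z - v z) : V -> K) z0.
  have := differentiableD dw dv; congr (differentiable _ _).
  by apply/funext => z; rewrite -[(_ + _ : _ -> _) _]/(_ + _) subrK.
have [C C0 hC] := differentiable_near_lipschitz du.
apply: differentiable_flat => e e0.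
pose b := 2^-1 * `|c|; have b0 : 0 < b by rewrite mulr_gt0 // invr_gt0.
have [d1 d10 h1] := hE b b0.
pose e2 := e * `|c| * b / C.
have e20 : 0 < e2 by rewrite divr_gt0 // !mulr_gt0.
have [d2 d20 h2] := hE e2 e20.
have n1 := near_cvg0 (hg d1 d10); have n2 := near_cvg0 (hg d2 d20).
near=> h.
have g1 : `|g (h + z0) - g z0| < d1 by near: h.
have g2 : `|g (h + z0) - g z0| < d2 by near: h.
have hu : `|u (h + z0) - u z0| <= C * `|h| by near: h.
have := h1 _ g1; have := h2 _ g2; rewrite !Eg.
set G := g (h + z0) - g z0; set U := u (h + z0) - u z0 => A B.
have GU : b * `|G| <= `|U|.
  have T : `|c * G| <= `|U| + b * `|G|.
    have -> : c * G = U - (U - c * G) by rewrite subKr.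
    by apply: le_trans (ler_normB _ _) _; rewrite lerD2l.
  have cb : `|c * G| = b * `|G| + b * `|G|.
    by rewrite normrM -mulrDl; congr (_ * _); rewrite /b; field.
  by move: T; rewrite cb lerD2r.
have -> : g (h + z0) - v (h + z0) - (g z0 - v z0) = - (c^-1 * (U - c * G)).
  by rewrite /v /GRing.scale /= /U /G; field.
rewrite normrN normrM normfV mulrC ler_pdivrMr //.
apply: le_trans A _.
have -> : e * `|h| * `|c| = e2 / b * (C * `|h|) by rewrite /e2; field; rewrite !gt_eqF.
rewrite -[e2 / b * _]mulrA ler_pM2l // mulrC.
by rewrite ler_pdivlMr // mulrC; apply: le_trans GU hu.
Unshelve. all: by end_near. Qed.

Lemma near0_eps (V : normedModType K) (P : V -> Prop) :
  (\forall h \near (0 : V), P h) -> exists2 d : K, 0 < d & forall h, `|h| < d -> P h.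
Proof.
move=> /nbhs_ballP[d /= d0 hd]; exists d => // h hh; apply: hd.
by rewrite -ball_normE /= sub0r normrN.
Qed.

Section Entire.
Variable n : nat.
Local Notation Kn := 'rV[K]_n.
Implicit Types (f g : Kn -> K) (z w : Kn) (p : mpoly n K).

Lemma entireD f g : entire f -> entire g -> entire (fun z => f z + g z).
Proof. by move=> hf hg z; exact: differentiableD. Qed.

Lemma entireM f g : entire f -> entire g -> entire (fun z => f z * g z).
Proof. by move=> hf hg z; exact: differentiableM. Qed.

Lemma entire_cst (a : K) : entire (fun _ : Kn => a).
Proof. by move=> z; exact: differentiable_cst. Qed.

Lemma entireN f : entire f -> entire (fun z => - f z).
Proof. by move=> hf z; exact: differentiableN. Qed.

Lemma entireB f g : entire f -> entire g -> entire (fun z => f z - g z).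
Proof. by move=> hf hg; apply: entireD => //; exact: entireN. Qed.

Lemma entire_coord j : entire (fun z : Kn => z ord0 j).
Proof. by move=> z; exact: differentiable_coord. Qed.

Lemma entire_shift c f : entire f -> entire (shift_by c f).
Proof.
move=> hf z; apply: (@differentiable_comp _ _ _ _ (fun x => x + c) f); last exact: hf.
have := differentiableD (@ex_diff _ _ _ _ _ _ _ (is_diff_id z)) (differentiable_cst c z).
by congr (differentiable _ _).
Qed.

Lemma entire_prod (I : Type) (s : seq I) (P : pred I) (F : I -> Kn -> K) :
  (forall i, P i -> entire (F i)) -> entire (fun z => \prod_(i <- s | P i) F i z).
Proof.
move=> h; elim: s => [|i s IH].
  by under eq_fun do rewrite big_nil; exact: entire_cst.
case Pi: (P i); under eq_fun do rewrite big_cons Pi; last exact: IH.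
by apply: entireM => //; exact: h.
Qed.

Lemma entire_sum (I : Type) (s : seq I) (P : pred I) (F : I -> Kn -> K) :
  (forall i, P i -> entire (F i)) -> entire (fun z => \sum_(i <- s | P i) F i z).
Proof.
move=> h; elim: s => [|i s IH].
  by under eq_fun do rewrite big_nil; exact: entire_cst.
case Pi: (P i); under eq_fun do rewrite big_cons Pi; last exact: IH.
by apply: entireD => //; exact: h.
Qed.

Lemma entire_peval p : entire (peval p).
Proof.
rewrite /peval; under eq_fun do rewrite mevalE.
apply: entire_sum => m _; apply: entireM; first exact: entire_cst.
apply: entire_prod => j _; elim: (m j) => [|k IH].
  by under eq_fun do rewrite expr0; exact: entire_cst.
by under eq_fun do rewrite exprS; apply: entireM => //; exact: entire_coord.
Qed.

Lemma entire_line f z w : entire f -> exists l : K, forall e : K, 0 < e ->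
  exists2 d : K, 0 < d & forall t : K, `|t| < d ->
    `|f (z + t *: w) - f z - l * t| <= e * `|t|.
Proof.
move=> hf; exists ('D_w f z) => e e0.
have /derivable_nbhs E := @diff_derivable _ _ _ f z w (hf z).
have /eqaddoP/(_ e e0)/(near0_eps (V := K^o))[d d0 hd] := E.
exists d => // t /hd; rewrite -![(_ + _ : _ -> _) _]/(_ + _) -![(- _ : _ -> _) _]/(- _) /=.
by rewrite [t *: w + z]addrC opprD addrA /GRing.scale /= [t * _]mulrC.
Qed.

Lemma entire_continuous_eps f z (e : K) : entire f -> 0 < e ->
  exists2 d : K, 0 < d & forall h, `|h| < d -> `|f (z + h) - f z| < e.
Proof.
move=> hf e0; have /cvgrPdist_lt/(_ e e0)/near_cvg0/near0_eps[d d0 hd] :=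
  differentiable_continuous (hf z).
by exists d => // h /hd; rewrite distrC [h + z]addrC.
Qed.

End Entire.
End DifferentiabilityCriteria.

(** * Logarithms of entire functions without zeros *)

Section EntireLogarithm.
Variables (R : realType) (n : nat).
Local Notation C := R[i].
Local Notation Cn := 'rV[C]_n.
Implicit Types (f g u : Cn -> C) (z w : Cn) (t s : C).
Local Open Scope classical_set_scope.

Lemma posC (d : C) : 0 < d -> exists2 r : R, 0 < r & d = r%:C%C.
Proof.
case: d => a b; rewrite ltcE /= => /andP[/eqP b0 a0]; exists a => //.
by rewrite b0.
Qed.

Lemma ltC_cn (t : C) (r : R) : (`|t| < r%:C%C) = (cn t < r).
Proof. by rewrite cn_normE ltcR. Qed.

Lemma rc_gt0 (r : R) : 0 < r -> (0 : C) < r%:C%C.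
Proof. by rewrite -ltcR. Qed.

Lemma ent_line f z w : entire f -> ent (fun t => f (z + t *: w)).
Proof.
move=> hf t; have [l hl] := entire_line (z + t *: w) w hf; exists l => e e0.
have [d /posC[r r0 ->] hd] := hl _ (rc_gt0 e0).
exists r => // s st.
have := hd (s - t); rewrite ltC_cn => /(_ st).
have -> : z + t *: w + (s - t) *: w = z + s *: w.
  by rewrite -addrA -scalerDl [t + _]addrC subrK.
by rewrite -lecR rcM -!cn_normE.
Qed.

Lemma entire_continuous_cn f z (e : R) : entire f -> 0 < e ->
  exists2 d : R, 0 < d & forall h, `|h| < d%:C%C -> cn (f (z + h) - f z) < e.
Proof.
move=> hf e0; have [d /posC[r r0 ->] hd] := entire_continuous_eps z hf (rc_gt0 e0).
by exists r => // h /hd; rewrite ltC_cn.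
Qed.

Lemma rV_norm_real w : exists2 m : R, 0 <= m & `|w| = m%:C%C.
Proof.
have : 0 <= `|w| by [].
case: (`|w|) => a b; rewrite lecE /= => /andP[/eqP -> a0]; by exists a.
Qed.

Lemma jcont_plane f z w v : entire f -> jcont (fun s t => f (z + s *: w + t *: v)).
Proof.
move=> hf s0 t0 e e0.
have [d d0 hd] := entire_continuous_cn (z + s0 *: w + t0 *: v) hf e0.
have [m m0 wm] := rV_norm_real w; have [k k0 vk] := rV_norm_real v.
exists (d / (m + k + 1)); first by rewrite divr_gt0 //; lra.
move=> s t hs ht.
have E : z + s *: w + t *: v = (z + s0 *: w + t0 *: v) + ((s - s0) *: w + (t - t0) *: v).
  by rewrite !scalerBl; apply/rowP => j; rewrite !mxE; ring.
rewrite E; apply/ltW/hd; apply: le_lt_trans (ler_normD _ _) _.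
rewrite !normrZ wm vk !cn_normE -!rcM -rcD ltcR.
have D0 : 0 < m + k + 1 by lra.
rewrite ltr_pdivlMr // in hs; rewrite ltr_pdivlMr // in ht.
have c1 := cn_ge0 (s - s0); have c2 := cn_ge0 (t - t0).
have [h|h] := leP (cn (s - s0)) (cn (t - t0)).
  by apply: le_lt_trans ht; nra.
by apply: le_lt_trans hs; nra.
Qed.

(** Multiplication by i, itself an exponential, brings any nonzero number into the right half-plane
    in at most three turns. *)
Lemma cexp_surj (w : C) : w != 0 -> exists l, cexp l = w.
Proof.
have half (v : C) : 0 < complex.Re v -> exists l, cexp l = v.
  by move=> /cexp_cln h; exists (cln v).
have [li hli] : exists l : C, cexp l = 'i%C.
  exists (Complex 0 (pi / 2)).
  by rewrite cexpE /= expR0 cos_pihalf sin_pihalf !mul1r.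
have rot (v : C) : (exists l, cexp l = v * 'i%C) -> exists l, cexp l = v.
  move=> [l hl]; exists (l - li); rewrite cexpD cexpNV hl hli mulfK //.
  by rewrite -cn_gt0 cn_i.
case: w => a b; rewrite eq_complex /= => ab.
have [a0|a0|a0] := ltgtP a 0.
- by apply rot; apply rot; apply: half; simpc; rewrite /= oppr_gt0.
- exact: half.
have [b0|b0|b0] := ltgtP b 0.
- by apply: rot; apply: half; simpc; rewrite /= oppr_gt0.
- by apply rot; apply rot; apply rot; apply: half; simpc.
by move: ab; rewrite a0 b0 eqxx.
Qed.

Lemma ent_log (F : C -> C) (l0 : C) : ent F -> (forall t, F t != 0) -> cexp l0 = F 0 ->
  exists G, [/\ forall t, cdiff G t (der F t / F t), G 0 = l0 & forall t, cexp (G t) = F t].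
Proof.
move=> hF F0 Fl.
have [P hP] := entire_primitive (entM (ent_der hF) (entV hF F0)).
pose G t := P t + (l0 - P 0).
have hG t : cdiff G t (der F t / F t).
  by apply: cdiff_eq (cdiffD (hP t) (cdiff_cst _ t)) _; rewrite addr0.
exists G; split=> //; first by rewrite /G addrCA subrr addr0.
move=> t.
have hD v : cdiff (fun v => cexp (- G v) * F v) v 0.
  have h1 := cdiff_comp (cdiffN (hG v)) (cdiff_cexp (- G v)).
  apply: cdiff_eq (cdiffM h1 (cdiff_der v hF)) _.
  by field; exact: F0.
have := cdiff_cst_eq hD t 0.
have -> : G 0 = l0 by rewrite /G addrCA subrr addr0.
rewrite -Fl cexpN => h.
by apply: (mulfI (cexp_neq0 (- G t))); rewrite cexpN.
Qed.

Lemma cn_div_sub1 (x y : C) : y != 0 -> cn (x - y) < cn y -> cn (x / y - 1) < 1.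
Proof.
move=> y0 xy; have -> : x / y - 1 = (x - y) / y by field.
by rewrite cnM cnV ltr_pdivrMr ?mul1r // cn_gt0.
Qed.

Lemma cln1 : cln 1 = 0 :> C.
Proof. by rewrite /cln cn1 ln1 /= mul0r atan0. Qed.

(** Lebesgue numbers: a radius that may be shrunk and exists near each point of [0, 1] can be chosen
    uniformly by compactness. *)
Lemma unit_interval_lebesgue (Q : R -> R -> Prop) :
  (forall s d d' : R, d' <= d -> Q s d -> Q s d') ->
  (forall t : R, 0 <= t <= 1 -> exists2 d : R, 0 < d & forall s : R, `|s - t| < d -> Q s d) ->
  exists2 d : R, 0 < d & forall s : R, 0 <= s <= 1 -> Q s d.
Proof.
move=> mono loc.
have := @segment_compact R 0 1; rewrite compact_near_coveringP => nc.
have := nc R (0^'+) (fun (d x : R) => Q x d) ltac:(typeclasses eauto).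
move=> /(_ _)/wrap[t|].
  rewrite /= in_itv /= => /loc [d d0 hd].
  exists (ball t d, [set x | x <= d]).
    split; first exact: nbhsx_ballx.
    exact: nbhs_right_le.
  move=> [s x] [/= st xd]; apply: mono xd _; apply: hd.
  by rewrite distrC.
move=> [d /= d0 hd].
exists (d / 2); first by lra.
move=> s hs; apply: (hd (d / 2)) => /=.
- by rewrite sub0r normrN gtr0_norm; lra.
- lra.
- by rewrite in_itv.
Qed.

Lemma rdiff_scalar (t : R) : rdiff (fun s : R => s%:C%C) t (1 : C).
Proof.
have := rdiff_line (0 : C) 1 t; congr (rdiff _ _ _).
by apply/funext => x; rewrite add0r mulr1.
Qed.

(** Logarithms are taken along rays from 0, all starting at [l0]. Their dependence on the ray is
    controlled by [Lnear]: for [z] near [z0] the quotient of [u] along the two rays stays in the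
    right half-plane, so its [cln] and the difference of the two logarithms have the same derivative
    along the ray. *)
Theorem entire_logarithm u : entire u -> (forall z, u z != 0) ->
  exists2 g, entire g & forall z, cexp ('i * g z) = u z.
Proof.
move=> hu u0; have [l0 hl0] := cexp_surj (u0 0).
pose U z t := u (0 + t *: z).
have hU z : ent (U z) := ent_line 0 z hu.
have U0 z t : U z t != 0 by exact: u0.
have /choice[G hG] : forall z, exists G, [/\ forall t, cdiff G t (der (U z) t / U z t),
    G 0 = l0 & forall t, cexp (G t) = U z t].
  by move=> z; apply: ent_log => //; rewrite /U scale0r addr0.
have i0 : 'i != 0 :> C by rewrite -complexiE -cn_gt0 cn_i.
pose L z := G z 1; pose g z := 'i^-1 * L z.
have Lu z : cexp (L z) = u z.
  by have [_ _ ->] := hG z; rewrite /U scale1r add0r.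
have gL z : 'i * g z = L z by rewrite /g mulrA divff // mul1r.
exists g; last by move=> z; rewrite gL.
have Lnear z0 : exists2 d : R, 0 < d & forall z, `|z - z0| < d%:C%C ->
    0 < complex.Re (u z / u z0) /\ L z - L z0 = cln (u z / u z0).
  have [z0n z0n0 z0nE] := rV_norm_real z0.
  have [||d d0 hd] := @unit_interval_lebesgue (fun (s d : R) => forall z, `|z - z0| < d%:C%C ->
      0 < complex.Re (U z s%:C%C / U z0 s%:C%C)).
  - move=> s d d' dd' h z zz; apply: h; apply: lt_le_trans zz _.
    by rewrite lecR.
  - move=> t /andP[t0 t1].
    (* Two values within [a / 4] of [U z0 t] differ by less than [a / 2] and have modulus above
       [3 a / 4], so their quotient is within 1 of 1. *)
    pose a := cn (U z0 t%:C%C); have a0 : 0 < a by rewrite cn_gt0.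
    have a2 : a / 2 = a / 4 + a / 4 by field.
    have a34 : a / 2 < a - a / 4 by lra.
    have [d d0 hd] := entire_continuous_cn (0 + t%:C%C *: z0) hu (e := a / 4) ltac:(lra).
    pose d' := Num.min 1 (d / (z0n + 3)).
    have d'0 : 0 < d' by rewrite lt_min ltr01 divr_gt0 //; lra.
    have d'1 : d' <= 1 by rewrite /d' ge_min lexx.
    have d'd : d' * (z0n + 3) <= d.
      by rewrite -ler_pdivlMr ?ge_min ?lexx ?orbT //; lra.
    have close z (s : R) : `|s - t| < d' -> `|z - z0| < d'%:C%C ->
        cn (U z s%:C%C - U z0 t%:C%C) < a / 4.
      move=> st zz0.
      have -> : U z s%:C%C = u (0 + t%:C%C *: z0 + ((s - t)%:C%C *: z0 + s%:C%C *: (z - z0))).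
        by rewrite /U; congr u; apply/rowP => j; rewrite rcB !mxE; ring.
      apply: hd; apply: le_lt_trans (ler_normD _ _) _.
      rewrite !normrZ z0nE !cn_normE !cn_real.
      have [m m0 mE] := rV_norm_real (z - z0); rewrite mE ltcR in zz0 *.
      rewrite -!rcM -rcD ltcR.
      have s2 : `|s| <= 2.
        have := ler_normD (s - t) t; rewrite subrK (ger0_norm t0); lra.
      have := normr_ge0 s; have := normr_ge0 (s - t); nra.
    exists d' => // s st z zz0.
    have h1 := close z s st zz0.
    have h2 : cn (U z0 s%:C%C - U z0 t%:C%C) < a / 4.
      by apply: close => //; rewrite subrr normr0 rc_gt0.
    have h3 : a - a / 4 < cn (U z0 s%:C%C).
      have := cn_lerB (U z0 t%:C%C) (U z0 s%:C%C); rewrite cnBC => h3.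
      by have := le_lt_trans h3 h2; rewrite ltrBlDr addrC -ltrBlDr.
    have h4 : cn (U z s%:C%C - U z0 s%:C%C) < a / 2.
      have -> : U z s%:C%C - U z0 s%:C%C =
          (U z s%:C%C - U z0 t%:C%C) - (U z0 s%:C%C - U z0 t%:C%C).
        by rewrite opprB addrA subrK.
      by apply: le_lt_trans (cnB _ _) _; rewrite a2; exact: ltrD.
    have h5 : cn (U z s%:C%C / U z0 s%:C%C - 1) < 1.
      exact: cn_div_sub1 (U0 _ _) (lt_trans h4 (lt_trans a34 h3)).
    have := le_lt_trans (cn_Re _) h5; rewrite ReD ReN /= ltr_norml => /andP[+ _].
    by rewrite ltrBrDr addNr.
  exists d => // z zz.
  have Rez (s : R) : 0 <= s <= 1 -> 0 < complex.Re (U z s%:C%C / U z0 s%:C%C).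
    by move=> /hd; apply.
  have U1 v : U v (1 : R)%:C%C = u v by rewrite /U scale1r add0r.
  split; first by have := Rez 1; rewrite !U1; apply; rewrite ler01 lexx.
  have [dG G0 _] := hG z; have [dG' G0' _] := hG z0.
  pose q t := U z t / U z0 t.
  pose D (s : R) := G z s%:C%C + (- G z0 s%:C%C + - cln (q s%:C%C)).
  have := @rdiff_cst_eq _ D 0 1 ler01; rewrite /D rmorph1 rmorph0 G0 G0'.
  have -> : q 0 = 1 by rewrite /q /U !scale0r divff.
  rewrite cln1 oppr0 addr0 subrr -/(L z) -/(L z0) => H.
  apply/eqP; rewrite -subr_eq0 -(H _).
    by rewrite /q -[1]/((1 : R)%:C%C) !U1; apply/eqP; ring.
  move=> t ht; have dsc := rdiff_scalar t.
  have dq : cdiff q t%:C%C (der (U z) t%:C%C * (U z0 t%:C%C)^-1 +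
      U z t%:C%C * (- der (U z0) t%:C%C / U z0 t%:C%C ^+ 2)).
    exact: cdiffM (cdiff_der _ (hU z)) (cdiffV (cdiff_der _ (hU z0)) (U0 z0 _)).
  have h1 := rdiff_comp dsc (dG _); have h2 := rdiff_comp dsc (dG' _).
  have h3 := rdiff_comp (rdiff_comp dsc dq) (cdiff_cln (Rez t ht)).
  apply: rdiff_eq (rdiffD h1 (rdiffD (rdiffN h2) (rdiffN h3))) _.
  rewrite /q; have := U0 z t%:C%C; have := U0 z0 t%:C%C.
  move: (U z t%:C%C) (U z0 t%:C%C) (der (U z) _) (der (U z0) _) => x y x' y' y0 x0.
  by field; rewrite x0 y0.
move=> z0.
apply: (@differentiable_local_inverse _ _ u g (fun y => cexp ('i * y)) z0 ('i * u z0)).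
- exact: hu.
- by rewrite mulf_neq0.
- move=> e e0; have [r r0 er] := posC e0.
  have hE : cdiff (fun y => cexp ('i * y)) (g z0) ('i * u z0).
    have h1 := cdiffZ 'i (cdiff_id (g z0)).
    have := cdiff_comp h1 (cdiff_cexp _); rewrite gL Lu => /cdiff_eq; apply.
    by rewrite mulr1 mulrC.
  have [d d0 hd] := hE r r0; exists d%:C%C; first exact: rc_gt0.
  move=> y; rewrite ltC_cn => /hd; rewrite er.
  by rewrite -lecR rcM -!cn_normE.
- move=> e e0; have [r r0 ->] := posC e0.
  have [d d0 hd] := Lnear z0.
  have [d1 d10 h1] := @ccont_cln R 1 ltr01 (r / 2) ltac:(lra).
  have cu0 : 0 < cn (u z0) by rewrite cn_gt0.
  have [d2 d20 h2] := entire_continuous_cn z0 hu (e := d1 * cn (u z0)) ltac:(exact: mulr_gt0).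
  apply/nbhs_ballP; exists (Num.min d d2)%:C%C; first by rewrite /= rc_gt0 // lt_min d0.
  move=> z; rewrite -ball_normE /= distrC => zz.
  have zd : `|z - z0| < d%:C%C.
    by apply: lt_le_trans zz _; rewrite lecR ge_min lexx.
  have zd2 : `|z - z0| < d2%:C%C.
    by apply: lt_le_trans zz _; rewrite lecR ge_min lexx orbT.
  have [_ LE] := hd z zd.
  rewrite ltC_cn /g -mulrBr cnM cnV -complexiE cn_i invr1 mul1r LE.
  rewrite -[cln _]subr0 -cln1; apply: le_lt_trans (h1 _ _) _; last lra.
  have -> : u z / u z0 - 1 = (u z - u z0) / u z0 by field.
  rewrite cnM cnV ltr_pdivrMr //.
  by have := h2 (z - z0) zd2; have -> : z0 + (z - z0) = z by rewrite addrC subrK.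
- by move=> z; rewrite gL.
Qed.

End EntireLogarithm.

(** * Polynomials in several variables *)

Section PolynomialFunctions.
Variable K : numFieldType.

Lemma poly_eq0_of_roots (q : {poly K}) (x : nat -> K) : injective x ->
  (forall k, q.[x k] = 0) -> q = 0.
Proof.
move=> xI qx; apply/eqP/negPn/negP => q0.
have := max_poly_roots q0 (rs := [seq x i | i <- iota 0 (size q)]).
rewrite size_map size_iota ltnn => /(_ _ _)/wrap[||//].
  by apply/allP => _ /mapP[k _ ->]; rewrite rootE qx.
by rewrite map_inj_uniq ?iota_uniq.
Qed.

Lemma exists_nonroot (q : {poly K}) : q != 0 -> exists x, q.[x] != 0.
Proof.
move=> q0; apply/not_existsP => h; move/eqP: q0; apply.
apply: (@poly_eq0_of_roots q (fun k => k%:R)) => [i j /eqP|k].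
  by rewrite eqr_nat => /eqP.
by apply/eqP/negPn/negP/h.
Qed.

Lemma digits_inj (B n : nat) (f g : 'I_n -> nat) :
  (forall j, f j < B)%N -> (forall j, g j < B)%N ->
  (\sum_(j < n) f j * B ^ j = \sum_(j < n) g j * B ^ j)%N -> f =1 g.
Proof.
elim: n f g => [|n IH] f g hf hg; first by move=> _ [].
have B0 : (0 < B)%N by apply: leq_ltn_trans (hf ord0).
have E (h : 'I_n.+1 -> nat) : (\sum_(j < n.+1) h j * B ^ j =
    h ord0 + (\sum_(j < n) h (lift ord0 j) * B ^ j) * B)%N.
  rewrite big_ord_recl expn0 muln1; congr (_ + _)%N; rewrite big_distrl /=.
  by apply: eq_bigr => j _; rewrite /= /bump leq0n add1n expnSr mulnA.
rewrite !E => e.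
have e0 : f ord0 = g ord0.
  by have := congr1 (modn^~ B) e; rewrite ![(_ + _ * B)%N]addnC !modnMDl !modn_small.
move: e; rewrite e0 => /addnI/eqP; rewrite eqn_pmul2r // => /eqP e1 j.
case: (unliftP ord0 j) => [i ->|-> //].
by apply: IH e1 i => i.
Qed.

(** Kronecker substitution: putting [x ^ (B ^ j)] for the j-th variable, with [B] above all degrees,
    sends distinct monomials to distinct powers of [x], by uniqueness of base-[B] digits. *)
Lemma monomials_nonvanishing n (s : seq (multinom n)) (a : multinom n -> K) m0 :
  uniq s -> m0 \in s -> a m0 != 0 ->
  exists w : 'rV[K]_n, \sum_(m <- s) a m * \prod_j w ord0 j ^+ m j != 0.
Proof.
move=> us m0s am0; pose B := (\max_(m <- s) mdeg m).+1.
have mB m j : m \in s -> (m j < B)%N.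
  move=> ms; rewrite ltnS; apply: (@leq_trans (mdeg m)).
    by rewrite mdegE (bigD1 j) //= leq_addr.
  exact: leq_bigmax_seq.
pose code (m : multinom n) := (\sum_(j < n) m j * B ^ j)%N.
have codeI m m' : m \in s -> m' \in s -> code m = code m' -> m = m'.
  move=> ms m's e; apply/mnmP; apply: digits_inj e => j; exact: mB.
pose q : {poly K} := \sum_(m <- s) a m *: 'X^(code m).
have [x hx] : exists x, q.[x] != 0.
  apply: exists_nonroot; apply: contraNneq am0 => q0.
  have := coef0 K (code m0); rewrite -q0 coef_sum (bigD1_seq m0) //= coefZ coefXn eqxx mulr1.
  rewrite big_seq_cond big1 ?addr0 => [-> //|m /andP[ms mm]].
  rewrite coefZ coefXn; case: eqP => [/codeI e|]; last by rewrite mulr0.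
  by rewrite e ?eqxx in mm.
exists (\row_j x ^+ (B ^ j)); congr (_ != _): hx.
rewrite horner_sum; apply: eq_bigr => m _; rewrite hornerZ hornerXn; congr (_ * _).
by rewrite expr_sum; apply: eq_bigr => j _; rewrite mxE -exprM mulnC.
Qed.

Section FixedDimension.
Variable n : nat.
Local Notation Kn := 'rV[K]_n.
Implicit Types (p q : mpoly n K) (x y : Kn).

Lemma pevalE p x : peval p x = \sum_(m <- msupp p) mcoeff m p * \prod_j x ord0 j ^+ m j.
Proof. by rewrite /peval mevalE. Qed.

Lemma pevalD p q x : peval (p + q) x = peval p x + peval q x.
Proof. exact: mevalD. Qed.
Lemma pevalB p q x : peval (p - q) x = peval p x - peval q x.
Proof. exact: mevalB. Qed.
Lemma pevalN p x : peval (- p) x = - peval p x.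
Proof. exact: mevalN. Qed.
Lemma pevalM p q x : peval (p * q) x = peval p x * peval q x.
Proof. exact: mevalM. Qed.
Lemma pevalZ (a : K) p x : peval (a *: p) x = a * peval p x.
Proof. exact: mevalZ. Qed.
Lemma pevalC (a : K) x : peval (mpolyC n a) x = a.
Proof. exact: mevalC. Qed.
Lemma peval0 x : peval (0 : mpoly n K) x = 0.
Proof. exact: meval0. Qed.

Lemma peval_nonvanishing p : p != 0 -> exists x, peval p x != 0.
Proof.
move=> p0; have [|||x hx] := @monomials_nonvanishing n (msupp p) (fun m => mcoeff m p) (mlead p).
- exact: msupp_uniq.
- exact: mlead_supp.
- by rewrite mleadc_eq0.
by exists x; rewrite pevalE.
Qed.

Lemma peval_eq0 p : (forall x, peval p x = 0) -> p = 0.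
Proof.
move=> h; apply/eqP/negPn/negP => /peval_nonvanishing[x]; by rewrite h eqxx.
Qed.

Lemma peval_inj p q : (forall x, peval p x = peval q x) -> p = q.
Proof.
move=> h; apply/eqP; rewrite -subr_eq0; apply/eqP/peval_eq0 => x.
by rewrite pevalB h subrr.
Qed.

Lemma mmap_retract (S : comNzRingType) (f : {rmorphism K -> S}) (g : {rmorphism S -> K})
    (h : 'I_n -> S) p : (forall a, g (f a) = a) ->
  g (mmap f h p) = meval (fun j => g (h j)) p.
Proof.
move=> fg; rewrite /meval /mmap rmorph_sum; apply: eq_bigr => m _.
rewrite rmorphM fg; congr (_ * _); rewrite /mmap1 rmorph_prod; apply: eq_bigr => j _.
by rewrite rmorphXn.
Qed.

Definition line_poly p x y : {poly K} :=
  mmap polyC (fun j => (x ord0 j)%:P + (y ord0 j)%:P * 'X) p.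

Lemma line_polyE p x y t : (line_poly p x y).[t] = peval p (x + t *: y).
Proof.
rewrite -[LHS]/(horner_eval t (line_poly p x y)) mmap_retract.
  by apply: meval_eq => j; rewrite [LHS]horner_evalE hornerD hornerM !hornerC hornerX !mxE mulrC.
by move=> a; rewrite [LHS]horner_evalE hornerC.
Qed.

Lemma mpoly_shift x p : exists q, forall y, peval q y = peval p (y + x).
Proof.
exists (mmap (@mpolyC n K) (fun j => mpolyX K (mnm1 j) + mpolyC n (x ord0 j)) p) => y.
rewrite /peval mmap_retract => [|a]; last exact: mevalC.
by apply: meval_eq => j; rewrite /= mevalD mevalC mevalXU mxE.
Qed.

Lemma size_coef_prod (I : Type) (s : seq I) (f : I -> {poly K}) (k : I -> nat) :
  (forall i, size (f i) <= (k i).+1)%N ->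
  (size (\prod_(i <- s) f i)%R <= (\sum_(i <- s) k i).+1)%N /\
  (\prod_(i <- s) f i)`_(\sum_(i <- s) k i) = \prod_(i <- s) (f i)`_(k i).
Proof.
move=> hf; elim: s => [|i s [IH1 IH2]].
  by rewrite !big_nil size_poly1 coef1 eqxx.
rewrite !big_cons; split.
  apply: leq_trans (size_polyMleq _ _) _.
  by rewrite -subn1 leq_subLR add1n -addnS -addSn leq_add.
rewrite coefM -IH2.
have kl : (k i < (k i + \sum_(j <- s) k j).+1)%N by rewrite ltnS leq_addr.
rewrite (bigD1 (Ordinal kl)) //= addKn [X in _ + X]big1 ?addr0 // => j jk.
have [jl|jl] := ltnP j (k i).
  rewrite [X in _ * X]nth_default ?mulr0 //; apply: leq_trans IH1 _.
  by rewrite ltn_subRL ltn_add2r.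
rewrite nth_default ?mul0r //; apply: leq_trans (hf i) _.
by rewrite ltn_neqAle jl andbT; apply: contraNneq jk => e; apply/eqP/val_inj.
Qed.

(** The coefficient at the total degree is the top homogeneous part of [p] at the direction [y]; the
    base point does not enter. *)
Lemma line_poly_lead p x y :
  (size (line_poly p x y) <= msize p)%N /\
  (line_poly p x y)`_(msize p).-1 =
    \sum_(m <- msupp p | mdeg m == (msize p).-1) mcoeff m p * \prod_j y ord0 j ^+ m j.
Proof.
pose F (m : multinom n) : {poly K} := mmap1 (fun j => (x ord0 j)%:P + (y ord0 j)%:P * 'X) m.
have lin j k : (size (((x ord0 j)%:P + (y ord0 j)%:P * 'X) ^+ k : {poly K})%R <= k.+1)%N /\
    (((x ord0 j)%:P + (y ord0 j)%:P * 'X) ^+ k)`_k = y ord0 j ^+ k.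
  pose f := (x ord0 j)%:P + (y ord0 j)%:P * 'X.
  have sf : (size f <= 2)%N.
    rewrite /f addrC -['X]expr1 mul_polyC; apply: leq_trans (size_polyD _ _) _; rewrite geq_max.
    by rewrite (leq_trans (size_scale_leq _ _)) ?size_polyXn // (leq_trans (size_polyC_leq1 _)).
  have [] := @size_coef_prod _ (iota 0 k) (fun=> f) (fun=> 1%N) (fun=> sf).
  rewrite !big_const_seq count_predT size_iota !iter_mulr_1 iter_addn_0 mul1n => -> ->.
  by rewrite /f coefD coefC coefCM coefX mulr1 add0r.
have FE m : (size (F m) <= (mdeg m).+1)%N /\ (F m)`_(mdeg m) = \prod_j y ord0 j ^+ m j.
  have [] := @size_coef_prod _ (index_enum 'I_n)
    (fun j => ((x ord0 j)%:P + (y ord0 j)%:P * 'X) ^+ m j) m (fun j => (lin j (m j)).1).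
  rewrite -mdegE => h1 ->; split=> //; apply: eq_bigr => j _; exact: (lin j (m j)).2.
have E : line_poly p x y = \sum_(m <- msupp p) mcoeff m p *: F m.
  by rewrite /line_poly /mmap; apply: eq_bigr => m _; rewrite mul_polyC.
split.
  rewrite E big_seq; apply: leq_trans (size_sum _ _ _) _; apply/bigmax_leqP_seq => m ms _.
  rewrite (leq_trans (size_scale_leq _ _)) // (leq_trans (FE m).1) //.
  exact: msize_mdeg_lt.
rewrite E coef_sum [RHS]big_mkcond /= !big_seq; apply: eq_bigr => m ms; rewrite coefZ.
case: eqP => [<-|/eqP e]; first by rewrite (FE m).2.
rewrite nth_default ?mulr0 //; apply: leq_trans (FE m).1 _.
have := msize_mdeg_lt ms; case: (msize p) e => //= k e; rewrite ltnS => h.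
by rewrite ltn_neqAle e.
Qed.

(** The top homogeneous part contains the leading monomial, so it is nonzero at some [y]; no line of
    that direction loses degree. *)
Lemma noncharacteristic_direction p : p != 0 -> exists y (l : K), l != 0 /\
  forall x, (line_poly p x y)`_(msize p).-1 = l /\ size (line_poly p x y) = msize p.
Proof.
move=> p0; have d0 := mlead_deg p0.
have [|||y hy] := @monomials_nonvanishing n [seq m <- msupp p | mdeg m == (msize p).-1]
    (fun m => mcoeff m p) (mlead p).
- by rewrite filter_uniq // msupp_uniq.
- by rewrite mem_filter mlead_supp // -d0 eqxx.
- by rewrite mleadc_eq0.
rewrite big_filter in hy; exists y; eexists; split; first exact: hy.
move=> x; have [h1 h2] := line_poly_lead p x y; split=> //.
apply/eqP; rewrite eqn_leq h1 /=.
case: (leqP (msize p) (size (line_poly p x y))) => // h.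
by move: hy; rewrite -h2 nth_default ?eqxx //; move: h; rewrite -d0 ltnS.
Qed.

End FixedDimension.

Definition lagrange_basis (D : nat) (k : 'I_D) : {poly K} :=
  \prod_(i < D | i != k) ((k%:R - i%:R)^-1 *: ('X - i%:R%:P)).

Lemma lagrange_interpolation (D : nat) (q : {poly K}) : (size q <= D)%N ->
  q = \sum_(k < D) q.[k%:R] *: lagrange_basis k.
Proof.
move=> sq; apply/eqP; rewrite -subr_eq0; apply/negPn/negP => d0.
set d := q - _ in d0.
have bE (k i : 'I_D) : (lagrange_basis k).[i%:R] = (i == k)%:R.
  rewrite horner_prod; have [->|ik] := eqVneq i k.
    by rewrite big1 // => j jk; rewrite !hornerE mulVf // subr_eq0 eqr_nat eq_sym.
  by rewrite (bigD1 i) //= !hornerE subrr mulr0 mul0r.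
have := max_poly_roots d0 (rs := [seq (i : 'I_D)%:R | i <- enum 'I_D]).
rewrite size_map size_enum_ord => /(_ _ _)/wrap[||].
- apply/allP => _ /mapP[i _ ->]; rewrite rootE /d hornerD hornerN horner_sum.
  rewrite (bigD1 i) //= hornerZ bE eqxx mulr1 big1 ?addr0 ?subrr // => j ji.
  by rewrite hornerZ bE eq_sym (negPf ji) mulr0.
- rewrite map_inj_uniq ?enum_uniq // => i j /eqP; rewrite eqr_nat => /eqP; exact: val_inj.
rewrite ltnNge => /negP; apply; apply: leq_trans (size_polyD _ _) _.
rewrite geq_max sq size_polyN; apply: leq_trans (size_sum _ _ _) _.
apply/bigmax_leqP => k _; apply: leq_trans (size_scale_leq _ _) _.
have [|] := @size_coef_prod _ [seq i <- index_enum 'I_D | i != k]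
  (fun i : 'I_D => (k%:R - i%:R)^-1 *: ('X - i%:R%:P)) (fun=> 1%N).
  by move=> i; apply: leq_trans (size_scale_leq _ _) _; rewrite size_XsubC.
rewrite !big_filter => h _; apply: leq_trans h _.
by rewrite sum1_card cardC1 card_ord; case: D {d d0 sq bE} k => [[]|].
Qed.

Section Interpolation.
Variable n : nat.
Local Notation Kn := 'rV[K]_n.
Local Notation e_ j := (delta_mx ord0 j : Kn).

(** Induction on the variables on which [Q] depends: interpolation in one variable at 0, ..., D - 1
    leaves coefficients [Qk] that depend on the others only. The uniform bound [D] fixes the number
    of nodes. *)
Lemma separately_polynomial (Q : Kn -> K) (D : nat) :
  (forall z j, exists2 q : {poly K}, (size q <= D)%N & forall t, Q (z + t *: e_ j) = q.[t]) ->
  exists p, forall z, Q z = peval p z.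
Proof.
suff H (js : seq 'I_n) : uniq js -> forall Q : Kn -> K,
    (forall z j, j \in js -> exists2 q : {poly K}, (size q <= D)%N &
      forall t, Q (z + t *: e_ j) = q.[t]) ->
    (forall z z' : Kn, {in js, forall j, z ord0 j = z' ord0 j} -> Q z = Q z') ->
    exists p, forall z, Q z = peval p z.
  move=> hQ; apply: (H (enum 'I_n)); first exact: enum_uniq.
    by move=> z j _; exact: hQ.
  by move=> z z' h; congr Q; apply/rowP => j; apply: h; rewrite mem_enum.
elim: js => [_|j js IH /= /andP[jjs us]] {}Q hQ dQ.
  by exists (mpolyC n (Q 0)) => z; rewrite pevalC; apply: dQ.
pose Qk k (z : Kn) := Q (z - z ord0 j *: e_ j + k%:R *: e_ j).
have /choice[m hm] (k : 'I_D) : exists p, forall z : Kn, Qk k z = peval p z.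
  apply: IH => //.
    move=> z i ijs; have [|q sq hq] := hQ (z - z ord0 j *: e_ j + (k : nat)%:R *: e_ j) i.
      by rewrite inE ijs orbT.
    exists q => // t; rewrite -hq /Qk; congr Q; apply/rowP => l; rewrite !mxE eqxx /=.
    have /negPf -> : j != i by apply: contraNneq jjs => ->.
    by rewrite mulr0 addr0 -!addrA; congr (_ + _); rewrite addrC -!addrA.
  move=> z z' h; apply: dQ => l; rewrite inE !mxE eqxx /= => ljs.
  have [lj|lj] := eqVneq l j; first by rewrite lj !mulr1 !subrr.
  by rewrite (negPf lj) /= in ljs *; rewrite !mulr0 h.
exists (\sum_k m k * \sum_(i < size (lagrange_basis k)) (lagrange_basis k)`_i *: mpolyX K (mnm1 j) ^+ i).
move=> z.
have [|q sq hq] := hQ (z - z ord0 j *: e_ j) j; first by rewrite inE eqxx.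
have -> : Q z = q.[z ord0 j] by rewrite -hq subrK.
rewrite (lagrange_interpolation sq) horner_sum /peval rmorph_sum; apply: eq_bigr => k _.
rewrite /= mevalM -[meval _ (m k)]/(peval (m k) z) -hm /Qk hq hornerZ; congr (_ * _).
rewrite horner_coef rmorph_sum; apply: eq_bigr => i _ /=.
by rewrite mevalZ rmorphXn /= mevalXU.
Qed.

End Interpolation.

(** Interpolation writes the coefficient as a fixed combination of values of [p], so it is
    polynomial in the base point without expanding [p]. *)
Lemma coef_line_poly n (p : mpoly n K) (i : nat) : exists a : 'I_(msize p) -> K,
  forall x y, (line_poly p x y)`_i = \sum_k a k * peval p (x + (k : nat)%:R *: y).
Proof.
exists (fun k => (lagrange_basis k)`_i) => x y.
rewrite {1}(lagrange_interpolation (line_poly_lead p x y).1) coef_sum.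
by apply: eq_bigr => k _; rewrite coefZ line_polyE mulrC.
Qed.

End PolynomialFunctions.

(** * Zeros along lines of a factor of a polynomial *)

Section ParametrizedTaylorCoefficients.
Variable R : realType.
Local Notation C := R[i].

Lemma tc_param_bound (U : C -> C -> C) (S rho : R) : jcont U -> (forall s, ent (U s)) ->
  0 < rho -> exists2 M : R, 0 <= M & forall s : C, cn s <= S ->
    (forall l, cn (tc (U s) l) <= M / rho ^+ l) /\
    (forall t N, cn t < rho -> cn (U s t - ps (tc (U s)) t N)
       <= M * (cn t / rho) ^+ N / (1 - cn t / rho)).
Proof.
move=> jU hU rho0.
have [M hM] := bidisc_bounded (Num.max S rho) jU.
exists (Num.max M 0); first by rewrite le_max lexx orbT.
move=> s sS; apply: (tcP (hU s) rho0) => t tr.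
rewrite le_max; apply/orP; left; apply: hM; first by rewrite le_max sS.
by rewrite tr le_max lexx orbT.
Qed.

(** The coefficient is a locally uniform limit of Fourier averages over the unit circle, each of
    which is a finite sum of functions entire in [s]. Bounds at radius 2 give the ratio 1/2. *)
Lemma ent_tc_param (U : C -> C -> C) l : jcont U -> (forall s, ent (U s)) ->
  (forall t, ent (U^~ t)) -> ent (fun s => tc (U s) l).
Proof.
move=> jU hU hU'.
(* More than [l] points, so that [l] is a Fourier index, and more than [n], so that the truncation
   error tends to 0. *)
pose N' n := (n + l).+1.
have /choice[y hy] n : exists y : C, (N' n).-primitive_root y by exact: prim_root_exists.
pose f n s := (N' n)%:R^-1 * \sum_(k < N' n) U s (y n ^+ k) * (y n ^+ k) ^+ (N' n - l).
apply: (@ent_lim R f).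
  move=> n; apply: entM; first exact: ent_cst.
  by apply: ent_sum => k _; apply: entM; [exact: hU'|exact: ent_cst].
move=> S e e0; have [M M0 hM] := tc_param_bound S jU hU (rho := 2) ltac:(lra).
have [N hN] := @expr_small R 2^-1 (2 * M) e ltac:(lra) e0.
exists N => n Nn s sS; have [_ hps] := hM s sS.
have nN0 : (N' n)%:R != 0 :> C by rewrite pnatr_eq0.
have E : tc (U s) l = (N' n)%:R^-1 * \sum_(k < N' n)
    ps (tc (U s)) (y n ^+ k) (N' n) * (y n ^+ k) ^+ (N' n - l).
  have := @dft R (N' n) (y n) 1 (tc (U s)) l (N' n - l) (hy n).
  rewrite /N' ltnS leq_addl subnKC ?leqW ?leq_addl // expr1n mulr1 => /(_ isT (dvdnn _)) h.
  rewrite (eq_bigr (fun k : 'I_(n + l).+1 => ps (tc (U s)) (y n ^+ k * 1) (n + l).+1 *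
    (y n ^+ k) ^+ ((n + l).+1 - l))); last by move=> k _; rewrite mulr1.
  by rewrite h mulKf.
rewrite E /f -mulrBr -sumrB cnM cnV cn_nat.
apply: le_trans (_ : (N' n)%:R^-1 * \sum_(k < N' n) (2 * M * 2^-1 ^+ n) <= _).
  rewrite ler_wpM2l ?invr_ge0 //; apply: le_trans (cn_sum _ _ _) _.
  apply: ler_sum => k _; rewrite -mulrBl cnM 2!cnX (prim_root_cn (hy n)) !expr1n mulr1.
  apply: le_trans (hps _ (N' n) _) _; rewrite cnX (prim_root_cn (hy n)) expr1n; first lra.
  have h1 : 0 <= (2^-1 : R) ^+ n by rewrite exprn_ge0.
  have h2 : (2^-1 : R) ^+ (N' n) <= 2^-1 ^+ n.
    by rewrite ler_wiXn2l ?invr_ge0 ?invf_le1 ?ler1n // /N' leqW // leq_addr.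
  have -> : (1 - 1 / 2 : R)^-1 = 2 by field.
  rewrite mul1r; nra.
rewrite sumr_const card_ord -[X in _ * X]mulr_natr mulrCA mulVf ?pnatr_eq0 // mulr1.
exact: hN.
Qed.

End ParametrizedTaylorCoefficients.

(** * Power sums of roots through linear recurrences *)

Section PowerSums.
Variable R : realType.
Local Notation C := R[i].
Implicit Types P : {poly C}.

(** The linear functional on polynomials that sends ['X^i] to [h i]. *)
Definition pairing (h : nat -> C) (f : {poly C}) : C := \sum_(i < size f) f`_i * h i.

Lemma pairingE N h (f : {poly C}) : (size f <= N)%N -> pairing h f = \sum_(i < N) f`_i * h i.
Proof.
move=> fN; rewrite /pairing (big_ord_widen N (fun i => f`_i * h i)) // big_mkcond /=.
apply: eq_bigr => i _; case: ltnP => // fi.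
by rewrite nth_default ?mul0r.
Qed.

Lemma pairingD h (f g : {poly C}) : pairing h (f + g) = pairing h f + pairing h g.
Proof.
pose N := maxn (size f) (size g).
rewrite !(@pairingE N) ?size_polyD ?leq_maxl ?leq_maxr // -big_split /=.
by apply: eq_bigr => i _; rewrite coefD mulrDl.
Qed.

Lemma pairingZ h a (f : {poly C}) : pairing h (a *: f) = a * pairing h f.
Proof.
rewrite (@pairingE (size f)) ?size_scale_leq // mulr_sumr.
by apply: eq_bigr => i _; rewrite coefZ mulrA.
Qed.

Lemma pairingX h (f : {poly C}) : pairing h ('X * f) = pairing (fun i => h i.+1) f.
Proof.
rewrite (@pairingE (size f).+1); last by rewrite (leq_trans (size_polyMleq _ _)) // size_polyX.
rewrite big_ord_recl coefXM eqxx mul0r add0r; apply: eq_bigr => i _.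
by rewrite coefXM.
Qed.

Lemma pairing_cst h a : pairing h a%:P = a * h 0%N.
Proof. by rewrite (@pairingE 1) ?size_polyC_leq1 // big_ord1 coefC eqxx. Qed.

(** A sliding window: the entry [i] at time [l] is the term of index [l + i] of the sequence, for
    [i] below [(size P).-1]. Each step shifts the window and fills its last place by the
    recurrence. *)
Fixpoint rec_state (P : {poly C}) (l i : nat) : C :=
  if l is l'.+1 then
    if i == (size P).-2 then - \sum_(j < (size P).-1) P`_j * rec_state P l' j
    else rec_state P l' i.+1
  else (i == (size P).-2)%:R.

(* The linear recurrent sequence with characteristic polynomial P and initial
   values 0, ..., 0, 1; [pairing (rec_seq P) f] is the coefficient of index
   (size P).-2 of the remainder of f by P. *)
Definition rec_seq P l := rec_state P l 0.

Lemma rec_stateE P l i : (i < (size P).-1)%N -> rec_state P l i = rec_seq P (l + i).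
Proof.
elim: i l => [|i IH] l hi; first by rewrite addn0.
rewrite addnS -addSn -IH; last exact: ltnW.
rewrite /=; case: eqP hi => // -> ; by case: (size P) => [|[|m]] //=; rewrite ltnn.
Qed.

Lemma rec_seq_init P i : (i < (size P).-1)%N -> rec_seq P i = (i == (size P).-2)%:R.
Proof. by move=> h; rewrite -(add0n i) -rec_stateE. Qed.

Lemma rec_seq_recurrence P l : P \is monic -> (1 < size P)%N ->
  pairing (fun i => rec_seq P (l + i)) P = 0.
Proof.
move=> /monicP Pm sP; have [d dE] : exists d, size P = d.+2.
  by case: (size P) sP => [|[|d]] //; exists d.
rewrite /pairing dE big_ord_recr /=.
have -> : P`_d.+1 = 1 by rewrite -Pm /lead_coef dE.
rewrite mul1r addnS -addSn -rec_stateE ?dE //= dE /= eqxx.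
rewrite (eq_bigr (fun j : 'I_d.+1 => P`_j * rec_state P l j)) ?subrr // => j _.
by rewrite rec_stateE // dE.
Qed.

(** Bounds at the same time the roots of a monic [P] and the ratio of growth of [rec_seq P]. *)
Definition coef_bound P : R := 1 + \sum_(j < (size P).-1) cn P`_j.

Lemma coef_bound_ge1 P : 1 <= coef_bound P.
Proof. by rewrite lerDl sumr_ge0 // => j _; exact: cn_ge0. Qed.

Lemma rec_seq_bound P l : cn (rec_seq P l) <= coef_bound P ^+ l.
Proof.
have B1 := coef_bound_ge1 P; rewrite /rec_seq; move: 0%N; elim: l => [|l IH] i /=.
  by case: eqP => _; rewrite ?cn1 ?cn0 expr0.
have Bl : 0 <= coef_bound P ^+ l by rewrite exprn_ge0 // (le_trans ler01).
rewrite exprS; case: eqP => _; last by apply: le_trans (IH _) _; rewrite ler_peMl.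
rewrite cnN; apply: le_trans (cn_sum _ _ _) _.
rewrite /coef_bound mulrDl mul1r -[leLHS]add0r lerD // mulr_suml.
apply: ler_sum => j _; rewrite cnM; apply: ler_wpM2l (IH _); exact: cn_ge0.
Qed.

(** An algebraic form of the sum of residues of [t ^ k q' / q]. By the product rule a root [a]
    contributes the functional at [P / ('X - a)]; the recurrence multiplies it by [a] when [k]
    increases, and its value at [k = 0] is 1, the leading coefficient. *)
Lemma pairing_power_sum (P : {poly C}) (rs : seq C) (r : {poly C}) k : P \is monic ->
  (1 < size P)%N -> P = \prod_(a <- rs) ('X - a%:P) * r ->
  pairing (fun i => rec_seq P (k + i)) ((\prod_(a <- rs) ('X - a%:P))^`() * r) =
  \sum_(a <- rs) a ^+ k.
Proof.
move=> Pm sP; elim: rs r => [|a rs IH] r.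
  by rewrite !big_nil derivC mul0r /pairing size_poly0 big_ord0.
rewrite !big_cons => PE; set q := \prod_(j <- rs) _ in PE *.
rewrite derivM derivXsubC mul1r mulrDl pairingD -mulrA [in X in _ + X]mulrCA IH; last first.
  by rewrite PE -/q mulrA [q * _]mulrC.
congr (_ + _).
have step m : pairing (fun i => rec_seq P (m.+1 + i)) (q * r) =
    a * pairing (fun i => rec_seq P (m + i)) (q * r).
  have := rec_seq_recurrence m Pm sP; rewrite {2}PE -mulrA mulrBl pairingD pairingX.
  rewrite -mulNr -polyCN mul_polyC pairingZ mulNr => /eqP; rewrite subr_eq0 => /eqP <-.
  by congr pairing; apply/funext => i; rewrite addnS.
have Mm : q * r \is monic.
  by move: Pm; rewrite PE -mulrA (monicMl _ (monicXsubC a)).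
have sM : (size P).-1 = size (q * r).
  by rewrite PE -mulrA (size_monicM (monicXsubC a) (monic_neq0 Mm)) size_XsubC.
elim: k {IH} => [|k IHk]; last by rewrite step IHk exprS.
rewrite expr0 /pairing -sM; case: (size P) sP sM (@rec_seq_init P) => [|[|d]] //= _ sM ini.
rewrite big_ord_recr /= big1 => [|i _].
  by rewrite add0r add0n ini // eqxx mulr1 -(monicP Mm) /lead_coef -sM.
by rewrite add0n (ini i (leqW (ltn_ord i))) (ltn_eqF (ltn_ord i)) mulr0.
Qed.

(** Stated for the reversed product, whose constant term is 1 and in which the number of roots does
    not appear. Induction adds one root [b]; its own powers contribute the telescoping sum
    [tele]. *)
Lemma newton_identity (rs : seq C) k :
  k%:R * (\prod_(a <- rs) (1 - a *: 'X))`_k =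
  - \sum_(i < k) (\sum_(a <- rs) a ^+ i.+1) * (\prod_(a <- rs) (1 - a *: 'X))`_(k - i.+1).
Proof.
elim: rs k => [|b rs IH] k.
  rewrite big_nil coef1 big1 ?oppr0 => [|i _]; last by rewrite big_nil mul0r.
  by case: k => [|k]; rewrite ?mul0r ?mulr0.
rewrite big_cons; set f := \prod_(a <- rs) _ in IH *.
pose p i := \sum_(a <- rs) a ^+ i.
have cE m : ((1 - b *: 'X) * f)`_m = f`_m - b * (if m is m'.+1 then f`_m' else 0).
  by rewrite mulrBl mul1r coefB -scalerAl coefZ coefXM; case: m.
case: k => [|k]; first by rewrite mul0r big_ord0 oppr0.
rewrite cE mulrBr IH.
have tele : \sum_(i < k.+1) b ^+ i.+1 * ((1 - b *: 'X) * f)`_(k - i) = b * f`_k.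
  elim: k {IH} => [|k IHk]; first by rewrite big_ord1 expr1 cE mulr0 subr0.
  rewrite big_ord_recl /= expr1 subn0 cE.
  rewrite (eq_bigr (fun i : 'I_k.+1 => b * (b ^+ i.+1 * ((1 - b *: 'X) * f)`_(k - i)))).
    by rewrite -mulr_sumr IHk; ring.
  by move=> i _; rewrite /bump leq0n add1n subSS exprS mulrA.
have -> : \sum_(i < k.+1) (\sum_(a <- b :: rs) a ^+ i.+1) * ((1 - b *: 'X) * f)`_(k.+1 - i.+1)
   = b * f`_k + (\sum_(i < k.+1) p i.+1 * f`_(k - i)
       - b * \sum_(i < k) p i.+1 * f`_(k - i.+1)).
  rewrite -tele mulr_sumr -[\sum_(i < k) _](_ : \sum_(i < k.+1) b * (p i.+1 *
    (if (k - i)%N is m.+1 then f`_m else 0)) = _); last first.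
    rewrite big_ord_recr /= subnn !mulr0 addr0; apply: eq_bigr => i _.
    by rewrite -[(k - i)%N]prednK ?subn_gt0 // -subnS.
  rewrite -sumrB -big_split /=; apply: eq_bigr => i _.
  rewrite big_cons subSS -/(p _) cE; case: (k - i)%N => [|m]; ring.
have := IH k; rewrite -/(p _) => IHk; rewrite -(opprK (\sum_(i < k) p i.+1 * _)) -IHk.
under [X in - X - _]eq_bigr do rewrite subSS -/(p _).
by rewrite -[k.+1%:R]natr1; ring.
Qed.

End PowerSums.

(** * The functional extended to entire functions *)

Section RootProducts.
Variable R : realType.
Local Notation C := R[i].
Implicit Types (P q : {poly C}) (h a : nat -> C) (F G g : C -> C).

Lemma psum_lim a w v : ulim (ps a w) v -> psum a w = v.
Proof. by move=> hv; rewrite /psum; case: xgetP => [u -> hu|/(_ v)//]; exact: ulim_unique hu hv. Qed.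

Definition geometric h := exists B M : R, [/\ 0 < B, 0 <= M & forall n, cn (h n) <= M * B ^+ n].

Lemma geometric_shift h k : geometric h -> geometric (fun n => h (n + k)%N).
Proof.
move=> [B [M [B0 M0 hB]]]; exists B, (M * B ^+ k); split=> //.
  by rewrite mulr_ge0 // exprn_ge0 // ltW.
by move=> n; rewrite -mulrA -exprD addnC; apply: le_trans (hB _) _; rewrite addnC.
Qed.

Lemma rapid_geometric h a : rapid a -> geometric h -> rapid (fun n => a n * h n).
Proof.
move=> ra [B [M [B0 M0 hB]]] r r0; have [N N0 hN] := ra (r * B) (mulr_gt0 r0 B0).
exists (N * M); first exact: mulr_ge0.
move=> n; rewrite cnM; have h1 := cn_ge0 (a n); have h2 := cn_ge0 (h n).
apply: le_trans (ler_pM h1 h2 (hN n) (hB n)) _.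
have x0 : r ^+ n != 0 by rewrite gt_eqF // exprn_gt0.
have y0 : B ^+ n != 0 by rewrite gt_eqF // exprn_gt0.
rewrite exprMn; move: x0 y0; set x := r ^+ n; set y := B ^+ n => x0 y0.
suff -> : N / (x * y) * (M * y) = N * M / x by [].
by field; rewrite x0 y0.
Qed.

(** Extends [pairing h] to entire functions by applying it to the Taylor series; a geometrically
    growing [h] is outweighed by the decay of the coefficients. *)
Definition moment h F := psum (fun l => tc F l * h l) 1.

Lemma momentP h F : geometric h -> ent F ->
  ulim (ps (fun l => tc F l * h l) 1) (moment h F).
Proof. by move=> gh hF; apply: psumP; apply: rapid_geometric gh; exact: tc_rapid. Qed.

Lemma momentD h F G : geometric h -> ent F -> ent G ->
  moment h (fun t => F t + G t) = moment h F + moment h G.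
Proof.
move=> gh hF hG; apply: psum_lim.
have := ulimD (momentP gh hF) (momentP gh hG); congr ulim; apply/funext => n.
by rewrite /ps -big_split; apply: eq_bigr => i _; rewrite tcD // /= !mulrDl.
Qed.

Lemma momentZ h b F : geometric h -> ent F -> moment h (fun t => b * F t) = b * moment h F.
Proof.
move=> gh hF; apply: psum_lim.
have := ulimZ b (momentP gh hF); congr ulim; apply/funext => n.
by rewrite /ps mulr_sumr; apply: eq_bigr => i _; rewrite tcZ // !mulrA.
Qed.

Lemma tc_cst (b : C) l : tc (fun=> b) l.+1 = 0.
Proof.
elim: l b => [|l IH] b; rewrite tcS ?der_cst; try exact: ent_cst.
  by rewrite tc_0 ?mul0r //; exact: ent_cst.
by rewrite IH mul0r.
Qed.

Lemma moment1 h : moment h (fun=> 1) = h 0%N.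
Proof.
apply: psum_lim => e e0; exists 1%N => -[//|n] _.
rewrite /ps big_ord_recl tc_0; last exact: ent_cst.
rewrite expr0 mulr1 mul1r big1 ?addr0 ?subrr ?cn0 ?ltW // => i _.
by rewrite tc_cst !mul0r.
Qed.

Lemma tc_mulX F l : ent F -> tc (fun t => t * F t) l.+1 = tc F l.
Proof.
move=> hF; rewrite (tcM _ (@ent_id R) hF) big_ord_recl (tc_0 (@ent_id R)) mul0r add0r.
rewrite big_ord_recl big1 ?addr0 => [|i _].
  rewrite /= /bump /= addn0 subSS subn0 tcS ?der_id; last exact: ent_id.
  by rewrite tc_0 ?invr1 ?mulr1 ?mul1r //; exact: ent_cst.
by rewrite /= /bump /= !add1n tcS ?der_id ?tc_cst ?mul0r //; exact: ent_id.
Qed.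

Lemma ent_mulX F : ent F -> ent (fun t => t * F t).
Proof. by move=> hF; apply: entM => //; exact: ent_id. Qed.

Lemma momentX h F : geometric h -> ent F ->
  moment h (fun t => t * F t) = moment (fun l => h l.+1) F.
Proof.
move=> gh hF; have hXF := ent_mulX hF.
have r1 : rapid (fun l => tc (fun t => t * F t) l * h l).
  by apply: rapid_geometric gh; exact: tc_rapid.
rewrite /moment (psum_shift 1 1 r1) /ps big_ord1 tc_0 // !mul0r add0r expr1 mul1r.
by congr psum; apply/funext => l; rewrite addn1 tc_mulX.
Qed.

Lemma pairing_MXaddC h q b : pairing h (q * 'X + b%:P) = pairing (fun i => h i.+1) q + b * h 0%N.
Proof. by rewrite pairingD mulrC pairingX pairing_cst. Qed.

Lemma moment_poly h q F : geometric h -> ent F ->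
  moment h (fun t => q.[t] * F t) = pairing (fun i => moment (fun l => h (l + i)%N) F) q.
Proof.
elim/poly_ind: q h F => [|q b IH] h F gh hF.
  rewrite /pairing size_poly0 big_ord0 -[RHS](mul0r (moment h F)) -momentZ //.
  by congr moment; apply/funext => t; rewrite horner0.
have hq : ent (fun t => q.[t] * (t * F t)) by apply: entM; [exact: ent_horner|exact: ent_mulX].
rewrite pairing_MXaddC.
have -> : (fun t => (q * 'X + b%:P).[t] * F t) = (fun t => q.[t] * (t * F t) + b * F t).
  by apply/funext => t; rewrite hornerMXaddC mulrDl mulrA.
rewrite momentD //; last by apply: entM => //; exact: ent_cst.
rewrite momentZ // IH //; last exact: ent_mulX.
congr (_ + _); last by under [in RHS]eq_fun do rewrite addn0.
congr pairing; apply/funext => i; rewrite momentX //; last exact: geometric_shift.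
by congr moment; apply/funext => l; rewrite addnS.
Qed.

Lemma moment_horner h q : geometric h -> moment h (fun t => q.[t]) = pairing h q.
Proof.
move=> gh; have -> : (fun t => q.[t]) = (fun t => q.[t] * 1) by apply/funext => t; rewrite mulr1.
rewrite moment_poly //; last exact: ent_cst.
by congr pairing; apply/funext => i; rewrite moment1.
Qed.

(** For each Taylor term of [F] this is the recurrence; the finite sum over the coefficients of [P]
    may be exchanged with the limit. *)
Lemma moment_annihilator h P F : geometric h -> ent F ->
  (forall l, pairing (fun i => h (l + i)%N) P = 0) -> moment h (fun t => P.[t] * F t) = 0.
Proof.
move=> gh hF hP; rewrite moment_poly //; apply: ulim_unique (ulim_cst 0).
have := @ulim_sum R _ (index_enum 'I_(size P)) xpredT
  (fun i n => P`_i * ps (fun l => tc F l * h (l + i)%N) 1 n) _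
  (fun i _ => ulimZ P`_i (momentP (geometric_shift i gh) hF)).
congr ulim; apply/funext => n; under eq_bigr do rewrite /ps mulr_sumr.
rewrite exchange_big big1 // => l _; transitivity (tc F l * pairing (fun i => h (l + i)%N) P); last by rewrite hP mulr0.
rewrite mulr_sumr.
by apply: eq_bigr => i _; rewrite expr1n mulr1 mulrCA.
Qed.

Lemma der_horner q : der (fun t => q.[t]) = fun t => q^`().[t].
Proof.
elim/poly_ind: q => [|q b IH].
  under eq_fun do rewrite horner0; rewrite der_cst; apply/funext => t.
  by rewrite deriv0 horner0.
under eq_fun do rewrite hornerMXaddC.
have h1 : ent (fun t => q.[t] * t) by apply: entM; [exact: ent_horner|exact: ent_id].
rewrite (derD h1 (ent_cst b)) (derM (ent_horner q) (@ent_id R)) IH der_cst der_id.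
by apply/funext => t; rewrite derivMXaddC hornerD hornerMX !hornerE; ring.
Qed.

Lemma rec_seq_geometric P : geometric (rec_seq P).
Proof.
exists (coef_bound P), 1; split=> //; first exact: lt_le_trans ltr01 (coef_bound_ge1 P).
by move=> n; rewrite mul1r; exact: rec_seq_bound.
Qed.

(* q' r + P e'/e = U' V, and the moments of a multiple of P vanish. *)
Lemma moment_power_sum P (rs : seq C) (r : {poly C}) (U V e : C -> C) k :
  P \is monic -> (1 < size P)%N -> ent V -> ent e -> (forall t, e t != 0) ->
  (forall t, U t = (\prod_(a <- rs) ('X - a%:P)).[t] * e t) ->
  (forall t, V t * e t = r.[t]) -> P = \prod_(a <- rs) ('X - a%:P) * r ->
  moment (fun l => rec_seq P (l + k)) (fun t => der U t * V t) = \sum_(a <- rs) a ^+ k.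
Proof.
move=> Pm sP hV he e0 UE VE PE; set q := \prod_(a <- rs) _ in UE PE.
have gh : geometric (fun l => rec_seq P (l + k)).
  by apply: geometric_shift; exact: rec_seq_geometric.
have hg : ent (fun t => der e t / e t) by apply: entM; [exact: ent_der|exact: entV].
have -> : (fun t => der U t * V t) =
    (fun t => (q^`() * r).[t] + P.[t] * (der e t / e t)).
  have -> : U = (fun t => q.[t] * e t) by apply/funext.
  rewrite derM ?der_horner //; last exact: ent_horner.
  apply/funext => t; rewrite PE !hornerM -VE; field; exact: e0.
have rec l : pairing (fun i => rec_seq P (l + i + k)) P = 0.
  rewrite -[RHS](rec_seq_recurrence (l + k) Pm sP).
  by congr pairing; apply/funext => i; rewrite addnAC.
rewrite momentD //; [|exact: ent_horner|by apply: entM => //; exact: ent_horner].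
rewrite (moment_annihilator gh hg rec) addr0 moment_horner //.
rewrite -(pairing_power_sum k Pm sP PE).
by congr pairing; apply/funext => i; rewrite addnC.
Qed.

Lemma root_bound P (a : C) : P \is monic -> (1 < size P)%N -> root P a ->
  cn a <= coef_bound P.
Proof.
move=> Pm sP /rootP Pa; rewrite leNgt; apply/negP => aB.
have [d dE] : exists d, size P = d.+2 by case: (size P) sP => [|[|d]] //; exists d.
have B1 := coef_bound_ge1 P; have a1 : 1 < cn a := le_lt_trans B1 aB.
move: Pa; rewrite horner_coef dE big_ord_recr /=.
have -> : P`_d.+1 = 1 by rewrite -(monicP Pm) /lead_coef dE.
rewrite mul1r => /eqP; rewrite addrC addr_eq0 => /eqP/(congr1 (@cn R)); rewrite cnN cnX => E.
have : cn a ^+ d.+1 <= (coef_bound P - 1) * cn a ^+ d.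
  rewrite E; apply: le_trans (cn_sum _ _ _) _; rewrite /coef_bound dE addrAC subrr add0r.
  rewrite mulr_suml; apply: ler_sum => i _; rewrite cnM cnX; apply: ler_wpM2l; first exact: cn_ge0.
  by apply: ler_weXn2l; [exact: ltW|rewrite -ltnS].
rewrite exprS ler_pM2r ?exprn_gt0 //; first by lra.
by lra.
Qed.

Lemma size_prod_le P (rs : seq C) r : P != 0 -> P = \prod_(a <- rs) ('X - a%:P) * r ->
  (size rs <= (size P).-1)%N.
Proof.
move=> P0 PE; have q0 : \prod_(a <- rs) ('X - a%:P) != 0 :> {poly C}.
  by apply: contraNneq P0 => q0; rewrite PE q0 mul0r.
have r0 : r != 0 by apply: contraNneq P0 => r0; rewrite PE r0 mulr0.
rewrite PE size_mul // (size_prod_XsubC rs id) addSn /=.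
by case: (size r) (size_poly_eq0 r) => [|m _]; rewrite ?(negPf r0) // addnS leq_addr.
Qed.

End RootProducts.

(** * Dependence of the zeros on a parameter *)

Section ParametrizedRootProducts.
Variable R : realType.
Local Notation C := R[i].
(** [U s] and [V s] stand for the two factors on a line that moves with [s], [P s] for their
    product, and [rs s] for the zeros of [U s]. Nothing is assumed on how [rs] varies with [s]. *)
Variables (U V : C -> C -> C) (P : C -> {poly C}) (d : nat) (rs : C -> seq C).
Hypotheses (jU : jcont U) (jV : jcont V).
Hypotheses (hU : forall s, ent (U s)) (hV : forall s, ent (V s)).
Hypotheses (hU' : forall t, ent (U^~ t)) (hV' : forall t, ent (V^~ t)).
Hypotheses (Pm : forall s, P s \is monic) (sP : forall s, size (P s) = d.+2).
Hypothesis hP : forall i, ent (fun s => (P s)`_i).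
Hypothesis fact : forall s, exists (e : C -> C) (r : {poly C}),
  [/\ ent e, forall t, e t != 0,
      forall t, U s t = (\prod_(a <- rs s) ('X - a%:P)).[t] * e t,
      forall t, V s t * e t = r.[t] & P s = \prod_(a <- rs s) ('X - a%:P) * r].
Variables (M : R) (D : nat).
Hypothesis hM : forall s, coef_bound (P s) <= M * (1 + cn s) ^+ D.

Local Lemma M_ge0 : 0 <= M.
Proof.
have := hM 0; rewrite cn0 addr0 expr1n mulr1; apply: le_trans.
exact: le_trans ler01 (coef_bound_ge1 _).
Qed.

Lemma ent_rec_seq l : ent (fun s => rec_seq (P s) l).
Proof.
rewrite /rec_seq; move: 0%N; elim: l => [|l IH] i.
  have -> : (fun s => rec_state (P s) 0 i) = fun=> (i == d)%:R.
    by apply/funext => s; rewrite /= sP.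
  exact: ent_cst.
have -> : (fun s => rec_state (P s) l.+1 i) = fun s =>
    if i == d then - \sum_(j < d.+1) (P s)`_j * rec_state (P s) l j else rec_state (P s) l i.+1.
  by apply/funext => s; rewrite /= sP.
case: eqP => _; last exact: IH.
by apply: entN; apply: ent_sum => j _; apply: entM.
Qed.

Lemma size1P s : (1 < size (P s))%N. Proof. by rewrite sP. Qed.

(** A Cauchy product of series bounded at radius [4 * rho]: it has [l + 1] terms, derivation adds a
    factor at most [l + 1], and [(l + 1) ^ 2 <= 4 ^ (l + 1)]. *)
Lemma tc_log_derivative_bound S rho : 1 <= rho -> exists2 N : R, 0 <= N & forall s l,
  cn s <= S -> cn (tc (fun t => der (U s) t * V s t) l) <= N / rho ^+ l.
Proof.
move=> r1; have r0 : 0 < rho by lra.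
have [A A0 hA] := tc_param_bound S jU hU (rho := 4 * rho) ltac:(lra).
have [B B0 hB] := tc_param_bound S jV hV (rho := 4 * rho) ltac:(lra).
exists (A * B); first exact: mulr_ge0.
move=> s l sS; have [hAs _] := hA s sS; have [hBs _] := hB s sS.
rewrite tcM //; last exact: ent_der.
apply: le_trans (cn_sum _ _ _) _.
apply: le_trans (_ : \sum_(i < l.+1) (l.+1%:R * (A * B / (4 * rho) ^+ l.+1)) <= _).
  apply: ler_sum => i _; have il : (i <= l)%N by rewrite -ltnS.
  rewrite cnM tc_der // cnM cn_nat -mulrA; apply: ler_pM => //.
  - by apply: mulr_ge0; exact: cn_ge0.
  - by rewrite ler_nat.
  have -> : A * B / (4 * rho) ^+ l.+1 = A / (4 * rho) ^+ i.+1 * (B / (4 * rho) ^+ (l - i)).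
    have -> : (4 * rho) ^+ l.+1 = (4 * rho) ^+ i.+1 * (4 * rho) ^+ (l - i).
      by rewrite -exprD addSn subnKC.
    by rewrite invfM; ring.
  by apply: ler_pM; rewrite ?cn_ge0.
rewrite sumr_const card_ord -[leLHS]mulr_natr.
have x0 : 0 < rho ^+ l by rewrite exprn_gt0.
have AB : 0 <= A * B / rho ^+ l by rewrite divr_ge0 ?mulr_ge0 // ltW.
have -> : l.+1%:R * (A * B / (4 * rho) ^+ l.+1) * l.+1%:R =
    (A * B / rho ^+ l) * ((l.+1%:R ^+ 2 / 4 ^+ l.+1) * rho^-1).
  have y0 : (4 : R) ^+ l.+1 != 0 by rewrite expf_neq0.
  rewrite exprMn [rho ^+ l.+1]exprS; move: y0; set y := 4 ^+ l.+1 => y0.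
  by field; rewrite y0 !gt_eqF.
rewrite ler_piMr //; apply: mulr_ile1.
- by rewrite divr_ge0 // exprn_ge0.
- by rewrite invr_ge0 ltW.
- rewrite ler_pdivrMr ?exprn_gt0 // mul1r.
  have -> : (4 : R) ^+ l.+1 = (2 ^+ l.+1) ^+ 2 by rewrite exprAC expr2; congr (_ ^+ _); ring.
  rewrite ler_sqr ?nnegrE ?exprn_ge0 // -natrX ler_nat.
  by apply: ltnW; exact: ltn_expl.
- by rewrite invf_le1.
Qed.

(** By [moment_power_sum] this is a series whose terms are entire in [s]. On a disc
    [coef_bound (P s) <= B], and Taylor bounds at radius [2 * B] against the growth [B ^ l] leave
    the ratio 1/2. *)
Lemma ent_power_sum k : ent (fun s => \sum_(a <- rs s) a ^+ k).
Proof.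
pose F s t := der (U s) t * V s t.
have hF s : ent (F s) by apply: entM => //; exact: ent_der.
apply: (@ent_mtest R (fun l s => tc (F s) l * rec_seq (P s) (l + k))).
- move=> l; apply: entM; last exact: ent_rec_seq.
  have -> : (fun s => tc (F s) l) =
      fun s => \sum_(i < l.+1) i.+1%:R * tc (U s) i.+1 * tc (V s) (l - i).
    apply/funext => s; rewrite tcM //; last exact: ent_der.
    by apply: eq_bigr => i _; rewrite tc_der.
  apply: ent_sum => i _; apply: entM; last exact: ent_tc_param.
  by apply: entM; [exact: ent_cst|exact: ent_tc_param].
- move=> S; pose B := Num.max 1 (M * (1 + `|S|) ^+ D).
  have B1 : 1 <= B by rewrite le_max lexx.
  have [N N0 hN] := tc_log_derivative_bound S (rho := 2 * B) ltac:(lra).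
  exists (N * B ^+ k) => l s sS; rewrite cnM.
  have PB : coef_bound (P s) <= B.
    apply: le_trans (hM s) _; rewrite le_max; apply/orP; right.
    apply: ler_wpM2l; first exact: M_ge0.
    have s0 := cn_ge0 s; have S0 := normr_ge0 S.
    have sS' : cn s <= `|S| := le_trans sS (ler_norm _).
    by apply: lerXn2r; rewrite ?nnegrE; lra.
  have hB : cn (rec_seq (P s) (l + k)) <= B ^+ l * B ^+ k.
    apply: le_trans (rec_seq_bound _ _) _; rewrite -exprD lerXn2r ?nnegrE //; last by lra.
    exact: le_trans ler01 (coef_bound_ge1 _).
  apply: le_trans (ler_pM (cn_ge0 _) (cn_ge0 _) (hN s l sS) hB) _.
  have x0 : B ^+ l != 0 by rewrite expf_neq0 // gt_eqF //; lra.
  have y0 : (2 : R) ^+ l != 0 by rewrite expf_neq0.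
  rewrite exprMn exprVn; move: x0 y0; set x := B ^+ l; set y := 2 ^+ l => x0 y0.
  by rewrite le_eqVlt; apply/orP; left; apply/eqP; field; rewrite x0 y0.
move=> s; have [e [r [he e0 UE VE PE]]] := fact s.
rewrite -(moment_power_sum k (Pm s) (size1P s) (hV s) he e0 UE VE PE).
have gh : geometric (fun l => rec_seq (P s) (l + k)).
  by apply: geometric_shift; exact: rec_seq_geometric.
have := momentP gh (hF s); congr ulim; apply/funext => n.
by apply: eq_bigr => l _; rewrite expr1n mulr1.
Qed.

Lemma ent_reversed_coef k : ent (fun s => (\prod_(a <- rs s) (1 - a *: 'X))`_k).
Proof.
have [m] := ubnP k; elim: m k => // m IH [|k] km.
  have -> : (fun s => (\prod_(a <- rs s) (1 - a *: 'X))`_0) = fun=> 1.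
    apply/funext => s; rewrite -horner_coef0 horner_prod big1 // => a _.
    by rewrite hornerD hornerN hornerZ hornerX hornerC mulr0 subr0.
  exact: ent_cst.
have -> : (fun s => (\prod_(a <- rs s) (1 - a *: 'X))`_k.+1) = fun s =>
    k.+1%:R^-1 * - \sum_(i < k.+1) (\sum_(a <- rs s) a ^+ i.+1) *
      (\prod_(a <- rs s) (1 - a *: 'X))`_(k.+1 - i.+1).
  by apply/funext => s; rewrite -newton_identity mulKf // pnatr_eq0.
apply: entM; first exact: ent_cst.
apply: entN; apply: ent_sum => i _; apply: entM; first exact: ent_power_sum.
by apply: IH; rewrite subSS; apply: leq_ltn_trans (leq_subr _ _) _; rewrite ltnS in km.
Qed.

Lemma size_rs s : (size (rs s) <= d.+1)%N.
Proof.
have [e [r [_ _ _ _ PE]]] := fact s.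
by have := size_prod_le (monic_neq0 (Pm s)) PE; rewrite sP.
Qed.

(** The product is the value at 1 of the reversed polynomial, so a sum of boundedly many entire
    coefficients; the root bound gives polynomial growth, and Liouville's theorem concludes. *)
Theorem root_product_polynomial : exists2 q : {poly C}, (size q <= (D * d.+1).+1)%N &
  forall s, \prod_(a <- rs s) (1 - a) = q.[s].
Proof.
have M0 := M_ge0.
apply: (@ent_poly_growth R (fun s => \prod_(a <- rs s) (1 - a)) (D * d.+1) ((2 * M) ^+ d.+1)).
  have -> : (fun s => \prod_(a <- rs s) (1 - a)) =
      fun s => \sum_(k < d.+2) (\prod_(a <- rs s) (1 - a *: 'X))`_k.
    apply/funext => s; pose f := \prod_(a <- rs s) (1 - a *: 'X) : {poly C}.
    have sf : (size f <= d.+2)%N.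
      have [|h _] := @size_coef_prod _ _ (rs s) (fun a => 1 - a *: 'X : {poly C}) (fun=> 1%N).
        move=> a; apply: leq_trans (size_polyD _ _) _; rewrite geq_max size_poly1 size_polyN.
        by rewrite (leq_trans (size_scale_leq _ _)) ?size_polyX.
      by apply: leq_trans h _; rewrite sum1_size ltnS size_rs.
    transitivity f.[1].
      by rewrite horner_prod; apply: eq_bigr => a _; rewrite hornerD hornerN hornerZ hornerX hornerC mulr1.
    rewrite (horner_coef_wide _ sf); apply: eq_bigr => k _; by rewrite expr1n mulr1.
  by apply: ent_sum => k _; exact: ent_reversed_coef.
move=> s; pose B := coef_bound (P s); have B1 : 1 <= B := coef_bound_ge1 _.
have [e [r [_ _ _ _ PE]]] := fact s.
apply: (@le_trans _ _ ((2 * B) ^+ d.+1)); last first.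
  rewrite exprM -exprMn lerXn2r ?nnegrE //; first by lra.
    by rewrite mulr_ge0 ?exprn_ge0 ?addr_ge0 ?cn_ge0 //; lra.
  by rewrite -mulrA ler_pM2l //; exact: hM.
apply: (@le_trans _ _ ((2 * B) ^+ size (rs s))); last by rewrite ler_weXn2l ?size_rs //; lra.
rewrite cn_prod -[X in _ ^+ X]sum1_size -prodrXr.
rewrite big_seq [leRHS]big_seq; apply: ler_prod => a ars; rewrite cn_ge0 /= expr1.
have ra : cn a <= B.
  apply: root_bound => //; rewrite ?sP // PE rootM root_prod_XsubC ars //.
by have := cnB 1 a; rewrite cn1; lra.
Qed.

End ParametrizedRootProducts.

(** * One of the two factors has no zeros *)

Section Dichotomy.
Variable R : realType.
Local Notation C := R[i].

Lemma poly_fun_inj (f g : {poly C}) : (forall t, f.[t] = g.[t]) -> f = g.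
Proof.
move=> h; apply/eqP; rewrite -subr_eq0; apply/negPn/negP => /exists_nonroot[t].
by rewrite hornerD hornerN h subrr eqxx.
Qed.

(** Each root of [q] is a zero of [F] or of [G] and is divided out there; when [q] has become
    constant, what is left of [F] is the unit [e]. *)
Lemma factor_entire_divisors (q : {poly C}) (F G : C -> C) : q != 0 -> ent F -> ent G ->
  (forall t, F t * G t = q.[t]) ->
  exists (rs rs' : seq C) (e : C -> C), [/\ ent e, forall t, e t != 0,
    forall t, F t = (\prod_(a <- rs) ('X - a%:P)).[t] * e t,
    forall t, G t * e t = lead_coef q * (\prod_(b <- rs') ('X - b%:P)).[t] &
    q = lead_coef q *: (\prod_(a <- rs) ('X - a%:P) * \prod_(b <- rs') ('X - b%:P))].
Proof.
have [m] := ubnP (size q); elim: m q F G => // m IH q F G sm q0 hF hG FG.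
have [s1|s1] := leqP (size q) 1.
  have [c qE] : exists c, q = c%:P by exists q`_0; exact: size1_polyC.
  have c0 : c != 0 by rewrite -polyC_eq0 -qE.
  have F0 t : F t != 0.
    by have : F t * G t != 0; [rewrite FG qE hornerC|rewrite mulf_eq0 negb_or => /andP[]].
  exists [::], [::], F; split=> //.
  - by move=> t; rewrite big_nil hornerC mul1r.
  - by move=> t; rewrite big_nil hornerC mulr1 mulrC FG qE lead_coefC hornerC.
  - by rewrite !big_nil mulr1 qE lead_coefC -mul_polyC mulr1.
have [a ra] : exists a, root q a by apply/closed_rootP; rewrite neq_ltn s1 orbT.
have [q1 qE] := factor_theorem q a ra.
have q10 : q1 != 0 by apply: contraNneq q0 => q10; rewrite qE q10 mul0r.
have lq : lead_coef q = lead_coef q1 by rewrite qE lead_coefM lead_coefXsubC mulr1.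
have sq1 : (size q1 < m)%N.
  by move: sm; rewrite qE size_Mmonic ?monicXsubC // size_XsubC addn2.
(* At the point [a] itself the cancellation of [t - a] uses that entire functions have no zero
   divisors. *)
have cancel_root (H : C -> C) : ent H -> (forall t, (t - a) * H t = q.[t]) ->
    forall t, H t = q1.[t].
  move=> hH HE; have hX : ent (fun t => t - a) by apply: entB; [exact: ent_id|exact: ent_cst].
  have hD : ent (fun t => H t - q1.[t]) by apply: entB => //; exact: ent_horner.
  have [] := ent_mul_eq0 hX hD.
  - by move=> t; rewrite mulrBr HE qE hornerM hornerXsubC mulrC subrr.
  - by move=> /(_ (a + 1)) /eqP; rewrite addrAC subrr add0r oner_eq0.
  - by move=> h t; apply/eqP; rewrite -subr_eq0 h.
have : F a * G a = 0 by rewrite FG; exact/rootP.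
move=> /eqP; rewrite mulf_eq0 => /orP[/eqP Fa|/eqP Ga].
  have [F1 hF1 FE] := ent_factor hF Fa.
  have hFG : ent (fun t => F1 t * G t) by exact: entM.
  have [|rs [rs' [e [he e0 h1 h2 h3]]]] := IH q1 F1 G sq1 q10 hF1 hG.
    by apply: cancel_root => // t; rewrite mulrA -FE.
  exists (a :: rs), rs', e; split=> //.
  - by move=> t; rewrite big_cons hornerM hornerXsubC -mulrA -h1.
  - by move=> t; rewrite lq.
  - by rewrite lq qE {1}h3 big_cons -scalerAl mulrC mulrA.
have [G1 hG1 GE] := ent_factor hG Ga.
have hFG : ent (fun t => F t * G1 t) by exact: entM.
have [|rs [rs' [e [he e0 h1 h2 h3]]]] := IH q1 F G1 sq1 q10 hF hG1.
  by apply: cancel_root => // t; rewrite mulrCA -GE.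
exists rs, (a :: rs'), e; split=> //.
- by move=> t; rewrite lq big_cons hornerM hornerXsubC GE -mulrA h2 mulrCA.
- by rewrite lq qE {1}h3 big_cons -scalerAl mulrAC -mulrA.
Qed.

Variable n : nat.
Local Notation Cn := 'rV[C]_n.
Implicit Types (u v : Cn -> C) (x y z w : Cn) (p q : mpoly n C).

Lemma line_polyZ l p x y : line_poly (l *: p) x y = l *: line_poly p x y.
Proof. by apply: poly_fun_inj => t; rewrite hornerZ !line_polyE pevalZ. Qed.

Lemma coef_line_poly_line p x y w i : exists2 f : {poly C}, (size f <= msize p)%N &
  forall s, (line_poly p (x + s *: y) w)`_i = f.[s].
Proof.
have [a ha] := coef_line_poly p i.
exists (\sum_k a k *: line_poly p (x + (k : nat)%:R *: w) y).
  apply: leq_trans (size_sum _ _ _) _; apply/bigmax_leqP => k _.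
  by apply: leq_trans (size_scale_leq _ _) _; exact: (line_poly_lead p _ y).1.
move=> s; rewrite ha horner_sum; apply: eq_bigr => k _.
by rewrite hornerZ line_polyE addrAC.
Qed.

Lemma horner_growth (f : {poly C}) (D : nat) s : (size f <= D.+1)%N ->
  cn f.[s] <= (\sum_(i < size f) cn f`_i) * (1 + cn s) ^+ D.
Proof.
move=> sf; rewrite horner_coef; apply: le_trans (cn_sum _ _ _) _.
rewrite mulr_suml; apply: ler_sum => i _; rewrite cnM cnX.
apply: ler_wpM2l; first exact: cn_ge0.
have s0 := cn_ge0 s; apply: (@le_trans _ _ ((1 + cn s) ^+ i)).
  by apply: lerXn2r; rewrite ?nnegrE; lra.
apply: ler_weXn2l; first by lra.
by rewrite -ltnS (leq_trans (ltn_ord i)).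
Qed.

(** The base point is [z - w], so that the parameter 1 on the line is [z]. Moving [z] along a
    coordinate axis is the one-parameter situation, with a degree bound independent of [z], as
    [separately_polynomial] requires. *)
Lemma root_product_mpoly u v q w d (rs : Cn -> seq C) : entire u -> entire v ->
  (forall x, line_poly q x w \is monic) -> (forall x, size (line_poly q x w) = d.+2) ->
  (forall x, exists (e : C -> C) (r : {poly C}), [/\ ent e, forall t, e t != 0,
     forall t, u (x + t *: w) = (\prod_(a <- rs x) ('X - a%:P)).[t] * e t,
     forall t, v (x + t *: w) * e t = r.[t] &
     line_poly q x w = \prod_(a <- rs x) ('X - a%:P) * r]) ->
  exists m, forall z, \prod_(a <- rs (z - w)) (1 - a) = peval m z.
Proof.
move=> hu hv qm sq fact; pose D := msize q.
apply: (@separately_polynomial _ _ _ (D * d.+1).+1) => z j.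
pose ej : Cn := delta_mx ord0 j; pose x := z - w.
have cf i := coef_line_poly_line q x ej w i.
have /choice[f hf] : forall i, exists f : {poly C}, (size f <= D.+1)%N /\
    forall s, (line_poly q (x + s *: ej) w)`_i = f.[s].
  by move=> i; have [f sf fE] := cf i; exists f; split=> //; exact: leqW.
have [|||||||||||f' sf' f'E] := @root_product_polynomial R
  (fun s t => u (x + s *: ej + t *: w)) (fun s t => v (x + s *: ej + t *: w))
  (fun s => line_poly q (x + s *: ej) w) d (fun s => rs (x + s *: ej))
  _ _ _ _ _ _ _ _ _ _ (1 + \sum_(i < d.+1) \sum_(k < size (f i)) cn (f i)`_k) D.
- exact: jcont_plane.
- exact: jcont_plane.
- by move=> s; exact: ent_line.
- by move=> s; exact: ent_line.
- move=> t; under eq_fun do rewrite addrAC; exact: ent_line.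
- move=> t; under eq_fun do rewrite addrAC; exact: ent_line.
- by move=> s; exact: qm.
- by move=> s; exact: sq.
- move=> i; under eq_fun do rewrite (hf i).2; exact: ent_horner.
- by move=> s; exact: fact.
- move=> s; rewrite /coef_bound sq mulrDl mul1r; apply: lerD.
    by apply: exprn_ege1; have := cn_ge0 s; lra.
  rewrite mulr_suml; apply: ler_sum => i _; rewrite (hf i).2.
  exact: horner_growth (hf i).1.
exists f' => // t; rewrite -f'E; congr (\prod_(a <- rs _) _).
by rewrite /x addrAC.
Qed.

Theorem irreducible_dichotomy u v p : p != 0 -> irreducible_mpoly p ->
  entire u -> entire v -> (forall z, u z * v z = peval p z) ->
  (forall z, u z != 0) \/ (forall z, v z != 0).
Proof.
move=> p0 irr hu hv uv.
have [w [l [l0 hl]]] := noncharacteristic_direction p0.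
have sp : (0 < msize p)%N by rewrite -(mlead_deg p0).
case E: (msize p) sp hl => [//|[|d]] _ hl.
  have /msize_poly1P[c c0 pE] : msize p == 1%N by rewrite E.
  left => z; have : u z * v z != 0 by rewrite uv pE pevalC.
  by rewrite mulf_eq0 negb_or => /andP[].
have lc x : lead_coef (line_poly p x w) = l.
  by have [<- sz] := hl x; rewrite /lead_coef sz.
have lp0 x : line_poly p x w != 0 by rewrite -lead_coef_eq0 lc.
have /choice[rs /choice[rs' /choice[e he]]] : forall x, exists (rs rs' : seq C) (e : C -> C),
    [/\ ent e, forall t, e t != 0,
      forall t, u (x + t *: w) = (\prod_(a <- rs) ('X - a%:P)).[t] * e t,
      forall t, v (x + t *: w) * e t = l * (\prod_(b <- rs') ('X - b%:P)).[t] &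
      line_poly p x w = l *: (\prod_(a <- rs) ('X - a%:P) * \prod_(b <- rs') ('X - b%:P))].
  move=> x; have := @factor_entire_divisors (line_poly p x w) (fun t => u (x + t *: w))
    (fun t => v (x + t *: w)) (lp0 x) (ent_line x w hu) (ent_line x w hv).
  by rewrite lc; apply => t; rewrite uv line_polyE.
(* The leading coefficient [l] is common to all lines of direction [w]; dividing by it makes the
   restricted polynomials monic. *)
pose v' z := l^-1 * v z.
have hv' : entire v' by apply: entireM => //; exact: entire_cst.
have lcm x : line_poly (l^-1 *: p) x w \is monic.
  by rewrite line_polyZ monicE lead_coefZ lc mulVf.
have lsz x : size (line_poly (l^-1 *: p) x w) = d.+2.
  by rewrite line_polyZ size_scale ?invr_eq0 // (hl x).2.
have lE x : line_poly (l^-1 *: p) x w =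
    \prod_(a <- rs x) ('X - a%:P) * \prod_(b <- rs' x) ('X - b%:P).
  by have [_ _ _ _ h] := he x; rewrite line_polyZ h scalerA mulVf // scale1r.
have [m hm] : exists m, forall z, \prod_(a <- rs (z - w)) (1 - a) = peval m z.
  apply: (root_product_mpoly hu hv' lcm lsz) => x; have [h1 h2 h3 h4 h5] := he x.
  exists (e x), (\prod_(b <- rs' x) ('X - b%:P)); split=> // t.
  by rewrite /v' -mulrA h4 mulKf.
(* The same with the factors exchanged and the unit [e] replaced by its inverse. *)
have [m' hm'] : exists m, forall z, \prod_(a <- rs' (z - w)) (1 - a) = peval m z.
  apply: (root_product_mpoly hv' hu lcm lsz) => x; have [h1 h2 h3 h4 h5] := he x.
  exists (fun t => (e x t)^-1), (\prod_(a <- rs x) ('X - a%:P)); split.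
  - exact: entV.
  - by move=> t; rewrite invr_eq0.
  - by move=> t; apply: (mulIf (h2 t)); rewrite mulfVK // /v' -mulrA h4 mulKf.
  - by move=> t; rewrite h3 mulfK.
  - by rewrite lE mulrC.
have at1 (s : seq C) : (\prod_(a <- s) ('X - a%:P)).[1] = \prod_(a <- s) (1 - a).
  by rewrite horner_prod; apply: eq_bigr => a _; rewrite hornerXsubC.
have uE z : u z = peval m z * e (z - w) 1.
  by have [_ _ /(_ 1) + _ _] := he (z - w); rewrite scale1r subrK at1 hm.
have vE z : v z * e (z - w) 1 = peval (l *: m') z.
  by have [_ _ _ /(_ 1) + _] := he (z - w); rewrite scale1r subrK at1 hm' pevalZ.
(* The unit multiplies [m] in [u] and divides [l *: m'] in [v], so it cancels here and
   irreducibility can be used. *)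
have pE : p = m * (l *: m').
  by apply: peval_inj => z; rewrite pevalM -vE -uv uE; ring.
have e1 z : e (z - w) 1 != 0 by have [_ h _ _ _] := he (z - w); exact: h.
have [m0 m'0] : m != 0 /\ l *: m' != 0.
  by apply/andP; rewrite -negb_or -mulf_eq0 -pE.
case: (irr _ _ pE) => -[c cE]; [left|right] => z.
  rewrite uE mulf_neq0 // cE pevalC; apply: contraNneq m0 => c0.
  by rewrite cE c0 mpolyC0.
suff : v z * e (z - w) 1 != 0 by rewrite mulf_eq0 negb_or => /andP[].
rewrite vE cE pevalC; apply: contraNneq m'0 => c0.
by rewrite cE c0 mpolyC0.
Qed.

End Dichotomy.

(** * The difference equation *)

Section SeveralVariables.
Variables (R : realType) (n : nat).
Local Notation C := R[i].
Local Notation Cn := 'rV[C]_n.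
Implicit Types (F G g : Cn -> C) (x y z : Cn).

Lemma entire_mul_eq0 F G : entire F -> entire G -> (forall z, F z * G z = 0) ->
  (forall z, F z = 0) \/ (forall z, G z = 0).
Proof.
move=> hF hG FG; have [h|/existsNP[x /eqP Fx]] := pselect (forall z, F z = 0); first by left.
right => y; have [|h|h] := ent_mul_eq0 (ent_line x (y - x) hF) (ent_line x (y - x) hG).
- by move=> t; exact: FG.
- by move: Fx; have := h 0; rewrite scale0r addr0 => ->; rewrite eqxx.
- by have := h 1; rewrite scale1r addrC subrK.
Qed.

Lemma entire_prod_eq0 (I : eqType) (s : seq I) (F : I -> Cn -> C) :
  (forall i, entire (F i)) -> (forall z, \prod_(i <- s) F i z = 0) ->
  exists2 i, i \in s & forall z, F i z = 0.
Proof.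
move=> hF; elim: s => [|i s IH] h.
  by have /eqP := h 0; rewrite big_nil oner_eq0.
have [||Fi|/IH[j js Fj]] := @entire_mul_eq0 (F i) (fun z => \prod_(j <- s) F j z) (hF i).
- by apply: entire_prod => j _.
- by move=> z; rewrite -[RHS](h z) big_cons.
- by exists i; rewrite ?mem_head.
- by exists j; rewrite // inE js orbT.
Qed.

(* Through a base point where no coefficient vanishes, every line yields a pair
   whose difference is constant along it; so the product of these differences
   vanishes identically. *)
Lemma borel_several_variables (I : finType) (p : I -> mpoly n C) (h : I -> Cn -> C) i0 :
  p i0 != 0 -> (forall i, entire (h i)) ->
  (forall z, \sum_i peval (p i) z * cexp (h i z) = 0) ->
  exists i j, [/\ p i != 0, p j != 0, i != j &
    constant_fun (fun z => h i z - h j z)].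
Proof.
move=> pi0 hh rel; pose A0 := finset [pred i | p i != 0].
have A00 : A0 != finset.set0 by apply/finset.set0Pn; exists i0; rewrite inE.
have [x hx] : exists x, forall i, i \in A0 -> peval (p i) x != 0.
  have [|x] := @peval_nonvanishing _ n (\prod_(i in A0) p i).
    apply: (big_ind (fun q => q != 0)); [exact: oner_neq0|exact: mulf_neq0|].
    by move=> i; rewrite inE => pi; exact: pi.
  rewrite /peval rmorph_prod /= => /prodf_neq0 hx.
  by exists x => i /hx.
pose prs := [seq ij : I * I <- enum {: I * I} | [&& ij.1 \in A0, ij.2 \in A0 & ij.1 != ij.2]].
pose D (ij : I * I) z := (h ij.1 z - h ij.2 z) - (h ij.1 x - h ij.2 x).
have [|z|[i j]] := @entire_prod_eq0 _ prs D.
- by move=> ij; apply: entireB; [exact: entireB|exact: entire_cst].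
- have [|i|z'|i [j [iA jA ij hij]]] := @borel_one_variable R I
    (fun i => line_poly (p i) x (z - x)) (fun i t => h i (x + t *: (z - x))) A0 A00.
  + move=> i /hx; apply: contraNneq => e; have := line_polyE (p i) x (z - x) 0.
    by rewrite e horner0 scale0r addr0 => <-.
  + exact: ent_line.
  + rewrite -[RHS](rel (x + z' *: (z - x))) [RHS](bigID (mem A0)) /=.
    rewrite [X in _ = _ + X]big1 ?addr0; last first.
      by move=> i; rewrite inE negbK => /eqP ->; rewrite peval0 mul0r.
    by apply: eq_bigr => i _; rewrite line_polyE.
  have ijs : (i, j) \in prs by rewrite mem_filter /= iA jA ij mem_enum.
  rewrite (big_rem _ ijs) /D /=; have := hij 1.
  rewrite scale1r scale0r addr0 [x + _]addrC subrK => ->.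
  by rewrite subrr mul0r.
rewrite mem_filter /= !inE => /andP[/and3P[pi pj ij] _] hD.
exists i, j; split=> //; exists (h i x - h j x) => z.
by apply/eqP; rewrite -subr_eq0; apply/eqP; exact: hD.
Qed.

(** The two exponents differ by [2 i g], so a nonzero coefficient would make [g] constant by Borel's
    theorem. *)
Lemma borel_unit_inverse (p q : mpoly n C) g : entire g -> ~ constant_fun g ->
  (forall z, peval p z * cexp ('i * g z) + peval q z * cexp (- ('i * g z)) = 0) ->
  p = 0 /\ q = 0.
Proof.
move=> hg ng rel; have i0 : 'i != 0 :> C by exact: neq0Ci.
pose P (b : bool) := if b then p else q.
pose h (b : bool) z := if b then 'i * g z else - ('i * g z).
have hig : entire (fun z => 'i * g z) by apply: entireM => //; exact: entire_cst.
have P0 b : P b = 0.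
  apply/eqP/negPn/negP => Pb; apply: ng.
  have [||i [j [_ _ ij [a ha]]]] := @borel_several_variables _ P h b Pb.
  - by move=> []; [exact: hig|exact: entireN hig].
  - by move=> z; rewrite big_bool; exact: rel.
  have i20 : 2 * 'i != 0 :> C by rewrite mulf_neq0 // pnatr_eq0.
  exists (if i then a / (2 * 'i) else - a / (2 * 'i)) => z.
  have := ha z; case: i j ij {ha} => [] [] // _ <-; rewrite /h /=; field; exact: i0.
by split; [exact: (P0 true)|exact: (P0 false)].
Qed.

Lemma nowhere_zero_mpoly (m : mpoly n C) : (forall z, peval m z != 0) ->
  nonzero_constant_poly m.
Proof.
move=> hm; have m0 : m != 0.
  by apply: contraTneq (hm 0) => ->; rewrite peval0 eqxx.
have [y [l [l0 hl]]] := noncharacteristic_direction m0.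
have [s1|s1] := leqP (msize m) 1.
  have E := msize1_polyC s1; eexists; split; last exact: E.
  by apply: contraNneq m0 => e; rewrite E e mpolyC0.
have [_ sl] := hl 0.
have [t /rootP] : exists t, root (line_poly m 0 y) t.
  by apply/closed_rootP; rewrite sl neq_ltn s1 orbT.
by rewrite line_polyE => /eqP; rewrite (negPf (hm _)).
Qed.

(** Such an [m] has period [2 c], so on each line of direction [c] it takes one value infinitely
    often and is constant there; hence [m (z + c) = m z]. This makes [g] transcendental in case
    (ii). *)
Lemma antiperiodic_mpoly (m : mpoly n C) (c : Cn) (a : C) :
  (forall z, peval m (z + c) + peval m z = a) -> constant_fun (peval m).
Proof.
move=> h; exists (a / 2) => z.
have per k : peval m (z + (2 * k%:R) *: c) = peval m z.
  elim: k => [|k IH]; first by rewrite mulr0 scale0r addr0.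
  have h1 := h (z + (2 * k%:R) *: c); have h2 := h (z + (2 * k%:R) *: c + c).
  have -> : z + (2 * k.+1%:R) *: c = z + (2 * k%:R) *: c + c + c.
    by apply/rowP => j; rewrite -[k.+1%:R]natr1 !mxE; ring.
  rewrite -IH; apply/(addIr (peval m (z + (2 * k%:R) *: c + c))).
  by rewrite h2 addrC h1.
pose q := line_poly m z c - (peval m z)%:P.
have q0 : q = 0.
  apply: (@poly_eq0_of_roots _ q (fun k => 2 * k%:R)) => [i j|k].
    by move/(mulfI (x := 2)) => /(_ _)/wrap[|/eqP]; rewrite ?pnatr_eq0 // eqr_nat => /eqP.
  by rewrite /q hornerD hornerN hornerC line_polyE per subrr.
have := congr1 (horner^~ 1) q0; rewrite /q hornerD hornerN hornerC line_polyE scale1r horner0.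
move=> /eqP; rewrite subr_eq0 => /eqP e; rewrite -(h z) e.
by field.
Qed.

End SeveralVariables.

(** The identity of case (iii) is the product of the two polynomial identities, in which the
    constant [a = exp (i kap)] and its inverse cancel. *)
Lemma product_relation (F : fieldType) (a D D' b1 b2 c1 c2 p p' : F) : a != 0 ->
  D' * c1 = a^-1 * (D * b2 * p') -> D' * c2 * p = a * (D * b1) ->
  D ^+ 2 * p' * b1 * b2 = D' ^+ 2 * p * c1 * c2.
Proof.
move=> a0 h1 h2; transitivity ((D' * c1) * (D' * c2 * p)); last by ring.
by rewrite h1 h2; field.
Qed.

Lemma product_relation' (F : fieldType) (a D D' b1 b2 c1 c2 p p' : F) : a != 0 ->
  D' * c1 = - (a * (D * b1)) -> D' * c2 * p = - (a^-1 * (D * b2 * p')) ->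
  D ^+ 2 * p' * b1 * b2 = D' ^+ 2 * p * c1 * c2.
Proof.
move=> a0 h1 h2; transitivity ((D' * c1) * (D' * c2 * p)); last by ring.
by rewrite h1 h2; field.
Qed.

Lemma regroup_relation (F : fieldType) (a b x y u v w t : F) :
  u * (a * x) + - v * (b * y) + (w * x + - t * y) = 0 ->
  (a * u + w) * x + - (b * v + t) * y = 0.
Proof. by move=> <-; ring. Qed.

Lemma regroup_crossed_relation (F : fieldType) (a b x y u v w t : F) :
  u * (a * y) + - v * (b * x) + (w * x + - t * y) = 0 ->
  (w - b * v) * x + (a * u - t) * y = 0.
Proof. by move=> <-; ring. Qed.

(** For the case [b1 = b2t = 0]: [j] is i, [a] the constant [p2], [b] the constant [exp (i kap)],
    [y] and [x] are the values of [p5] at [z] and [z + c], and [q] that of [p] at [z + c]. *)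
Lemma degenerate_relation1 (F : fieldType) (j k a b x y q : F) : j * j = -1 -> k * k = 1 ->
  b != 0 ->
  (a * (j * k * x) - - (j * k) * a * x) * (k * y - j * (j * k * y)) =
  b^-1 * ((a * (j * k * y) - - (j * k) * a * y) * (k * a + j * (- (j * k) * a)) * q) ->
  4 * j * a / b * (y * (b * x - a * q)) = 0.
Proof.
move=> j2 k2 b0 /eqP; rewrite -subr_eq0 => /eqP <-.
transitivity (2 * j * (k * k) * (1 - j * j) * a / b * (y * (b * x - a * q))).
  by rewrite j2 k2; ring.
by field.
Qed.

Lemma degenerate_relation2 (F : fieldType) (j k a b x y q : F) : j * j = -1 -> k * k = 1 ->
  (x * (- (j * k) * a) - j * k * x * a) * (k * a + j * (- (j * k) * a)) * q =
  b * ((y * (- (j * k) * a) - j * k * y * a) * (k * x - j * (j * k * x))) ->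
  4 * j * a * (x * (b * y - a * q)) = 0.
Proof.
move=> j2 k2 /eqP; rewrite -subr_eq0 => /eqP <-.
transitivity (2 * j * (k * k) * (1 - j * j) * a * (x * (b * y - a * q))).
  by rewrite j2 k2; ring.
by ring.
Qed.

(** Here [f] stands for the value at [z + c], which is known from the solution formula at [z + c]
    and from the linear system at [z]; cross-multiplying by the two determinants removes it. *)
Lemma eliminate_unknown (F : comPzRingType) (e D D' f b1 b2 c1 c2 x y x' y' p p' : F) :
  e * D' * f = b1 * x' - b2 * (p' * y') -> e * D * f = - c1 * x + c2 * (p * y) ->
  D * b1 * x' + - (D * b2 * p') * y' + (D' * c1 * x + - (D' * c2 * p) * y) = 0.
Proof.
move=> h1 h2; transitivity (D * (e * D' * f) - D' * (e * D * f)); last by ring.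
by rewrite h1 h2; ring.
Qed.

Theorem theorem5p1 (R : realType) (n : nat) (hn : (1 <= n)%N)
  (c : 'rV[R[i]]_n) (hc : c != 0)
  (p p2 p4 p5 p6 : mpoly n R[i])
  (hp0 : p != 0) (hp : irreducible_mpoly p)
  (hd1 : p2 * p6 - p4 * p5 != 0)
  (f : 'rV[R[i]]_n -> R[i]) (hf : entire f)
  (hsol : forall z,
     (peval p2 z * shift_by c f z + peval p5 z * f z) ^+ 2 +
     (peval p4 z * shift_by c f z + peval p6 z * f z) ^+ 2 = peval p z) :
  exists (k : R[i]) (g : 'rV[R[i]]_n -> R[i]),
    (k = 1 \/ k = -1) /\ entire g /\
    let d1 := p2 * p6 - p4 * p5 in
    let b1 := k *: p2 - 'i *: p4 in
    let b2 := k *: p2 + 'i *: p4 in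
    let b1t := k *: p5 - 'i *: p6 in
    let b2t := k *: p5 + 'i *: p6 in
    let bar := shift_by c in
    eq_quotient f
      (fun z => peval b1 z * cexp ('i * g z)
                - peval p z * peval b2 z * cexp (- ('i * g z)))
      (fun z => 2 * 'i * peval d1 z) /\
    [\/ constant_fun g,
        [/\ transcendental g,
            constant_fun (fun z => bar g z + g z)
          & [/\ b1t = 0, b2 = 0, nonzero_constant_poly p5
              & nonzero_constant_ratio p p2] \/
            [/\ b2t = 0, b1 = 0, nonzero_constant_poly p2
              & nonzero_constant_ratio p p5]]
      | [/\ forall z,
              peval d1 z ^+ 2 * bar (peval p) z
                * bar (peval b1) z * bar (peval b2) z
              = bar (peval d1) z ^+ 2 * peval p z
                * peval b1t z * peval b2t z,
            ~ (forall z, bar (peval d1) z ^+ 2 * peval p z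
                         * peval b1t z * peval b2t z = 0)
          & (eq_quotient (fun z => cexp ('i * (bar g z + g z)))
               (fun z => bar (peval d1) z * peval p z * peval b2t z)
               (fun z => peval d1 z * bar (peval b1) z) /\
             constant_fun (fun z => cexp ('i * (bar g z + g z)))) \/
            (eq_quotient (fun z => cexp ('i * (bar g z - g z)))
               (fun z => - (bar (peval d1) z * peval b1t z))
               (fun z => peval d1 z * bar (peval b1) z) /\
             constant_fun (fun z => cexp ('i * (bar g z - g z))))]].
Proof.
have i2 : 'i * 'i = -1 :> R[i] by rewrite -expr2 sqrCi.
have i0 : 'i != 0 :> R[i] by exact: neq0Ci.
pose A z := peval p2 z * shift_by c f z + peval p5 z * f z.
pose B z := peval p4 z * shift_by c f z + peval p6 z * f z.
have hfc : entire (shift_by c f) by exact: entire_shift.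
have hA : entire A by apply: entireD; apply: entireM => //; exact: entire_peval.
have hB : entire B by apply: entireD; apply: entireM => //; exact: entire_peval.
have hAB a : entire (fun z => A z + a * B z).
  exact: entireD hA (entireM (@entire_cst _ _ a) hB).
have AB a z : a * a = -1 -> (A z + a * B z) * (A z + - a * B z) = peval p z.
  move=> a2; rewrite -hsol -/(A z) -/(B z).
  transitivity (A z ^+ 2 - a * a * B z ^+ 2); first by ring.
  by rewrite a2; ring.
have [k [k1 k2 X0]] : exists k : R[i],
    [/\ k = 1 \/ k = -1, k * k = 1 & forall z, A z + 'i * k * B z != 0].
  have [h|h] := irreducible_dichotomy hp0 hp (hAB 'i) (hAB (- 'i)) (fun z => AB 'i z i2).
    by exists 1; split; [left|ring|move=> z; rewrite mulr1].
  by exists (-1); split; [right|ring|move=> z; rewrite mulrN1].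
pose X z := A z + 'i * k * B z; pose Y z := A z - 'i * k * B z.
have XY z : X z * Y z = peval p z.
  rewrite -(AB ('i * k) z) ?mulNr //.
  by transitivity ('i * 'i * (k * k)); [ring|rewrite i2 k2 mulr1].
have [g hg gX] := entire_logarithm (hAB ('i * k)) X0.
have {}gX z : cexp ('i * g z) = X z by rewrite gX.
have {}X0 z : X z != 0 by exact: X0.
have YE z : Y z = peval p z * cexp (- ('i * g z)).
  by rewrite cexpNV gX -XY mulrAC divff ?mul1r.
exists k, g; split=> //; split=> //.
move=> d1 b1 b2 b1t b2t bar.
have d1E z : peval d1 z = peval p2 z * peval p6 z - peval p4 z * peval p5 z.
  by rewrite pevalB !pevalM.
have b1E z : peval b1 z = k * peval p2 z - 'i * peval p4 z by rewrite pevalB !pevalZ.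
have b2E z : peval b2 z = k * peval p2 z + 'i * peval p4 z by rewrite pevalD !pevalZ.
have b1tE z : peval b1t z = k * peval p5 z - 'i * peval p6 z by rewrite pevalB !pevalZ.
have b2tE z : peval b2t z = k * peval p5 z + 'i * peval p6 z by rewrite pevalD !pevalZ.
have fE z : 2 * 'i * peval d1 z * f z = peval b1 z * X z - peval b2 z * Y z.
  transitivity (2 * 'i * (k * k * (peval p2 z * B z) - peval p4 z * A z)).
    by rewrite k2 d1E /A /B; ring.
  by rewrite b1E b2E /X /Y; ring.
have fcE z : 2 * 'i * peval d1 z * f (z + c) = - peval b1t z * X z + peval b2t z * Y z.
  transitivity (2 * 'i * (peval p6 z * A z - k * k * (peval p5 z * B z))).
    by rewrite k2 d1E /A /B /shift_by; ring.
  by rewrite b1tE b2tE /X /Y; ring.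
have XE z : X z = peval p2 z * f (z + c) + peval p5 z * f z +
    'i * k * (peval p4 z * f (z + c) + peval p6 z * f z) by [].
have i20 : 2 * 'i != 0 :> R[i] by rewrite mulf_neq0 // pnatr_eq0.
have [[z0 d1z0] d10] : (exists z, peval d1 z != 0) /\ d1 != 0.
  by split=> //; exact: peval_nonvanishing.
clearbody d1 b1 b2 b1t b2t X Y A B.
split.
  split; first by exists z0; rewrite mulf_neq0.
  move=> z nz; apply: (mulfI nz); rewrite fE mulrCA divff // mulr1 gX YE.
  by ring.
have [sd sdE] := mpoly_shift c d1; have [sb1 sb1E] := mpoly_shift c b1.
have [sb2 sb2E] := mpoly_shift c b2; have [sp spE] := mpoly_shift c p.
have shift0 (q q' : mpoly n R[i]) : (forall z, peval q' z = peval q (z + c)) -> q != 0 -> q' != 0.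
  move=> h; apply: contraNneq => e; apply/eqP/peval_eq0 => z.
  by have := h (z - c); rewrite subrK e peval0 => <-.
have sd0 := shift0 _ _ sdE d10; have sp0 := shift0 _ _ spE hp0.
have sb10 := shift0 _ _ sb1E; have sb20 := shift0 _ _ sb2E.
have rel z : peval (d1 * sb1) z * cexp ('i * g (z + c)) +
    peval (- (d1 * sb2 * sp)) z * cexp (- ('i * g (z + c))) +
    (peval (sd * b1t) z * cexp ('i * g z) +
     peval (- (sd * b2t * p)) z * cexp (- ('i * g z))) = 0.
  rewrite !pevalN !pevalM sdE sb1E sb2E spE !gX.
  have h1 := fE (z + c); have h2 := fcE z; rewrite !YE in h1 h2.
  exact: eliminate_unknown h1 h2.
(* Both vanish only if [p2 = p4 = 0], which makes [d1] zero. This provides the nonzero coefficient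
   from which Borel's theorem starts. *)
have b12 : b1 = 0 -> b2 = 0 -> False.
  move=> e1 e2; move/eqP: d1z0; apply.
  have h1 := b1E z0; have h2 := b2E z0; rewrite e1 e2 !peval0 in h1 h2.
  have h3 : 2 * k * peval p2 z0 = 0.
    by transitivity (k * peval p2 z0 - 'i * peval p4 z0 +
      (k * peval p2 z0 + 'i * peval p4 z0)); [ring|rewrite -h1 -h2 addr0].
  have h4 : 2 * 'i * peval p4 z0 = 0.
    by transitivity (k * peval p2 z0 + 'i * peval p4 z0 -
      (k * peval p2 z0 - 'i * peval p4 z0)); [ring|rewrite -h1 -h2 subr0].
  have k0 : 2 * k != 0.
    by rewrite mulf_neq0 ?pnatr_eq0 //; case: k1 => ->; rewrite ?oppr_eq0 oner_eq0.
  move/eqP: h3; rewrite mulf_eq0 (negPf k0) /= => /eqP h3.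
  move/eqP: h4; rewrite mulf_eq0 (negPf i20) /= => /eqP h4.
  by rewrite d1E h3 h4; ring.

have shg : entire (shift_by c g) by exact: entire_shift.
have three : [\/ constant_fun g, constant_fun (fun z => g (z + c) + g z) |
    constant_fun (fun z => g (z + c) - g z)].
  (* The first boolean tells whether [g] is shifted, the second is the sign of the exponent. A pair
     that differs in the sign only gives [g] constant, in the shift only the difference, in both the
     sum. *)
  pose P (i : bool * bool) := if i.1 then (if i.2 then d1 * sb1 else - (d1 * sb2 * sp))
    else (if i.2 then sd * b1t else - (sd * b2t * p)).
  pose h (i : bool * bool) z := let y := 'i * (if i.1 then g (z + c) else g z) in
    if i.2 then y else - y.
  have hh i : entire (h i).
    have i1 : entire (fun z => 'i * g (z + c)) := entireM (@entire_cst _ _ 'i) shg.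
    have i3 : entire (fun z => 'i * g z) := entireM (@entire_cst _ _ 'i) hg.
    by case: i => -[] []; [exact: i1|exact: entireN i1|exact: i3|exact: entireN i3].
  have relP z : \sum_i peval (P i) z * cexp (h i z) = 0.
    rewrite -(pair_bigA _ (fun s e => peval (P (s, e)) z * cexp (h (s, e) z))) /=.
    by rewrite !big_bool; exact: rel.
  have [i0' Pi0] : exists i, P i != 0.
    have [e1|e1] := eqVneq b1 0; last first.
      by exists (true, true); exact: mulf_neq0 d10 (sb10 e1).
    have [e2|e2] := eqVneq b2 0; first by case: (b12 e1 e2).
    by exists (true, false); rewrite oppr_eq0; exact: mulf_neq0 (mulf_neq0 d10 (sb20 e2)) sp0.
  have [i [j [_ _ ij [a ha]]]] := borel_several_variables Pi0 hh relP.
  have [sg|sg] := boolP (i.1 == j.1).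
    have ne : i.2 != j.2 by apply: contra ij; rewrite -pair_eqE /= => ->; rewrite sg.
    apply: Or31; exists ((if i.2 then a else - a) / (2 * 'i)) => z.
    have := ha (if i.1 then z - c else z); rewrite /h -(eqP sg).
    move: ne; case: i.1; case: i.2; case: j.2 => // _; rewrite ?subrK => <-; by field.
  have [eg|eg] := boolP (i.2 == j.2).
    apply: Or33; exists ((if i.1 (+) i.2 then - a else a) / 'i) => z.
    have := ha z; rewrite /h -(eqP eg).
    move: sg; case: i.1; case: i.2; case: j.1 => // _ <-; rewrite /=; by field.
  apply: Or32; exists ((if i.2 then a else - a) / 'i) => z.
  have := ha z; rewrite /h.
  by move: sg eg; case: i.1; case: i.2; case: j.1; case: j.2 => // _ _ <-; rewrite /=; field.
have [cg|ncg] := pselect (constant_fun g); first exact: Or31.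

have nonzero_iii : b1 != 0 -> b2 != 0 ->
    [/\ exists z, peval d1 z * peval b1 (z + c) != 0 &
        exists z, peval d1 z ^+ 2 * peval p (z + c) * peval b1 (z + c) * peval b2 (z + c) != 0].
  move=> /sb10 n1 /sb20 n2; split.
    have [z hz] := peval_nonvanishing (mulf_neq0 d10 n1).
    by exists z; rewrite pevalM sb1E in hz.
  have [z hz] := peval_nonvanishing (mulf_neq0 (mulf_neq0 (mulf_neq0 (mulf_neq0 d10 d10) sp0) n1) n2).
  by exists z; move: hz; rewrite 4!pevalM spE sb1E sb2E expr2.
have zero_shift q q' : (forall z, peval q' z = peval q (z + c)) -> q' = 0 -> q = 0.
  by move=> h e; apply/eqP/negPn/negP => /(shift0 _ _ h); rewrite e eqxx.

have sol1 x y : k * x - 'i * y = 0 -> y = - ('i * k) * x.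
  move=> e; apply/eqP; rewrite -subr_eq0; apply/eqP.
  transitivity ('i * (k * x - 'i * y) + ('i * 'i + 1) * y); first by ring.
  by rewrite e i2 addNr mulr0 mul0r addr0.
have sol2 x y : k * x + 'i * y = 0 -> y = 'i * k * x.
  move=> e; apply/eqP; rewrite -subr_eq0; apply/eqP.
  transitivity (- 'i * (k * x + 'i * y) + ('i * 'i + 1) * y); first by ring.
  by rewrite e i2 addNr mulr0 mul0r addr0.
have B1 : b1 = 0 -> forall z, peval p4 z = - ('i * k) * peval p2 z.
  by move=> e z; apply: sol1; rewrite -b1E e peval0.
have B2 : b2 = 0 -> forall z, peval p4 z = 'i * k * peval p2 z.
  by move=> e z; apply: sol2; rewrite -b2E e peval0.
have B1t : b1t = 0 -> forall z, peval p6 z = - ('i * k) * peval p5 z.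
  by move=> e z; apply: sol1; rewrite -b1tE e peval0.
have B2t : b2t = 0 -> forall z, peval p6 z = 'i * k * peval p5 z.
  by move=> e z; apply: sol2; rewrite -b2tE e peval0.
have sb1_0 : b1 = 0 -> sb1 = 0 by move=> e; apply: peval_eq0 => z; rewrite sb1E e peval0.
have sb2_0 : b2 = 0 -> sb2 = 0 by move=> e; apply: peval_eq0 => z; rewrite sb2E e peval0.
have kk : 'i * k * ('i * k) = -1.
  by transitivity ('i * 'i * (k * k)); [ring|rewrite i2 k2 mulr1].
case: three => [//|[kap hk]|[kap hk]]; pose gam := cexp ('i * kap);
  have gam0 : gam != 0 := cexp_neq0 _.
- have gs z : cexp ('i * g (z + c)) = gam * cexp (- ('i * g z)).
    by rewrite /gam -(hk z) mulrDr cexpD -mulrA cexpNV divff ?mulr1 // cexp_neq0.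
  have gs' z : cexp (- ('i * g (z + c))) = gam^-1 * cexp ('i * g z).
    by rewrite cexpNV gs invfM cexpNV invrK.
  have [|E1 E2] := @borel_unit_inverse R n (sd * b1t - gam^-1 *: (d1 * sb2 * sp))
      (gam *: (d1 * sb1) - sd * b2t * p) g hg ncg.
    move=> z; have := rel z; rewrite gs gs' 2!pevalB 2!pevalZ 2!pevalN.
    exact: regroup_crossed_relation.
  have {E1}E1 : sd * b1t = gam^-1 *: (d1 * sb2 * sp) by apply/eqP; rewrite -subr_eq0 E1.
  have {E2}E2 : sd * b2t * p = gam *: (d1 * sb1) by apply/esym/eqP; rewrite -subr_eq0 E2.
  have e1 z : peval d1 (z + c) * peval b1t z =
      gam^-1 * (peval d1 z * peval b2 (z + c) * peval p (z + c)).
    by have := congr1 (fun q => peval q z) E1; rewrite pevalZ !pevalM sdE sb2E spE.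
  have e2 z : peval d1 (z + c) * peval b2t z * peval p z =
      gam * (peval d1 z * peval b1 (z + c)).
    by have := congr1 (fun q => peval q z) E2; rewrite pevalZ !pevalM sdE sb1E.
  have trg : transcendental g.
    split=> // -[m hm]; apply: ncg.
    have [|a ha] := @antiperiodic_mpoly R n m c kap; first by move=> z; rewrite -2!hm.
    by exists a => z; rewrite hm.
  have ratio al q : al != 0 -> q != 0 -> (forall z, gam * peval q z = al * peval p z) ->
      nonzero_constant_ratio p q.
    move=> al0 q0 h; split=> //; exists (gam / al); split; first by rewrite mulf_neq0 ?invr_eq0.
    by apply: peval_inj => z; rewrite pevalZ mulrAC h mulrAC divff ?mul1r.
  have [b10|b10] := eqVneq b1 0.
    have b2t0 : b2t = 0.
      move/eqP: E2; rewrite sb1_0 // mulr0 scaler0 !mulf_eq0 (negPf sd0) (negPf hp0) orbF.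
      by move/eqP.
    have P4 := B1 b10; have P6 := B2t b2t0.
    (* The relations [P4] and [P6] collapse the factor without zeros to a multiple of [p2], so [p2]
       itself has no zeros and is constant. *)
    have X2 z : X z = 2 * peval p2 z * f (z + c).
      rewrite XE P4 P6; transitivity ((1 - 'i * k * ('i * k)) * peval p2 z * f (z + c) +
        (1 + 'i * k * ('i * k)) * peval p5 z * f z); [by ring|rewrite kk; by ring].
    have [al [al0 p2E]] : nonzero_constant_poly p2.
      by apply: nowhere_zero_mpoly => z; apply: contraNneq (X0 z) => h; rewrite X2 h mulr0 mul0r.
    have p50 : p5 != 0.
      by apply: contraNneq d1z0 => h; rewrite d1E P6 h peval0 !mulr0 subrr.
    apply: Or32; split=> //; first by exists kap.
    right; split=> //; first by exists al.
    have pr z : peval p5 z * (gam * peval p5 (z + c) - al * peval p (z + c)) = 0.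
      have := e1 z; rewrite !d1E b2E b1tE !P4 !P6 p2E !pevalC => h.
      have u0 : 4 * 'i * al * gam^-1 != 0 by rewrite !mulf_neq0 ?invr_eq0 ?pnatr_eq0.
      apply: (mulfI u0); rewrite mulr0.
      exact: degenerate_relation1 i2 k2 gam0 h.
    have [h|h] := entire_mul_eq0 (@entire_peval _ _ p5) (entire_shift c (entireB
      (entireM (@entire_cst _ _ gam) (@entire_peval _ _ p5))
      (entireM (@entire_cst _ _ al) (@entire_peval _ _ p)))) pr.
      by case/eqP: p50; apply: peval_eq0.
    apply: (ratio al) => // z; apply/eqP; rewrite -subr_eq0; apply/eqP.
    by have := h (z - c); rewrite /shift_by subrK.
  have [b20|b20] := eqVneq b2 0.
    have b1t0 : b1t = 0.
      move/eqP: E1; rewrite sb2_0 // mulr0 mul0r scaler0 mulf_eq0 (negPf sd0) /=.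
      by move/eqP.
    have P4 := B2 b20; have P6 := B1t b1t0.
    have X2 z : X z = 2 * peval p5 z * f z.
      rewrite XE P4 P6; transitivity ((1 + 'i * k * ('i * k)) * peval p2 z * f (z + c) +
        (1 - 'i * k * ('i * k)) * peval p5 z * f z); [by ring|rewrite kk; by ring].
    have [al [al0 p5E]] : nonzero_constant_poly p5.
      by apply: nowhere_zero_mpoly => z; apply: contraNneq (X0 z) => h; rewrite X2 h mulr0 mul0r.
    have p20 : p2 != 0.
      by apply: contraNneq d1z0 => h; rewrite d1E P4 h peval0 !mulr0 !mul0r subrr.
    apply: Or32; split=> //; first by exists kap.
    left; split=> //; first by exists al.
    have pr z : peval p2 (z + c) * (gam * peval p2 z - al * peval p z) = 0.
      have := e2 z; rewrite !d1E b2tE b1E !P4 !P6 p5E !pevalC => h.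
      have u0 : 4 * 'i * al != 0 by rewrite !mulf_neq0 ?pnatr_eq0.
      by apply: (mulfI u0); rewrite mulr0; exact: degenerate_relation2 i2 k2 h.
    have [h|h] := entire_mul_eq0 (entire_shift c (@entire_peval _ _ p2)) (entireB
      (entireM (@entire_cst _ _ gam) (@entire_peval _ _ p2))
      (entireM (@entire_cst _ _ al) (@entire_peval _ _ p))) pr.
      case/eqP: p20; apply: peval_eq0 => z.
      by have := h (z - c); rewrite /shift_by subrK.
    by apply: (ratio al) => // z; apply/eqP; rewrite -subr_eq0; apply/eqP; exact: h.
  have [[zD hD] [zN hN]] := nonzero_iii b10 b20.
  have prod z : peval d1 z ^+ 2 * peval p (z + c) * peval b1 (z + c) * peval b2 (z + c) =
      peval d1 (z + c) ^+ 2 * peval p z * peval b1t z * peval b2t z.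
    have h1 := e1 z; have h2 := e2 z.
    exact: product_relation gam0 h1 h2.
  apply: Or33; split=> //.
    by move=> h; move/eqP: hN; apply; rewrite prod; exact: h.
  left; split; last by exists gam => z; rewrite /bar /shift_by hk.
  split; first by exists zD.
  move=> z nz; apply: (mulIf nz); rewrite mulfVK // [X in cexp ('i * X)]hk -/gam.
  by rewrite -e2 mulrAC.
have gs z : cexp ('i * g (z + c)) = gam * cexp ('i * g z).
  by rewrite /gam -(hk z) -cexpD -mulrDr subrK.
have gs' z : cexp (- ('i * g (z + c))) = gam^-1 * cexp (- ('i * g z)).
  by rewrite cexpNV gs invfM cexpNV.
have [|E1 E2] := @borel_unit_inverse R n (gam *: (d1 * sb1) + sd * b1t)
    (- (gam^-1 *: (d1 * sb2 * sp) + sd * b2t * p)) g hg ncg.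
  move=> z; have := rel z; rewrite gs gs' 3!pevalN 2!pevalD 2!pevalZ.
  exact: regroup_relation.
have {E1}E1 : sd * b1t = - (gam *: (d1 * sb1)) by apply/eqP; rewrite -addr_eq0 addrC E1.
have {E2}E2 : sd * b2t * p = - (gam^-1 *: (d1 * sb2 * sp)).
  by apply/eqP; rewrite -addr_eq0 addrC -oppr_eq0 E2.
have e1 z : peval d1 (z + c) * peval b1t z = - (gam * (peval d1 z * peval b1 (z + c))).
  by have := congr1 (fun q => peval q z) E1; rewrite pevalN pevalZ !pevalM sdE sb1E.
have e2 z : peval d1 (z + c) * peval b2t z * peval p z =
    - (gam^-1 * (peval d1 z * peval b2 (z + c) * peval p (z + c))).
  by have := congr1 (fun q => peval q z) E2; rewrite pevalN pevalZ !pevalM sdE sb2E spE.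
(* Now [E1] ties [b1] to [b1t] and [E2] ties [b2] to [b2t]. If one of them vanished, so would its
   partner, and then [d1]; the degenerate alternatives thus arise only when the sum is constant. *)
have b10 : b1 != 0.
  apply/eqP => b10; move/eqP: E1; rewrite sb1_0 // mulr0 scaler0 oppr0 mulf_eq0 (negPf sd0) /=.
  by move=> /eqP /B1t P6; move/eqP: d1z0; apply; rewrite d1E P6 (B1 b10); ring.
have b20 : b2 != 0.
  apply/eqP => b20; move/eqP: E2; rewrite sb2_0 // mulr0 mul0r scaler0 oppr0.
  rewrite !mulf_eq0 (negPf sd0) (negPf hp0) orbF /=.
  by move=> /eqP /B2t P6; move/eqP: d1z0; apply; rewrite d1E P6 (B2 b20); ring.
have [[zD hD] [zN hN]] := nonzero_iii b10 b20.
have prod z : peval d1 z ^+ 2 * peval p (z + c) * peval b1 (z + c) * peval b2 (z + c) =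
    peval d1 (z + c) ^+ 2 * peval p z * peval b1t z * peval b2t z.
  have h1 := e1 z; have h2 := e2 z.
  exact: product_relation' gam0 h1 h2.
apply: Or33; split=> //.
  by move=> h; move/eqP: hN; apply; rewrite prod; exact: h.
right; split; last by exists gam => z; rewrite /bar /shift_by hk.
split; first by exists zD.
move=> z nz; apply: (mulIf nz); rewrite mulfVK // [X in cexp ('i * X)]hk -/gam.
by rewrite /bar /shift_by e1 opprK.
Qed.
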